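(* Let $\mathcal W$ be a real-valued even tempered distribution on $\mathbb R$ with $\widehat{\mathcal W}\in L^\infty(\mathbb R)$. Assume that $\widehat{\mathcal W}$ is of class $C^2$ in a neighborhood of the origin, that $\widehat{\mathcal W}\ge0$ a.e. on $\mathbb R$, and that $\widehat{\mathcal W}(0)=1$. Suppose that either $(\widehat{\mathcal W})''(0)\ne-1$, or $(\widehat{\mathcal W})''=-1$ on a neighborhood of the origin. Then the equation $$i\sqrt2\,u'+u''+u\,\bigl(\mathcal W*(1-|u|^2)\bigr)=0\quad\text{in }\mathbb R$$ admits no nontrivial solution in $\mathcal E(\mathbb R)$.
   Context: Fourier transform convention: $\widehat f(\xi)=\int_{\mathbb R}e^{-ix\xi}f(x)\,dx$. For $f\in L^2(\mathbb R)$, $\mathcal W*f\in L^2(\mathbb R)$ is defined by $\widehat{\mathcal W*f}=\widehat{\mathcal W}\,\widehat f$. The energy space is $\mathcal E(\mathbb R)=\{v\in H^1_{\rm loc}(\mathbb R;\mathbb C): 1-|v|^2\in L^2(\mathbb R),\ v'\in L^2(\mathbb R)\}$. The equation is understood in the sense of distributions. The trivial solutions are the constant functions of modulus one; ''nontrivial'' means not one of these. *)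

(* Defs.v *)
From mathcomp Require Import all_boot all_order all_algebra.
From mathcomp Require Import all_classical all_reals all_analysis.
From mathcomp Require Export complex.
Set Implicit Arguments.
Unset Strict Implicit.
Unset Printing Implicit Defensive.
Import Order.TTheory GRing.Theory Num.Theory.
Import numFieldNormedType.Exports.
Local Open Scope classical_set_scope.
Local Open Scope ring_scope.
Local Open Scope complex_scope.

(* Calculus and integration of functions R -> R[i], component by component. *)

Definition reP (R : realType) (f : R -> R[i]) : R -> R := fun x => complex.Re (f x).
Definition imP (R : realType) (f : R -> R[i]) : R -> R := fun x => complex.Im (f x).

Definition cderive (R : realType) (n : nat) (f : R -> R[i]) : R -> R[i] :=
  fun x => derive1n n (reP f) x +i* derive1n n (imP f) x.

Definition cintegral (R : realType) (f : R -> R[i]) : R[i] :=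
  (\int[lebesgue_measure]_x reP f x)%R +i* (\int[lebesgue_measure]_x imP f x)%R.

Definition smooth (R : realType) (f : R -> R[i]) : Prop :=
  forall (n : nat) (x : R),
    derivable (derive1n n (reP f)) x 1 /\ derivable (derive1n n (imP f)) x 1.

Definition C2_near (R : realType) (a : R) (f : R -> R[i]) : Prop :=
  \forall x \near a, forall h : R -> R, h = reP f \/ h = imP f ->
    [/\ derivable h x 1, derivable (derive1n 1 h) x 1 &
        {for x, continuous (derive1n 2 h)}].

(* L^p(R; C). Elements are Borel representatives of the usual classes. *)
Definition Lp (R : realType) (p : \bar R) (f : R -> R[i]) : Prop :=
  reP f \in Lfun (@lebesgue_measure R) p /\
  imP f \in Lfun (@lebesgue_measure R) p.

Definition L2 (R : realType) (f : R -> R[i]) : Prop := Lp 2%:E f.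

Definition L2loc (R : realType) (f : R -> R[i]) : Prop :=
  forall K : set R, compact K -> L2 (fun x => (\1_K x)%:C * f x).

(* Test functions, Schwartz functions and distributions. A distribution is
   handled as a functional on all functions R -> R[i]; only its values on test
   functions (resp. Schwartz functions, in the tempered case) are meaningful. *)

Definition test_function (R : realType) (phi : R -> R[i]) : Prop :=
  smooth phi /\ compact (closure [set x | phi x != 0]).

Definition weighted_deriv (R : realType) (j k : nat) (phi : R -> R[i]) : R -> R :=
  fun x => `|x| ^+ j * Normc.normc (cderive k phi x).

Definition schwartz (R : realType) (phi : R -> R[i]) : Prop :=
  smooth phi /\ forall j k : nat, has_ubound (range (weighted_deriv j k phi)).

Definition schwartz_seminorm (R : realType) (j k : nat) (phi : R -> R[i]) : R :=
  sup (range (weighted_deriv j k phi)).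

Record tempered_distribution (R : realType) := TemperedDistribution {
  td_fun :> (R -> R[i]) -> R[i];
  td_linear : forall (a : R[i]) (phi psi : R -> R[i]),
    schwartz phi -> schwartz psi ->
    td_fun (fun x => a * phi x + psi x) = a * td_fun phi + td_fun psi;
  td_continuous : exists (N : nat) (K : R), forall phi : R -> R[i],
    schwartz phi ->
    Normc.normc (td_fun phi) <=
      K * \sum_(j < N.+1) \sum_(k < N.+1) schwartz_seminorm j k phi
}.

Definition td_real (R : realType) (W : tempered_distribution R) : Prop :=
  forall phi : R -> R[i], schwartz phi ->
    (forall x, complex.Im (phi x) = 0) -> complex.Im (W phi) = 0.

Definition td_even (R : realType) (W : tempered_distribution R) : Prop :=
  forall phi : R -> R[i], schwartz phi -> W (fun x => phi (- x)) = W phi.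

(* The functional phi |-> \int f phi attached to a function f. *)
Definition dist_of (R : realType) (f phi : R -> R[i]) : R[i] :=
  cintegral (fun x => f x * phi x).

Definition dist_deriv (R : realType) (T : (R -> R[i]) -> R[i])
    (phi : R -> R[i]) : R[i] :=
  - T (cderive 1 phi).

Definition expi (R : realType) (t : R) : R[i] := cos t +i* sin t.

Definition fourier (R : realType) (f : R -> R[i]) (xi : R) : R[i] :=
  cintegral (fun x => expi (- (x * xi)) * f x).

(* The Fourier transform of the tempered distribution T is the function F;
   on L^2(R), with T := dist_of f, this is the Fourier-Plancherel transform. *)
Definition fourier_is (R : realType) (T : (R -> R[i]) -> R[i]) (F : R -> R[i]) :
    Prop :=
  forall phi : R -> R[i], schwartz phi -> T (fourier phi) = dist_of F phi.

(* g = W * f for f in L^2(R), when the Fourier transform of W is bounded. *)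
Definition convolution_is (R : realType) (W : tempered_distribution R)
    (f g : R -> R[i]) : Prop :=
  L2 g /\
  exists What fhat : R -> R[i],
    [/\ Lp +oo%E What, fourier_is W What,
        L2 fhat, fourier_is (dist_of f) fhat &
        fourier_is (dist_of g) (fun xi => What xi * fhat xi)].

Definition weak_deriv (R : realType) (v dv : R -> R[i]) : Prop :=
  forall phi : R -> R[i], test_function phi ->
    dist_deriv (dist_of v) phi = dist_of dv phi.

Definition H1loc (R : realType) (v : R -> R[i]) : Prop :=
  L2loc v /\ exists dv : R -> R[i], weak_deriv v dv /\ L2loc dv.

Definition energy_space (R : realType) (v : R -> R[i]) : Prop :=
  [/\ H1loc v,
      L2 (fun x => 1 - `|v x| ^+ 2) &
      exists dv : R -> R[i], weak_deriv v dv /\ L2 dv].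

Definition is_solution (R : realType) (W : tempered_distribution R)
    (u : R -> R[i]) : Prop :=
  exists g : R -> R[i], convolution_is W (fun x => 1 - `|u x| ^+ 2) g /\
    forall phi : R -> R[i], test_function phi ->
      (0 +i* 1) * (Num.sqrt 2)%:C * dist_deriv (dist_of u) phi
      + dist_deriv (dist_deriv (dist_of u)) phi
      + dist_of (fun x => u x * g x) phi = 0.

(* Equality with a constant is almost everywhere, as u stands for its class. *)
Definition trivial_solution (R : realType) (u : R -> R[i]) : Prop :=
  exists c : R[i], `|c| = 1 /\
    {ae (@lebesgue_measure R), forall x, u x = c}.

(* Main.v *)
Require Import Defs.
From mathcomp Require Import all_boot all_order all_algebra.
From mathcomp Require Import all_classical all_reals all_analysis.
From mathcomp Require Import measurable_realfun ess_sup_inf.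
From mathcomp Require Import ring lra.
Import Order.TTheory GRing.Theory Num.Theory.
Import numFieldNormedType.Exports.
Local Open Scope classical_set_scope.
Local Open Scope ring_scope.

(** Write eta = 1 - |u|^2, g = W * eta and c = sqrt 2, so that the equation is
i c u' + u'' + u g = 0. A solution of finite energy has an absolutely continuous
representative U1 + i U2 whose derivative V1 + i V2 is absolutely continuous and
square integrable ([weak_deriv_prim], [solution_prim]).

Two quantities are followed along the line. The momentum U1 V2 - U2 V1 differs
from (c / 2) eta by a constant, and the finite energy forces this constant to
vanish ([momentum_identity]). The current Q = U1 V1 + U2 V2 satisfies
eta' = - 2 Q, and, since c^2 = 2, the momentum identity turns its equation into
Q' = |V|^2 + eta - g + eta g ([prim_current]). Integrating eta'' = - 2 Q' against
the Gaussian weight damp s x = exp (- s^2 x^2 / 2) gives ([weighted_identity])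

  int eta (- damp s'' - 2 damp s) + 2 int g (damp s)
    = 2 int (|V|^2 + eta g) (damp s).

On the Fourier side, let p be the real part of the transform of eta and w the
transform of W. The weight damp s is the transform of the normal density gauss s
of standard deviation s, and the left-hand side equals

  int p(t) (t^2 - 2 + 2 w(t)) (gauss s t) dt.

This is where the speed sqrt 2 is critical: as w(0) = 1 and w is differentiable
at 0, the symbol t^2 - 2 + 2 w(t) is O(|t| + t^2). Its product with gauss s then
tends to 0 in L^2 as s tends to 0, although the L^2 norm of gauss s grows like
s^(-1/2); as p is in L^2, the left-hand side tends to 0 ([symbol_vanish]).
The right-hand side tends to twice the integral of |V|^2 + eta g, which is
therefore 0 ([balance_Int0]).

By Plancherel, 2 pi times the integral of eta g is the integral of w times the
squared modulus of the transform of eta, which is nonnegative as w is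
([convolution_pairing_ge0]). Hence V = 0, so u is constant; then eta is a constant
in L^2, that is 0, and |u| = 1 ([solution_const]).

Fourier transforms enter only by duality with Schwartz functions. Every
pairing used here is with a translated and modulated Gaussian, possibly times a
polynomial, whose transform is explicit ([gauss_shift_trig], [gauss_t2cos_ft]).
Uniqueness of transforms and the Plancherel identity both follow from one fact:
the pairing of two L^2 functions is the limit of Gaussian mollified pairings
([moll_cvg]). *)

Set Implicit Arguments.
Unset Strict Implicit.
Unset Printing Implicit Defensive.

(** * Integrable and square-integrable functions on the line *)

Notation lebL1 f := ((@lebesgue_measure _).-integrable setT (EFin \o f)).
Notation Int f := (Rintegral (@lebesgue_measure _) setT f).

Notation L1prod F := ((@lebesgue_measure _ \x @lebesgue_measure _)%E.-integrable setT (EFin \o F)).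

Section Basics.
Context {R : realType}.
Notation mu := (@lebesgue_measure R).
Implicit Types f g h : R -> R.

Lemma ae_imp (P Q : R -> Prop) : {ae mu, forall x, P x} ->
  (forall x, P x -> Q x) -> {ae mu, forall x, Q x}.
Proof. by move=> aP PQ; apply: (@filterS _ _ (ae_filter_ringOfSetsType _) _ _ _ aP). Qed.

Lemma ae_and (P Q : R -> Prop) : {ae mu, forall x, P x} ->
  {ae mu, forall x, Q x} -> {ae mu, forall x, P x /\ Q x}.
Proof. by move=> aP aQ; apply: (@filterS2 _ _ (ae_filter_ringOfSetsType _) _ _ _ _ aP aQ). Qed.

Lemma L1_meas f : lebL1 f -> measurable_fun setT f.
Proof. by move/measurable_int/measurable_EFinP. Qed.

Lemma L1_ext f g : f =1 g -> lebL1 f -> lebL1 g.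
Proof. by move=> /funext ->. Qed.

Lemma L1D f g : lebL1 f -> lebL1 g -> lebL1 (fun x => f x + g x).
Proof. by move=> *; exact: (@integrableD _ _ _ mu _ measurableT (EFin \o f) (EFin \o g)). Qed.

Lemma L1B f g : lebL1 f -> lebL1 g -> lebL1 (fun x => f x - g x).
Proof. by move=> *; exact: (@integrableB _ _ _ mu _ measurableT (EFin \o f) (EFin \o g)). Qed.

Lemma L1Z (k : R) f : lebL1 f -> lebL1 (fun x => k * f x).
Proof. by move=> *; exact: (@integrableZl _ _ _ mu _ measurableT k (EFin \o f)). Qed.

Lemma L1N f : lebL1 f -> lebL1 (fun x => - f x).
Proof. by move=> /(L1Z (-1)); apply: L1_ext => x; rewrite mulN1r. Qed.

Lemma L1_abs f : lebL1 f -> lebL1 (fun x => `|f x|).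
Proof. by move=> *; exact: integrable_norm. Qed.

Lemma L1_le f g : measurable_fun setT f -> lebL1 g ->
  (forall x, `|f x| <= g x) -> lebL1 f.
Proof.
move=> mf ig fg; apply: (le_integrable measurableT _ _ ig).
  exact/measurable_EFinP.
by move=> x _ /=; rewrite lee_fin (le_trans (fg x))// ler_norm.
Qed.

Lemma L1_bM (M : R) (b f : R -> R) : measurable_fun setT b -> (forall x, `|b x| <= M) ->
  lebL1 f -> lebL1 (fun x => b x * f x).
Proof.
move=> mb bM L1f; apply: (L1_le _ (L1_abs (L1Z M L1f))).
  by apply: measurable_funM => //; exact: L1_meas.
move=> x; rewrite !normrM ler_wpM2r// (le_trans (bM x))// ler_norm//.
Qed.

Lemma IntD f g : lebL1 f -> lebL1 g ->
  Int (fun x => f x + g x) = Int f + Int g.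
Proof. by move=> *; rewrite RintegralD. Qed.

Lemma IntB f g : lebL1 f -> lebL1 g ->
  Int (fun x => f x - g x) = Int f - Int g.
Proof. by move=> *; rewrite RintegralB. Qed.

Lemma IntZ (k : R) f : lebL1 f -> Int (fun x => k * f x) = k * Int f.
Proof. by move=> *; rewrite RintegralZl. Qed.

Lemma IntN f : lebL1 f -> Int (fun x => - f x) = - Int f.
Proof.
by move=> /(IntZ (-1)); rewrite mulN1r => <-; apply: eq_Rintegral => x _; rewrite mulN1r.
Qed.

Lemma Int_ext f g : f =1 g -> Int f = Int g.
Proof. by move=> /funext ->. Qed.

Lemma Int0 : Int (fun _ : R => 0 : R) = 0.
Proof. by rewrite /Rintegral integral0. Qed.

Lemma Int_le f g : lebL1 f -> lebL1 g -> (forall x, f x <= g x) -> Int f <= Int g.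
Proof. by move=> *; apply: le_Rintegral. Qed.

Lemma Int_norm f : lebL1 f -> `|Int f| <= Int (fun x => `|f x|).
Proof. by move=> *; apply: le_normr_Rintegral. Qed.

Lemma Int_norm_le f g : lebL1 f -> lebL1 g -> (forall x, `|f x| <= g x) ->
  `|Int f| <= Int g.
Proof.
move=> L1f L1g fg; apply: (le_trans (Int_norm L1f)); apply: Int_le => //.
exact: L1_abs.
Qed.

Lemma Int_ge0 f : (forall x, 0 <= f x) -> 0 <= Int f.
Proof. by move=> f0; apply: Rintegral_ge0. Qed.

Lemma L1_ae f g : measurable_fun setT g -> {ae mu, forall x, f x = g x} ->
  lebL1 f -> lebL1 g.
Proof.
move=> mg fg /integrableP[mf If]; apply/integrableP; split.
  exact/measurable_EFinP.
rewrite (@ae_eq_integral _ _ _ mu setT (fun x => `|(EFin \o f) x|%E))//.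
- by apply: measurableT_comp => //; exact/measurable_EFinP.
- exact: measurableT_comp.
- by apply: (ae_imp fg) => x /= ->.
Qed.

Lemma Int_ae f g : measurable_fun setT f -> measurable_fun setT g ->
  {ae mu, forall x, f x = g x} -> Int f = Int g.
Proof.
move=> mf mg fg; rewrite /Rintegral; congr fine; apply: ae_eq_integral => //.
- exact/measurable_EFinP.
- exact/measurable_EFinP.
- by apply: (ae_imp fg) => x /= -> _.
Qed.

Lemma Int_EFin f : lebL1 f -> (Int f)%:E = (\int[mu]_x (f x)%:E)%E.
Proof. by move=> If; rewrite fineK//; exact: integrable_fin_num. Qed.

Lemma Int_eq0_ae f : lebL1 f -> (forall x, 0 <= f x) -> Int f = 0 ->
  {ae mu, forall x, f x = 0}.
Proof.
move=> If f0 I0.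
have mf : measurable_fun setT (EFin \o f) by apply/measurable_EFinP; exact: L1_meas.
have [h0 _] := @ae_eq_integral_abs _ _ _ mu _ measurableT _ mf.
have /h0 h : (\int[mu]_x `|(EFin \o f) x| = 0)%E.
  rewrite -[RHS]/(0%:E) -I0 Int_EFin//; apply: eq_integral => x _ /=.
  by rewrite ger0_norm.
by apply: (ae_imp h) => x /= /(_ I) [].
Qed.

Lemma Int_cvg_dom (F : nat -> R -> R) f g :
  (forall n, measurable_fun setT (F n)) -> measurable_fun setT f -> lebL1 g ->
  (forall n x, `|F n x| <= g x) ->
  {ae mu, forall x, F n x @[n --> \oo] --> f x} ->
  lebL1 f /\ Int (F n) @[n --> \oo] --> Int f.
Proof.
move=> mF mf Ig Fg cF.
have cE x : F n x @[n --> \oo] --> f x -> setT x -> (F n x)%:E @[n --> \oo] --> (f x)%:E.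
  by move=> cx _; apply: cvg_EFin => //; exact: nearW.
have Fg' n x : (`|(F n x)%:E| <= (EFin \o g) x)%E by rewrite /= lee_fin.
have [If _ cvI] := @dominated_convergence _ _ _ mu _ measurableT
  (fun n x => (F n x)%:E) (EFin \o f) (EFin \o g)
  (fun n => (measurable_EFinP _ _).2 (mF n)) ((measurable_EFinP _ _).2 mf)
  (ae_imp cF cE) Ig (@aeW _ _ _ mu _ (fun x n _ => Fg' n x)).
split => //; apply: fine_cvg; rewrite fineK//; exact: integrable_fin_num.
Qed.

(** Tonelli's theorem in the form used throughout: integrate the second
variable first, and dominate the result by an integrable function. *)
Lemma L1prod_crit (F : R * R -> R) (a : R -> R) : measurable_fun setT F ->
  (forall x, lebL1 (fun y => F (x, y))) ->
  lebL1 a -> (forall x, Int (fun y => `|F (x, y)|) <= a x) -> L1prod F.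
Proof.
move=> mF L1F L1a Fa.
apply/integrable12ltyP; first exact/measurable_EFinP.
have /integrableP[_] := L1a.
apply: le_lt_trans.
apply: ge0_le_integral => //.
- by move=> x _; apply: integral_ge0.
- apply: (@measurable_fun_fubini_tonelli_F _ _ _ _ _ mu (abse \o (EFin \o F))).
    by apply: measurableT_comp => //; exact/measurable_EFinP.
  by move=> x; exact: abse_ge0.
- by apply: measurableT_comp => //; apply/measurable_EFinP; exact: L1_meas.
- move=> x _ /=; rewrite -Int_EFin; last exact: L1_abs.
  by rewrite lee_fin (le_trans (Fa x))// ler_norm.
Qed.

(** The real-valued inner integrals agree with the extended ones outside the
null set of slices that are not integrable. *)
Lemma Fubini_Int (F : R * R -> R) : L1prod F ->
  lebL1 (fun x => Int (fun y => F (x, y))) /\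
  Int (fun x => Int (fun y => F (x, y))) = Int (fun y => Int (fun x => F (x, y))).
Proof.
move=> IF.
have F1 := ae_integrable1 IF.
have F2 := ae_integrable2 IF.
have mF1 := measurable_fubini_F IF.
have mF2 := measurable_fubini_G IF.
have I1 := integrable_fubini_F IF.
have E := Fubini IF.
have m1 : measurable_fun setT (fun x => Int (fun y => F (x, y))).
  exact: (measurableT_comp (fine_measurable measurableT) mF1).
have m2 : measurable_fun setT (fun y => Int (fun x => F (x, y))).
  exact: (measurableT_comp (fine_measurable measurableT) mF2).
have A1 : {ae mu, forall x, (Int (fun y => F (x, y)))%:E = (\int[mu]_y (F (x, y))%:E)%E}.
  by apply: (ae_imp F1) => x; exact: Int_EFin.
have A2 : {ae mu, forall y, (Int (fun x => F (x, y)))%:E = (\int[mu]_x (F (x, y))%:E)%E}.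
  by apply: (ae_imp F2) => y; exact: (@Int_EFin (fun x => F (x, y))).
split.
  move/integrableP: I1 => [_ I1].
  apply/integrableP; split; first exact/measurable_EFinP.
  apply: le_lt_trans I1; rewrite le_eqVlt; apply/orP; left; apply/eqP.
  apply: ae_eq_integral => //.
  - by apply: measurableT_comp => //; apply/measurable_EFinP.
  - by apply: measurableT_comp => //; exact: mF1.
  - by apply: (ae_imp A1) => x e _; congr abse; exact: e.
rewrite /Rintegral; congr fine.
transitivity (\int[mu]_x \int[mu]_y (F (x, y))%:E)%E.
  apply: ae_eq_integral => //.
  - exact/measurable_EFinP.
  - by apply: (ae_imp A1) => x /= -> _.
rewrite E; apply/esym; apply: ae_eq_integral => //.
- exact/measurable_EFinP.
- by apply: (ae_imp A2) => x /= -> _.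
Qed.

Lemma L1prod_swap (F : R * R -> R) : L1prod F -> L1prod (fun z => F (z.2, z.1)).
Proof.
move=> IF; have mF : measurable_fun setT (EFin \o F) := measurable_int _ IF.
have mG : measurable_fun setT (EFin \o (fun z : R * R => F (z.2, z.1))).
  apply: (measurableT_comp mF); apply/measurable_fun_pairP; split => /=.
    exact: measurable_snd.
  exact: measurable_fst.
apply: (proj2 (@integrable12ltyP _ _ _ _ R mu mu _ mG)).
exact: (proj1 (@integrable21ltyP _ _ _ _ R mu mu _ mF) IF).
Qed.

Lemma Int_reflect f : lebL1 f ->
  lebL1 (fun x => f (- x)) /\ Int (fun x => f (- x)) = Int f.
Proof.
move=> L1f; have mf := L1_meas L1f.
pose N : R -> measurableTypeR R := -%R.
have mN : measurable_fun [set: measurableTypeR R] N by exact: oppr_measurable.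
have E A : measurable A -> A `<=` setT -> mu A = pushforward mu N A.
  by move=> mA _; exact/esym/lebesgue_measureN.
have IfN : lebL1 (fun x => f (- x)).
  have /integrableP[_ If] := L1f.
  apply/integrableP; split; first by apply/measurable_EFinP; exact: measurableT_comp.
  apply: le_lt_trans If; rewrite le_eqVlt; apply/orP; left; apply/eqP/esym.
  rewrite (eq_measure_integral (pushforward mu N)) //.
  rewrite ge0_integral_pushforward//.
    by apply: measurableT_comp => //; apply/measurable_EFinP.
split => //; apply/esym; rewrite /Rintegral; congr fine.
rewrite (eq_measure_integral (pushforward mu N)) //.
rewrite integral_pushforward//.
exact/measurable_EFinP.
Qed.

Definition rL2 f := measurable_fun setT f /\ lebL1 (fun x => f x ^+ 2).

Lemma rL2_meas f : rL2 f -> measurable_fun setT f. Proof. by case. Qed.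

Lemma rL2_mul f g : rL2 f -> rL2 g -> lebL1 (fun x => f x * g x).
Proof.
move=> [mf If] [mg Ig]; apply: (L1_le _ (L1D If Ig)).
  exact: measurable_funM.
by move=> x; rewrite ler_norml; apply/andP; split; nra.
Qed.

Lemma rL2D f g : rL2 f -> rL2 g -> rL2 (fun x => f x + g x).
Proof.
move=> [mf If] [mg Ig]; split; first exact: measurable_funD.
apply: (L1_le _ (L1Z 2 (L1D If Ig))).
  by apply: measurable_funX; exact: measurable_funD.
move=> x; rewrite ger0_norm ?sqr_ge0//; have := sqr_ge0 (f x - g x).
by rewrite !expr2; lra.
Qed.

Lemma rL2_bM (M : R) (b f : R -> R) : measurable_fun setT b -> (forall x, `|b x| <= M) ->
  rL2 f -> rL2 (fun x => b x * f x).
Proof.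
move=> mb bM [mf If]; split; first exact: measurable_funM.
apply: (L1_le _ (L1Z (M ^+ 2) If)).
  by apply: measurable_funX; exact: measurable_funM.
move=> x; rewrite ger0_norm ?sqr_ge0// exprMn ler_wpM2r ?sqr_ge0//.
rewrite -[b x ^+ 2]real_normK ?num_real//.
by rewrite lerXn2r ?nnegrE//; exact: le_trans (bM x).
Qed.

Lemma rL2Z (k : R) f : rL2 f -> rL2 (fun x => k * f x).
Proof. by move=> hf; apply: (@rL2_bM `|k| (fun _ => k)) hf. Qed.

Lemma rL2_ext f g : f =1 g -> rL2 f -> rL2 g.
Proof. by move=> /funext ->. Qed.

Lemma rL2B f g : rL2 f -> rL2 g -> rL2 (fun x => f x - g x).
Proof.
move=> hf /(rL2Z (-1)) hg; apply: (rL2_ext _ (rL2D hf hg)) => x.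
by rewrite mulN1r.
Qed.

Lemma amgm (t x y : R) : 0 < t -> `|x * y| <= t * x ^+ 2 + t^-1 * y ^+ 2.
Proof.
move=> t0; have tV : 0 < t^-1 by rewrite invr_gt0.
have tt : t * t^-1 = 1 by rewrite mulfV// gt_eqF.
rewrite ler_norml; apply/andP; split.
  have : 0 <= t^-1 * (t * x + y) ^+ 2 by rewrite mulr_ge0 ?sqr_ge0// ltW.
  have : 0 <= t * x ^+ 2 by rewrite mulr_ge0 ?sqr_ge0// ltW.
  have : 0 <= t^-1 * y ^+ 2 by rewrite mulr_ge0 ?sqr_ge0// ltW.
  have -> : t^-1 * (t * x + y) ^+ 2 = (t * t^-1) * t * x ^+ 2 + 2 * (t * t^-1) * x * y + t^-1 * y ^+ 2 by ring.
  by rewrite tt; lra.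
have : 0 <= t^-1 * (t * x - y) ^+ 2 by rewrite mulr_ge0 ?sqr_ge0// ltW.
have : 0 <= t * x ^+ 2 by rewrite mulr_ge0 ?sqr_ge0// ltW.
have : 0 <= t^-1 * y ^+ 2 by rewrite mulr_ge0 ?sqr_ge0// ltW.
have -> : t^-1 * (t * x - y) ^+ 2 = (t * t^-1) * t * x ^+ 2 - 2 * (t * t^-1) * x * y + t^-1 * y ^+ 2 by ring.
by rewrite tt; lra.
Qed.

(** A substitute for the Cauchy-Schwarz inequality without square roots of
integrals: optimizing the weight [t] would give it back up to a constant factor. *)
Lemma Int_mul_amgm (t : R) f g : 0 < t -> rL2 f -> rL2 g ->
  `|Int (fun x => f x * g x)| <=
    t * Int (fun x => f x ^+ 2) + t^-1 * Int (fun x => g x ^+ 2).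
Proof.
move=> t0 hf hg; have [mf Lf] := hf; have [mg Lg] := hg.
rewrite -(IntZ t Lf) -(IntZ t^-1 Lg) -IntD; [|exact: L1Z|exact: L1Z].
apply: Int_norm_le; first exact: rL2_mul.
  by apply: L1D; exact: L1Z.
by move=> x; exact: amgm.
Qed.

Lemma Lfun2_rL2 f : f \in Lfun mu 2%:E -> rL2 f.
Proof.
move=> hf; split; last exact: Lfun2_integrable_sqr.
by move: hf; rewrite inE => /andP[]; rewrite inE.
Qed.

Lemma Lfuny_bounded f : f \in Lfun mu +oo%E -> measurable_fun setT f /\
  exists M : R, 0 <= M /\ {ae mu, forall x, `|f x| <= M}.
Proof.
rewrite inE => /andP[]; rewrite inE /= => mf; rewrite inE /= /finite_norm unlock.
have mT : (0 < mu [set: R])%E.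
  by rewrite -set_itvNyy lebesgue_measure_itv /= ltry.
rewrite mT => fin; split => //.
have := ess_sup_ge mu (abse \o (EFin \o f)).
move: fin; case: (ess_sup _ _) => [r _ h|//|_ h].
  exists (Num.max 0 r); split; first by rewrite le_max lexx.
  by apply: (ae_imp h) => x /=; rewrite lee_fin le_max => ->; rewrite orbT.
by exists 0; split => //; apply: (ae_imp h) => x /=; rewrite leeNy_eq.
Qed.

End Basics.

(** * Gaussian averages at Lebesgue points *)

Section Lpt.
Context {R : realType}.
Notation mu := (@lebesgue_measure R).
Implicit Types f g h : R -> R.

Lemma L1_ind_itv (b0 b1 : bool) (a b : R) :
  lebL1 (\1_[set` Interval (BSide b0 a) (BSide b1 b)] : R -> R).
Proof. exact: integrable_indic_itv. Qed.

Lemma bnd_locint h (M : R) : measurable_fun setT h -> (forall x, `|h x| <= M) ->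
  locally_integrable setT h.
Proof.
move=> mh hM; split => //; first exact: openT.
move=> K _ cK.
have mK := compact_measurable cK.
have fK : (mu K < +oo)%E by exact: compact_finite_measure.
apply: (@le_lt_trans _ _ (\int[mu]_(x in K) (M%:E))%E).
  apply: ge0_le_integral => //.
  - apply/measurable_EFinP; apply: measurableT_comp => //.
    exact: measurable_funS mh.
  - by move=> x _; rewrite lee_fin.
by rewrite integral_cst//= lte_mul_pinfty// lee_fin (le_trans (normr_ge0 _) (hM 0)).
Qed.

(** The mean of the oscillation over the ball is eventually below e / 2, and the
ball has length 2 r. *)
Lemma lebesgue_pt_le h (x : R) : locally_integrable setT h ->
  lebesgue_pt h x -> forall e : R, 0 < e -> exists d : R, 0 < d /\
    forall r : R, 0 < r < d ->
      lebL1 (fun y : R => \1_`]x - r, x + r[ y * `|h y - h x|) /\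
      Int (fun y : R => \1_`]x - r, x + r[ y * `|h y - h x|) <= e * r.
Proof.
move=> hloc hx e e0.
have e2 : (0 < (e / 2)%:E)%E by rewrite lte_fin divr_gt0.
have [d /= d0 hd] := hx _ (open_ereal_lt_ereal e2).
exists d; split => // r /andP[r0 rd].
have /= := hd r; rewrite /ball_ /= sub0r normrN gtr0_norm// => /(_ rd r0).
rewrite /davg /iavg (lebesgue_measure_ball _ (ltW r0)).
set I := (\int[mu]_(y in _) _)%E.
have EI : I = (\int[mu]_y (\1_`]x - r, x + r[ y * `|h y - h x|)%:E)%E.
  rewrite /I integral_mkcond; apply: eq_integral => y _.
  by rewrite epatch_indic /= ball_itv mulrC EFinM muleC muleC.
have mh : measurable_fun setT h by case: hloc.
have mF : measurable_fun setT (fun y : R => \1_`]x - r, x + r[ y * `|h y - h x|).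
  apply: measurable_funM => //; apply: measurableT_comp => //.
  exact: measurable_funB.
have F0 y : 0 <= (\1_`]x - r, x + r[ y : R) * `|h y - h x| by rewrite mulr_ge0.
have I0 : (0 <= I)%E by rewrite EI; apply: integral_ge0 => y _; rewrite lee_fin.
move=> hI.
have [v vI] : exists v : R, I = v%:E.
  move: hI I0; case: I {EI} => [v _ _|/=|//]; first by exists v.
  rewrite inver mulrn_eq0 /= gt_eqF//= gt0_muley// lte_fin invr_gt0.
  by rewrite mulrn_wgt0.
have L : lebL1 (fun y : R => \1_`]x - r, x + r[ y * `|h y - h x|).
  apply/integrableP; split; first exact/measurable_EFinP.
  under eq_integral do rewrite /= ger0_norm//.
  by rewrite -EI vI ltry.
split => //;
rewrite -lee_fin Int_EFin// -EI vI lee_fin.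
move: hI; rewrite vI inver mulrn_eq0 /= gt_eqF//= -EFinM lte_fin.
rewrite mulrC ltr_pdivrMr ?mulrn_wgt0// => /ltW/le_trans; apply.
by rewrite -mulr_natr; lra.
Qed.

(** The centred normal density of standard deviation [s]. *)
Definition gauss (s z : R) : R := normal_peak s * expR (- z ^+ 2 / (s ^+ 2 *+ 2)).

Lemma gauss_pdf (s a x : R) : s != 0 -> gauss s (x - a) = normal_pdf a s x.
Proof. by move=> s0; rewrite normal_pdfE. Qed.

Lemma gaussN s z : gauss s (- z) = gauss s z.
Proof. by rewrite /gauss sqrrN. Qed.

Lemma gaussC s (x y : R) : gauss s (x - y) = gauss s (y - x).
Proof. by rewrite -gaussN opprB. Qed.

Lemma gauss_ge0 s z : 0 <= gauss s z.
Proof. by rewrite mulr_ge0 ?normal_peak_ge0// expR_ge0. Qed.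

Lemma gauss_le s z : gauss s z <= normal_peak s.
Proof.
rewrite ler_piMr ?normal_peak_ge0// -[leRHS]expR0 ler_expR mulNr oppr_le0.
by rewrite divr_ge0 ?sqr_ge0// mulrn_wge0// sqr_ge0.
Qed.

Lemma normal_peak_le (s : R) : 0 < s -> normal_peak s <= s^-1.
Proof.
move=> s0; rewrite /normal_peak lef_pV2 ?posrE//; last first.
  by rewrite sqrtr_gt0 mulrn_wgt0// mulr_gt0 ?exprn_gt0// pi_gt0.
rewrite -[leLHS]ger0_norm ?(ltW s0)// -sqrtr_sqr ler_sqrt; last first.
  by rewrite mulrn_wge0// mulr_ge0 ?sqr_ge0// ltW// pi_gt0.
have := pi_ge2 R; have := sqr_ge0 s; rewrite -mulr_natr; nra.
Qed.

Lemma meas_gauss s : measurable_fun setT (gauss s).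
Proof.
apply: measurable_funM => //; apply: measurableT_comp => //.
by apply: measurable_funM => //; apply: measurableT_comp.
Qed.

Lemma meas_gauss_shift s (a : R) : measurable_fun setT (fun y : R => gauss s (a - y)).
Proof. by apply: (measurableT_comp (meas_gauss s)); exact: measurable_funB. Qed.

Lemma gauss_L1 s a : s != 0 -> lebL1 (fun y => gauss s (a - y)).
Proof.
move=> s0; apply: (L1_ext (f := normal_pdf a s)) => [x|].
  by rewrite -gauss_pdf// gaussC.
exact: integrable_normal_pdf.
Qed.

Lemma gauss_Int s a : s != 0 -> Int (fun y => gauss s (a - y)) = 1.
Proof.
move=> s0; rewrite -(Int_ext (f := normal_pdf a s)) => [|x]; last first.
  by rewrite -gauss_pdf// gaussC.
by rewrite /Rintegral integral_normal_pdf.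
Qed.

Lemma gauss_IntZ s (c a : R) : s != 0 -> Int (fun y => c * gauss s (a - y)) = c.
Proof. by move=> s0; rewrite (IntZ c (gauss_L1 a s0)) gauss_Int// mulr1. Qed.

Lemma gauss_IntZr s (c a : R) : s != 0 -> Int (fun y => c * gauss s (y - a)) = c.
Proof.
move=> s0; rewrite -{2}(gauss_IntZ c a s0); apply: Int_ext => y.
by rewrite gaussC.
Qed.

Lemma normal_peak2 (s : R) : normal_peak (2 * s) = 2^-1 * normal_peak s.
Proof.
rewrite /normal_peak exprMn -mulrA -mulrnAr sqrtrM ?sqr_ge0//.
by rewrite sqrtr_sqr ger0_norm// invfM.
Qed.

(** At distance at least r standard deviations the density is dominated by the one
with twice the deviation, times a factor that is small in [r] uniformly in [s].
As both densities have mass 1, this controls the mass of the tails. *)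
Lemma gauss_tail (s r z : R) : 0 < s -> 0 <= r -> r * s <= `|z| ->
  gauss s z <= 2 * expR (- (3/8) * r ^+ 2) * gauss (2 * s) z.
Proof.
move=> s0 r0 rz; rewrite /gauss normal_peak2.
rewrite [leRHS](_ : _ = normal_peak s * (expR (- (3/8) * r ^+ 2) * expR (- z ^+ 2 / ((2 * s) ^+ 2 *+ 2)))); last by field.
rewrite ler_wpM2l ?normal_peak_ge0// -expRD ler_expR.
have s20 : 0 < s ^+ 2 by rewrite exprn_gt0.
have -> : - z ^+ 2 / ((2 * s) ^+ 2 *+ 2) = - (z ^+ 2 / s ^+ 2) / 8 by field; lra.
have -> : - z ^+ 2 / (s ^+ 2 *+ 2) = - (z ^+ 2 / s ^+ 2) / 2 by field; lra.
have : r ^+ 2 <= z ^+ 2 / s ^+ 2.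
  rewrite ler_pdivlMr// -exprMn -[leRHS]real_normK ?num_real//.
  by rewrite lerXn2r ?nnegrE// mulr_ge0// ltW.
lra.
Qed.

Lemma conv_L1_bnd s x (M : R) h : s != 0 -> measurable_fun setT h ->
  (forall y, `|h y| <= M) -> lebL1 (fun y => gauss s (x - y) * h y).
Proof.
move=> s0 mh hM; apply: (L1_ext (f := fun y => h y * gauss s (x - y))) => [y|].
  by rewrite mulrC.
by apply: (@L1_bM _ M) => //; exact: gauss_L1.
Qed.

(** Within r standard deviations the density is at most s^-1, and the Lebesgue
point controls the oscillation; beyond, [gauss_tail] does. *)
Lemma moll_pt h (M x : R) : measurable_fun setT h -> (forall y, `|h y| <= M) ->
  lebesgue_pt h x ->
  Int (fun y => gauss n.+1%:R^-1 (x - y) * h y) @[n --> \oo] --> h x.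
Proof.
move=> mh hM hx.
apply/cvgrPdist_le => /= e e0.
have M0 : 0 <= M by exact: le_trans (normr_ge0 _) (hM 0).
(* the tail estimate needs 8 M <= e (1 + 3 / 8 r^2), by exp y >= 1 + y *)
pose r := 1 + 32 * M / e.
have r1 : 1 <= r by rewrite lerDl divr_ge0// ?mulr_ge0// ltW.
have er0 : 0 < e / (2 * r) by rewrite divr_gt0//; lra.
have [d [d0 hd]] := lebesgue_pt_le (bnd_locint mh hM) hx er0.
have tailE : 4 * M * expR (- (3/8) * r ^+ 2) <= e / 2.
  have E1 : 0 < expR (- (3/8) * r ^+ 2) by exact: expR_gt0.
  have E2 : expR (- (3/8) * r ^+ 2) * expR ((3/8) * r ^+ 2) = 1.
    by rewrite -expRD (_ : _ + _ = 0) ?expR0//; ring.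
  have E3 : 1 + (3/8) * r ^+ 2 <= expR ((3/8) * r ^+ 2) by exact: expR_ge1Dx.
  have E4 : 8 * M <= e * (1 + (3/8) * r ^+ 2).
    have : r <= r ^+ 2 by rewrite expr2; nra.
    have : e * r = e + 32 * M by rewrite /r; field; lra.
    nra.
  have E5 : (1 + (3/8) * r ^+ 2) * expR (- (3/8) * r ^+ 2) <= 1.
    by rewrite -[leRHS]E2 [leRHS]mulrC ler_wpM2r ?(ltW E1)//.
  have E6 : e * ((1 + (3/8) * r ^+ 2) * expR (- (3/8) * r ^+ 2)) <= e * 1.
    by rewrite ler_wpM2l ?(ltW e0)//.
  have E7 : 8 * M * expR (- (3/8) * r ^+ 2) <= e * (1 + (3/8) * r ^+ 2) * expR (- (3/8) * r ^+ 2).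
    by rewrite ler_wpM2r ?(ltW E1)//.
  lra.
have : \forall n \near \oo, (n.+1%:R^-1 : R) < d / r.
  have dr0 : 0 < d / r by rewrite divr_gt0//; lra.
  exact: (near_infty_natSinv_lt (PosNum dr0)).
apply: filterS => n hn.
set s : R := n.+1%:R^-1 in hn *.
have s0 : 0 < s by rewrite invr_gt0.
have sn0 : s != 0 by rewrite gt_eqF.
have [|L I] := hd (r * s).
  rewrite mulr_gt0//=; last by lra.
  by rewrite mulrC -ltr_pdivlMr//; lra.
have s2n0 : 2 * s != 0 by rewrite gt_eqF// mulr_gt0.
have Lg := gauss_L1 x sn0.
have Lgh := conv_L1_bnd x sn0 mh hM.
have -> : h x - Int (fun y => gauss s (x - y) * h y) =
    Int (fun y => gauss s (x - y) * (h x - h y)).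
  rewrite -[h x in LHS]mulr1 -(gauss_Int x sn0) -IntZ// -IntB//; last exact: L1Z.
  by apply: Int_ext => y; ring.
apply: (@le_trans _ _ (Int (fun y => s^-1 * (\1_`]x - r * s, x + r * s[ y * `|h y - h x|)
   + (4 * M * expR (- (3/8) * r ^+ 2)) * gauss (2 * s) (x - y)))).
  apply: Int_norm_le.
  - apply: (L1_ext (f := fun y => h x * gauss s (x - y) - gauss s (x - y) * h y)).
      by move=> y; ring.
    by apply: L1B => //; exact: L1Z.
  - by apply: L1D; apply: L1Z => //; exact: gauss_L1.
  - move=> y; rewrite normrM ger0_norm ?gauss_ge0// distrC.
    have [yr|yr] := ltP `|x - y| (r * s).
      rewrite indicE mem_set /=; last first.
        by move: yr; rewrite ltr_norml in_itv /= => /andP[? ?]; apply/andP; split; lra.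
      rewrite mul1r ler_wpDr//.
        by rewrite mulr_ge0 ?gauss_ge0// !mulr_ge0// expR_ge0.
      rewrite ler_wpM2r//; apply: le_trans (gauss_le _ _) _; exact: normal_peak_le.
    rewrite ler_wpDl//.
      by rewrite mulr_ge0 ?invr_ge0 ?(ltW s0)// mulr_ge0.
    apply: (@le_trans _ _ (gauss s (x - y) * (2 * M))).
      rewrite ler_wpM2l ?gauss_ge0//.
      by have := ler_normB (h y) (h x); have := hM x; have := hM y; lra.
    apply: (@le_trans _ _ (2 * expR (- (3/8) * r ^+ 2) * gauss (2 * s) (x - y) * (2 * M))).
      by rewrite ler_wpM2r ?mulr_ge0// gauss_tail//; lra.
    by rewrite le_eqVlt; apply/orP; left; apply/eqP; ring.
rewrite IntD; [|exact: L1Z|by apply: L1Z; exact: gauss_L1].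
rewrite (IntZ _ (gauss_L1 x s2n0)) (gauss_Int x s2n0) mulr1 (IntZ _ L).
apply: (@le_trans _ _ (e / 2 + e / 2)); last by lra.
apply: lerD => //.
rewrite ler_pdivrMl//; apply: (le_trans I).
by rewrite le_eqVlt; apply/orP; left; apply/eqP; field; lra.
Qed.

End Lpt.

(** * Gaussian mollification of pairings of square-integrable functions *)

Section Moll.
Context {R : realType}.
Notation mu := (@lebesgue_measure R).
Implicit Types f g h A : R -> R.

(** The Fourier transform of [gauss s], see [gauss_cos_ft]; as a function of x it
is a multiple of [gauss s^-1], so it is both a cut-off at distance 1 / s and a
Gaussian. *)
Definition damp (s x : R) : R := expR (- (s ^+ 2 * x ^+ 2) / 2).

Lemma damp_ge0 s x : 0 <= damp s x. Proof. exact: expR_ge0. Qed.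

Lemma damp_le1 s x : damp s x <= 1.
Proof.
rewrite -[leRHS]expR0 ler_expR mulNr oppr_le0 divr_ge0// mulr_ge0// sqr_ge0//.
Qed.

Lemma meas_damp s : measurable_fun setT (damp s).
Proof.
apply: measurableT_comp => //; apply: measurable_funM => //.
by apply: measurableT_comp => //; apply: measurable_funM.
Qed.

Lemma invn_cvg0 : (n.+1%:R^-1 : R) @[n --> \oo] --> (0 : R).
Proof. exact: cvg_harmonic. Qed.

Lemma damp_cvg (x : R) : damp n.+1%:R^-1 x @[n --> \oo] --> (1 : R).
Proof.
suff : damp n.+1%:R^-1 x @[n --> \oo] --> damp 0 x.
  by rewrite {2}/damp expr0n /= !mul0r oppr0 mul0r expR0.
apply: (cvg_comp (fun n : nat => n.+1%:R^-1 : R) (fun s => damp s x) invn_cvg0).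
rewrite /damp; apply: (cvg_comp (fun s => - (s ^+ 2 * x ^+ 2) / 2) expR); last exact: continuous_expR.
apply: cvgMl; apply: (@cvgN _ R^o); apply: cvgMl.
exact: sqr_continuous.
Qed.

Opaque Rintegral gauss damp.

Lemma meas_gauss2 s : measurable_fun setT (fun z : R * R => gauss s (z.1 - z.2)).
Proof.
apply: (measurableT_comp (meas_gauss s)).
by apply: measurable_funB; [exact: measurable_fst|exact: measurable_snd].
Qed.

Lemma gauss_rL2 s (a : R) : s != 0 -> rL2 (fun y => gauss s (a - y)).
Proof.
move=> s0; split; first exact: meas_gauss_shift.
apply: (L1_ext (f := fun y => gauss s (a - y) * gauss s (a - y))) => //.
apply: (@L1_bM _ (normal_peak s)); first exact: meas_gauss_shift.
  by move=> x; rewrite ger0_norm ?gauss_ge0// gauss_le.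
exact: gauss_L1.
Qed.

(** Schur's test: gauss is a probability density in each of its two variables. *)
Lemma schur_L1prod s (a : R -> R) : s != 0 -> lebL1 a ->
  L1prod (fun z : R * R => a z.1 * gauss s (z.1 - z.2)).
Proof.
move=> s0 La.
apply: (L1prod_crit (a := fun x => `|a x|)).
- apply: measurable_funM; last exact: meas_gauss2.
  by apply: (measurableT_comp (L1_meas La)); exact: measurable_fst.
- by move=> x /=; apply: L1Z; exact: gauss_L1.
- exact: L1_abs.
- move=> x /=; rewrite (Int_ext (g := fun y => `|a x| * gauss s (x - y))).
    by rewrite IntZ ?gauss_Int ?mulr1//; exact: gauss_L1.
  by move=> y; rewrite normrM (ger0_norm (gauss_ge0 _ _)).
Qed.

Lemma schur_L1prod2 s (b : R -> R) : s != 0 -> lebL1 b ->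
  L1prod (fun z : R * R => b z.2 * gauss s (z.1 - z.2)).
Proof.
move=> s0 /(schur_L1prod s0)/L1prod_swap /=.
by apply: eq_integrable => // z _ /=; rewrite gaussC.
Qed.

(** By |A h| <= A^2 + h^2 the kernel splits into two Schur kernels. The bounded
factor [e] is there for the cut-off [damp]. *)
Lemma moll_L1prod s (e A h : R -> R) : s != 0 -> measurable_fun setT e ->
  (forall x, `|e x| <= 1) -> rL2 A -> rL2 h ->
  L1prod (fun z : R * R => e z.1 * A z.1 * (gauss s (z.1 - z.2) * h z.2)).
Proof.
move=> s0 me e1 [mA LA] [mh Lh].
have D := integrableD measurableT (schur_L1prod s0 LA) (schur_L1prod2 s0 Lh).
apply: (le_integrable measurableT _ _ D).
  apply/measurable_EFinP; apply: measurable_funM; apply: measurable_funM.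
  - by apply: (measurableT_comp me); exact: measurable_fst.
  - by apply: (measurableT_comp mA); exact: measurable_fst.
  - exact: meas_gauss2.
  - by apply: (measurableT_comp mh); exact: measurable_snd.
have K (x y : R) : `|e x * A x * (gauss s (x - y) * h y)| <=
    `|A x ^+ 2 * gauss s (x - y) + h y ^+ 2 * gauss s (x - y)|.
  have g0 := gauss_ge0 s (x - y).
  rewrite (ger0_norm (_ : 0 <= A x ^+ 2 * _ + _)); last first.
    by rewrite addr_ge0// mulr_ge0// sqr_ge0.
  rewrite (normrM (e x * A x)) (normrM (e x)) (normrM (gauss s (x - y))) (ger0_norm g0).
  rewrite -mulrDl mulrCA mulrC ler_wpM2r//.
  apply: (@le_trans _ _ (`|A x| * `|h y|)).
    by rewrite -mulrA ler_piMl// mulr_ge0.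
  rewrite -[A x ^+ 2]real_normK ?num_real// -[h y ^+ 2]real_normK ?num_real//.
  by have := sqr_ge0 (`|A x| - `|h y|); have := normr_ge0 (A x); have := normr_ge0 (h y); nra.
by move=> [x y] _ /=; rewrite lee_fin.
Qed.

(** The pairing of [A] with the Gaussian mean of [h]. The cut-off makes the
integrals absolutely convergent after the Fourier transforms of both arguments
have been inserted, as in [moll_plancherel]. *)
Definition moll (s : R) (A h : R -> R) : R :=
  Int (fun x => damp s x * A x * Int (fun y => gauss s (x - y) * h y)).

Lemma mollE s (A h : R -> R) : s != 0 -> rL2 A -> rL2 h ->
  lebL1 (fun x => damp s x * A x * Int (fun y => gauss s (x - y) * h y)) /\
  moll s A h = Int (fun x => Int (fun y => damp s x * A x * (gauss s (x - y) * h y))).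
Proof.
move=> s0 hA hh.
have d1 x : `|damp s x| <= 1 by rewrite ger0_norm ?damp_ge0// damp_le1.
have E x : Int (fun y => damp s x * A x * (gauss s (x - y) * h y)) =
  damp s x * A x * Int (fun y => gauss s (x - y) * h y).
  by apply: IntZ; apply: rL2_mul => //; exact: gauss_rL2.
have [L _] := Fubini_Int (moll_L1prod s0 (meas_damp s) d1 hA hh).
split; first by apply: (L1_ext _ L) => x /=; rewrite E.
by apply: Int_ext => x; rewrite E.
Qed.

(** The bound does not depend on [s]; this is what the density argument of
[moll_cvg] needs. *)
Lemma moll_bnd (t s : R) A h : 0 < t -> s != 0 -> rL2 A -> rL2 h ->
  `|moll s A h| <= t * Int (fun x => A x ^+ 2) + t^-1 * Int (fun x => h x ^+ 2).
Proof.
move=> t0 s0 hA hh.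
have [L E] := mollE s0 hA hh.
have d1 x : `|damp s x| <= 1 by rewrite ger0_norm ?damp_ge0// damp_le1.
have P1 := schur_L1prod s0 (proj2 hA).
have P2 := schur_L1prod2 s0 (proj2 hh).
have [L1 E1] := Fubini_Int P1.
have [L2 E2] := Fubini_Int P2.
have <- : Int (fun x => Int (fun y => A x ^+ 2 * gauss s (x - y))) = Int (fun x => A x ^+ 2).
  by apply: Int_ext => x; exact: gauss_IntZ.
have <- : Int (fun x => Int (fun y => h y ^+ 2 * gauss s (x - y))) = Int (fun x => h x ^+ 2).
  by apply: (etrans E2); apply: Int_ext => y; exact: (gauss_IntZr (h y ^+ 2) y s0).
rewrite -(IntZ t L1) -(IntZ t^-1 L2) -IntD; [|exact: L1Z|exact: L1Z].
apply: Int_norm_le; [exact: L|apply: L1D; [exact: (L1Z t L1)|exact: (L1Z t^-1 L2)]|].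
clear L E d1 P1 P2 L1 E1 L2 E2.
move=> x; rewrite -mulrA normrM (ger0_norm (damp_ge0 _ _)).
apply: (@le_trans _ _ `|A x * Int (fun y => gauss s (x - y) * h y)|).
  exact: ler_piMl (normr_ge0 _) (damp_le1 _ _).
have gb y : `|gauss s (x - y)| <= normal_peak s.
  by rewrite ger0_norm ?gauss_ge0// gauss_le.
have Lh : lebL1 (fun y => h y ^+ 2 * gauss s (x - y)).
  apply: (L1_ext (f := fun y => gauss s (x - y) * h y ^+ 2)); first by move=> y; rewrite mulrC.
  exact: (L1_bM (meas_gauss_shift _ _) gb (proj2 hh)).
have LA : lebL1 (fun y => A x ^+ 2 * gauss s (x - y)) by apply: L1Z; exact: gauss_L1.
have Lg : lebL1 (fun y => gauss s (x - y) * h y) by apply: rL2_mul => //; exact: gauss_rL2.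
rewrite -(IntZ (A x) Lg) -(IntZ t LA) -(IntZ t^-1 Lh) -IntD; [|exact: L1Z|exact: L1Z].
apply: Int_norm_le; [exact: L1Z|by apply: L1D; exact: L1Z|move=> y].
have g0 := gauss_ge0 s (x - y).
rewrite mulrCA normrM (ger0_norm g0).
rewrite [leRHS](_ : _ = gauss s (x - y) * (t * A x ^+ 2 + t^-1 * h y ^+ 2)); last by ring.
rewrite ler_wpM2l//; exact: amgm.
Qed.

Lemma mollDl s A B h : s != 0 -> rL2 A -> rL2 B -> rL2 h ->
  moll s (fun x => A x + B x) h = moll s A h + moll s B h.
Proof.
move=> s0 hA hB hh; have [LA _] := mollE s0 hA hh; have [LB _] := mollE s0 hB hh.
rewrite /moll -(IntD LA LB); apply: Int_ext => x; ring.
Qed.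

Lemma mollDr s A h k : s != 0 -> rL2 A -> rL2 h -> rL2 k ->
  moll s A (fun x => h x + k x) = moll s A h + moll s A k.
Proof.
move=> s0 hA hh hk; have [Lh _] := mollE s0 hA hh; have [Lk _] := mollE s0 hA hk.
rewrite /moll -(IntD Lh Lk); apply: Int_ext => x.
rewrite -mulrDr -IntD; [|exact: rL2_mul (gauss_rL2 _ s0) _..].
by congr (_ * _); apply: Int_ext => y; rewrite mulrDr.
Qed.

(** Truncating both the domain and the values gives bounded integrable
approximations. *)
Lemma trunc_cvg f : rL2 f -> exists fN : nat -> R -> R,
  [/\ forall N, measurable_fun setT (fN N),
      forall N, exists M : R, forall x, `|fN N x| <= M,
      forall N, lebL1 (fN N),
      forall N, rL2 (fN N) /\ (forall x, fN N x ^+ 2 <= f x ^+ 2) &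
      Int (fun x => (f x - fN N x) ^+ 2) @[N --> \oo] --> (0 : R)].
Proof.
move=> [mf Lf].
pose fN (N : nat) (x : R) := if (`|x| <= N%:R) && (`|f x| <= N%:R) then f x else 0.
have mN N : measurable_fun setT (fN N).
  apply: measurable_fun_ifT => //.
  apply: measurable_and; apply: measurable_fun_ler => //.
  exact: measurableT_comp.
have bN N x : `|fN N x| <= N%:R.
  by rewrite /fN; case: ifP => [/andP[]|]//; rewrite normr0.
have sN N x : fN N x ^+ 2 <= f x ^+ 2.
  by rewrite /fN; case: ifP => // _; rewrite expr0n/= sqr_ge0.
have dN N x : (f x - fN N x) ^+ 2 <= f x ^+ 2.
  by rewrite /fN; case: ifP => // _; rewrite ?subrr ?subr0// expr0n/= sqr_ge0.
exists fN; split => //.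
- by move=> N; exists N%:R.
- move=> N; apply: (L1_le (mN N) (L1Z N%:R (L1_ind_itv true false (- N%:R) N%:R))) => x.
  rewrite /fN; have [xN|xN] /= := leP `|x| N%:R; last by rewrite normr0 mulr_ge0.
  rewrite indicE mem_set ?mulr1; last by rewrite /= in_itv /= -ler_norml.
  by case: ifP => //; rewrite normr0.
- move=> N; split => //; split => //; apply: (L1_le _ Lf); first exact: measurable_funX.
  by move=> x; rewrite ger0_norm ?sqr_ge0.
- rewrite -[X in _ --> X](Int0 (R := R)).
  apply: (proj2 (Int_cvg_dom _ _ Lf _ _)) => //.
  + by move=> n; apply: measurable_funX; exact: measurable_funB.
  + by move=> n x; rewrite ger0_norm ?sqr_ge0.
  + apply: aeW => x.
    apply: cvg_near_cst.
    near=> N.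
    rewrite /fN ifT ?subrr ?expr0n//.
    by apply/andP; split; near: N; exact: nbhs_infty_ger.
Unshelve. all: by end_near.
Qed.

(** For an integrable [A] and a bounded [h], dominated convergence applies, with
convergence at every Lebesgue point of [h]. *)
Lemma moll_cvg1 A h (M : R) : rL2 A -> lebL1 A -> rL2 h -> (forall x, `|h x| <= M) ->
  moll n.+1%:R^-1 A h @[n --> \oo] --> Int (fun x => A x * h x).
Proof.
move=> hA LA hh hM.
have mA := rL2_meas hA; have mh := rL2_meas hh.
have M0 : 0 <= M by exact: le_trans (normr_ge0 _) (hM 0).
have sn0 (n : nat) : (n.+1%:R^-1 : R) != 0 by rewrite invr_eq0.
have lp := lebesgue_differentiation (bnd_locint mh hM).
apply: (proj2 (Int_cvg_dom _ _ (L1Z M (L1_abs LA)) _ _)).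
- by move=> n; apply: L1_meas; exact: (proj1 (mollE (sn0 n) hA hh)).
- exact: measurable_funM.
- move=> n x; rewrite -mulrA normrM (ger0_norm (damp_ge0 _ _)).
  apply: (@le_trans _ _ `|A x * Int (fun y => gauss n.+1%:R^-1 (x - y) * h y)|).
    exact: ler_piMl (normr_ge0 _) (damp_le1 _ _).
  rewrite normrM mulrC ler_wpM2r//.
  rewrite -(gauss_IntZ M x (sn0 n)).
  apply: Int_norm_le.
  + exact: conv_L1_bnd.
  + by apply: L1Z; exact: gauss_L1.
  + move=> y; rewrite normrM (ger0_norm (gauss_ge0 _ _)) mulrC.
    by rewrite ler_wpM2r// gauss_ge0.
- apply: (ae_imp lp) => x hx.
  rewrite -[A x in X in _ --> X]mul1r.
  apply: cvgM; last exact: (moll_pt mh hM hx).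
  by apply: cvgMl; exact: damp_cvg.
Qed.

Lemma error_split_le (e m1 m2 i1 i2 i3 m3 : R) : 0 < e ->
  `|m1| <= e / 40 + e / 40 -> `|m2| <= e / 40 + e / 40 ->
  `|i1| <= e / 40 + e / 40 -> `|i2| <= e / 40 + e / 40 -> `|i3 - m3| <= e / 2 ->
  `|i1 + (i2 + i3) - (m1 + (m2 + m3))| <= e.
Proof.
rewrite !ler_norml => e0 /andP[? ?] /andP[? ?] /andP[? ?] /andP[? ?] /andP[? ?].
by apply/andP; split; lra.
Qed.

(** Both arguments are truncated. The errors are controlled, uniformly in the
width of the Gaussian, by [moll_bnd], and the truncated pairing by [moll_cvg1]. *)
Lemma moll_cvg A h : rL2 A -> rL2 h ->
  moll n.+1%:R^-1 A h @[n --> \oo] --> Int (fun x => A x * h x).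
Proof.
move=> hA hh.
have [AN [mAN _ LAN bAN cAN]] := trunc_cvg hA.
have [hN [mhN bhN _ bbhN chN]] := trunc_cvg hh.
have L2AN N : rL2 (AN N) by have [] := bAN N.
have L2hN N : rL2 (hN N) by have [] := bbhN N.
have CAN N : Int (fun x => AN N x ^+ 2) <= Int (fun x => A x ^+ 2).
  by apply: Int_le; [exact: (proj2 (L2AN N))|exact: (proj2 hA)|exact: (proj2 (bAN N))].
have halg (t e : R) : 0 < t -> t * (e / (40 * t)) = e / 40.
  by move=> t0; field; rewrite gt_eqF.
apply/cvgrPdist_le => /= e e0.
pose a := Int (fun x => A x ^+ 2).
pose b := Int (fun x => h x ^+ 2).
have a0 : 0 <= a by apply: Int_ge0 => x; exact: sqr_ge0.
have b0 : 0 <= b by apply: Int_ge0 => x; exact: sqr_ge0.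
have [C [C0 aC bC]] : exists C, [/\ 0 < C, a <= C & b <= C] by exists (a + b + 1); split; lra.
(* each error is at most t times the small squared norm of a truncation error, plus
   t^-1 times a squared norm bounded by C: t is fixed first, then the truncation *)
have [t [t0 tV]] : exists t, 0 < t /\ t^-1 * C = e / 40.
  by exists (40 * C / e); rewrite divr_gt0// ?mulr_gt0//; split => //; field; lra.
have etg : 0 < e / (40 * t) by rewrite divr_gt0// mulr_gt0.
have [N [NA Nh]] : exists N, Int (fun x => (A x - AN N x) ^+ 2) <= e / (40 * t) /\
    Int (fun x => (h x - hN N x) ^+ 2) <= e / (40 * t).
  move/cvgrPdist_le: cAN => /(_ _ etg) cA; move/cvgrPdist_le: chN => /(_ _ etg) ch.
  have [N _ HN] := filterI cA ch.
  exists N; have [] := HN N (leqnn N); rewrite /= !sub0r !normrN.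
  by move=> /ler_normlW ? /ler_normlW ?.
have [M hM] := bhN N.
have /cvgrPdist_le /(_ _ (_ : 0 < e / 2)) := moll_cvg1 (L2AN N) (LAN N) (L2hN N) hM.
move=> /(_ _); have e2 : 0 < e / 2 by rewrite divr_gt0.
move=> /(_ e2); apply: filterS => n.
set s : R := n.+1%:R^-1 => Hn.
have s0 : s != 0 by rewrite invr_eq0.
have hdA := rL2B hA (L2AN N); have hdh := rL2B hh (L2hN N).
have EA : moll s A h = moll s (fun x => A x - AN N x) h + moll s (AN N) h.
  by rewrite -(mollDl s0 hdA (L2AN N) hh); congr moll; apply/funext => x; rewrite subrK.
have Eh : moll s (AN N) h = moll s (AN N) (fun x => h x - hN N x) + moll s (AN N) (hN N).
  by rewrite -(mollDr s0 (L2AN N) hdh (L2hN N)); congr moll; apply/funext => x; rewrite subrK.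
have EI : Int (fun x => A x * h x) = Int (fun x => (A x - AN N x) * h x) +
   (Int (fun x => AN N x * (h x - hN N x)) + Int (fun x => AN N x * hN N x)).
  rewrite -IntD; [|exact: rL2_mul..]; rewrite -IntD.
  - by apply: Int_ext => x; ring.
  - exact: rL2_mul.
  - by apply: L1D; exact: rL2_mul.
have tV0 : 0 < t^-1 by rewrite invr_gt0.
have tt := halg t e t0.
have B1 := moll_bnd t0 s0 hdA hh.
have B2 := moll_bnd tV0 s0 (L2AN N) hdh.
have B3 := Int_mul_amgm t0 hdA hh.
have B4 := Int_mul_amgm tV0 (L2AN N) hdh.
have C1 : t * Int (fun x => (A x - AN N x) ^+ 2) <= e / 40.
  by rewrite -tt ler_wpM2l// ltW.
have C2 : t^-1 * Int (fun x => h x ^+ 2) <= e / 40.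
  by rewrite -tV ler_wpM2l// ltW.
have C3 : t^-1 * Int (fun x => AN N x ^+ 2) <= e / 40.
  by rewrite -tV ler_wpM2l ?(ltW tV0)// (le_trans (CAN N)).
have C4 : t^-1^-1 * Int (fun x => (h x - hN N x) ^+ 2) <= e / 40.
  by rewrite invrK -tt ler_wpM2l// ltW.
have D1 := le_trans B1 (lerD C1 C2).
have D2 := le_trans B2 (lerD C3 C4).
have D3 := le_trans B3 (lerD C1 C2).
have D4 := le_trans B4 (lerD C3 C4).
rewrite EI EA Eh.
exact: error_split_le e0 D1 D2 D3 D4 Hn.
Qed.

End Moll.

(** * Primitives of locally integrable functions *)

Section Prim.
Context {R : realType}.
Notation mu := (@lebesgue_measure R).
Implicit Types (f g h F G H : R -> R) (a b : R).

Definition chi a b (x : R) : R := if a <= x <= b then 1 else 0.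

Lemma chiE a b : chi a b = \1_`[a, b].
Proof.
apply/funext => x; rewrite indicE /chi; case: ifPn => xab.
  by rewrite mem_set//= in_itv.
by rewrite memNset//= in_itv/=; exact/negP.
Qed.

Lemma chi_ge0 a b x : 0 <= chi a b x. Proof. by rewrite /chi; case: ifP. Qed.

Lemma chi_norm a b x : `|chi a b x| <= 1.
Proof. by rewrite /chi; case: ifP; rewrite ?normr1 ?normr0. Qed.

Lemma meas_chi a b : measurable_fun setT (chi a b).
Proof. by rewrite chiE; exact: measurable_indic. Qed.

Lemma L1_chi a b : lebL1 (chi a b).
Proof. by rewrite chiE; exact: (L1_ind_itv true false). Qed.

Lemma Int_chi a b : a <= b -> Int (chi a b) = b - a.
Proof.
move=> ab; rewrite chiE /Rintegral integral_indic//= setIT lebesgue_measure_itv/=.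
rewrite lte_fin; case: ltP => // ba.
have -> : a = b by apply/eqP; rewrite eq_le ab.
by rewrite subrr.
Qed.

Lemma chi_cvg (x : R) : chi (- n%:R) n%:R x @[n --> \oo] --> (1 : R).
Proof.
apply: cvg_near_cst; near=> n.
rewrite /chi -ler_norml ifT//; near: n; exact: nbhs_infty_ger.
Unshelve. all: by end_near. Qed.

Definition L1loc f := measurable_fun setT f /\ forall a b, lebL1 (fun x => chi a b x * f x).

Definition itg a b f : R := Int (fun x => chi a b x * f x).

(** [F] is absolutely continuous on bounded intervals and [f] is its derivative
almost everywhere; the fundamental theorem of calculus serves as the definition. *)
Definition prim F f := L1loc f /\ forall a b, a <= b -> F b - F a = itg a b f.

Lemma L1_L1loc f : lebL1 f -> L1loc f.
Proof.
move=> Lf; split; first exact: L1_meas.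
by move=> a b; apply: (L1_bM (meas_chi a b) (chi_norm a b) Lf).
Qed.

Lemma rL2_L1loc f : rL2 f -> L1loc f.
Proof.
move=> [mf Lf]; split => // a b.
apply: (L1_le _ (L1D (L1_chi a b) Lf)).
  by apply: measurable_funM => //; exact: meas_chi.
move=> x; rewrite /chi; case: ifP => _; rewrite ?mul1r ?mul0r ?normr0 ?add0r ?sqr_ge0//.
rewrite -[f x ^+ 2]real_normK ?num_real//.
by have := sqr_ge0 (`|f x| - 1); have := normr_ge0 (f x); rewrite !expr2; lra.
Qed.

Lemma bnd_L1loc f (M : R) : measurable_fun setT f -> (forall x, `|f x| <= M) -> L1loc f.
Proof.
move=> mf fM; split => // a b.
apply: (L1_ext (f := fun x => f x * chi a b x)); first by move=> x; rewrite mulrC.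
exact: L1_bM (L1_chi a b).
Qed.

Lemma L1locD f g : L1loc f -> L1loc g -> L1loc (fun x => f x + g x).
Proof.
move=> [mf Lf] [mg Lg]; split; first exact: measurable_funD.
move=> a b; apply: (L1_ext _ (L1D (Lf a b) (Lg a b))) => x.
by rewrite mulrDr.
Qed.

Lemma L1locZ (k : R) f : L1loc f -> L1loc (fun x => k * f x).
Proof.
move=> [mf Lf]; split; first exact: measurable_funM.
move=> a b; apply: (L1_ext _ (L1Z k (Lf a b))) => x.
by rewrite mulrCA.
Qed.

Lemma itgD a b f g : L1loc f -> L1loc g -> itg a b (fun x => f x + g x) = itg a b f + itg a b g.
Proof.
move=> [_ Lf] [_ Lg]; rewrite /itg -IntD//; apply: Int_ext => x.
by rewrite mulrDr.
Qed.

Lemma itgZ a b (k : R) f : L1loc f -> itg a b (fun x => k * f x) = k * itg a b f.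
Proof.
move=> [_ Lf]; rewrite /itg -(IntZ k (Lf a b)); apply: Int_ext => x.
by rewrite mulrCA.
Qed.

Lemma primD F f G g : prim F f -> prim G g ->
  prim (fun x => F x + G x) (fun x => f x + g x).
Proof.
move=> [Lf pF] [Lg pG]; split; first exact: L1locD.
by move=> a b ab; rewrite itgD// -pF// -pG//; lra.
Qed.

Lemma primZ (k : R) F f : prim F f -> prim (fun x => k * F x) (fun x => k * f x).
Proof.
move=> [Lf pF]; split; first exact: L1locZ.
by move=> a b ab; rewrite itgZ// -pF// mulrBr.
Qed.

Lemma prim_cst (k : R) : prim (fun _ => k) (fun _ => 0).
Proof.
split; first by apply: (@bnd_L1loc _ 0) => // x; rewrite normr0.
move=> a b _; rewrite subrr /itg (Int_ext (g := fun=> 0)) ?Int0// => x.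
by rewrite mulr0.
Qed.

Lemma prim_ext F f G g : F =1 G -> f =1 g -> prim F f -> prim G g.
Proof. by move=> /funext -> /funext ->. Qed.

Lemma prim_const F : prim F (fun _ => 0) -> forall x y, F x = F y.
Proof.
move=> [_ pF].
have E x y : x <= y -> F x = F y.
  move=> /pF; rewrite /itg (Int_ext (g := fun=> 0)) ?Int0; last by move=> z; rewrite mulr0.
  by move/eqP; rewrite subr_eq0 => /eqP.
by move=> x y; have [/E|/ltW/E] := leP x y.
Qed.

(** The kernel of integration by parts: f(x) g(y) on the triangle
a <= y <= x <= b. Its two iterated integrals are the two sides of the formula. *)
Lemma triangle_L1prod a b f g : L1loc f -> L1loc g ->
  L1prod (fun z : R * R => chi a b z.1 * f z.1 * (chi a b z.2 * (if z.2 <= z.1 then 1 else 0) * g z.2)).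
Proof.
move=> [mf Lf] [mg Lg].
have m1 : measurable_fun setT (fun z : R * R => if z.2 <= z.1 then 1 else 0 : R).
  apply: measurable_fun_ifT => //.
  by apply: measurable_fun_ler; [exact: measurable_snd|exact: measurable_fst].
pose C := Int (fun y => `|chi a b y * g y|).
have K x y : `|chi a b x * f x * (chi a b y * (if y <= x then 1 else 0) * g y)| <=
   `|chi a b x * f x| * `|chi a b y * g y|.
  rewrite normrM ler_wpM2l//; case: ifP => _; rewrite ?mulr1// mulr0 mul0r normr0//.
have my x : measurable_fun setT (fun y : R => if y <= x then 1 else 0 : R).
  by apply: measurable_fun_ifT => //; exact: measurable_fun_ler.
have Lx x : lebL1 (fun y => chi a b x * f x * (chi a b y * (if y <= x then 1 else 0) * g y)).
  apply: (L1_le _ (L1Z `|chi a b x * f x| (L1_abs (Lg a b)))) => [|y]; last exact: K.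
  apply: measurable_funM => //; apply: measurable_funM => //; apply: measurable_funM => //.
  exact: meas_chi.
apply: (L1prod_crit (a := fun x => C * `|chi a b x * f x|)).
- apply: measurable_funM; first apply: measurable_funM.
  + by apply: (measurableT_comp (meas_chi a b)); exact: measurable_fst.
  + by apply: (measurableT_comp mf); exact: measurable_fst.
  apply: measurable_funM; last by apply: (measurableT_comp mg); exact: measurable_snd.
  apply: measurable_funM => //.
  by apply: (measurableT_comp (meas_chi a b)); exact: measurable_snd.
- by move=> x /=; exact: Lx.
- by apply: L1Z; apply: L1_abs.
- move=> x /=; rewrite [leRHS]mulrC /C -(IntZ _ (L1_abs (Lg a b))).
  by apply: Int_le; [exact: L1_abs|apply: L1Z; exact: L1_abs|move=> y; exact: K].
Qed.

Lemma triangle_slice_L1 (s : R -> bool) g a b : measurable_fun setT s -> L1loc g ->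
  lebL1 (fun y => chi a b y * (if s y then 1 else 0) * g y).
Proof.
move=> ms [mg Lg].
apply: (L1_ext (f := fun y => (if s y then 1 else 0) * (chi a b y * g y))).
  by move=> y; rewrite mulrCA mulrA.
apply: (@L1_bM _ 1) => //; first exact: measurable_fun_ifT.
by move=> y; case: ifP; rewrite ?normr1 ?normr0.
Qed.

Lemma triangle_slice_lower G g a b x : prim G g -> a <= x <= b ->
  Int (fun y => chi a b y * (if y <= x then 1 else 0) * g y) = G x - G a.
Proof.
move=> [_ pG] /andP[ax xb]; rewrite pG//; apply: Int_ext => y; congr (_ * _).
rewrite /chi; case: (leP y x) => yx; rewrite ?mulr1 ?mulr0 ?andbT ?andbF//.
by rewrite (le_trans yx xb) andbT.
Qed.

Lemma triangle_slice_upper F f a b y : prim F f -> a <= y <= b ->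
  Int (fun x => chi a b x * (if y <= x then 1 else 0) * f x) = F b - F y.
Proof.
move=> [_ pF] /andP[ay yb]; rewrite pF//; apply: Int_ext => x; congr (_ * _).
rewrite /chi; case: (leP y x) => yx; rewrite ?mulr1 ?mulr0//=.
by rewrite (le_trans ay yx).
Qed.

(** With the triangle kernel for the constant 1 and g, G - G(a) is an inner
integral of an integrable function of two variables, hence measurable. *)
Lemma prim_meas G g : prim G g -> measurable_fun setT G.
Proof.
move=> pG; have [[mg Lg] _] := pG.
have L1c : L1loc (fun _ : R => 1 : R) by apply: (@bnd_L1loc _ 1) => // x; rewrite normr1.
have mn (n : nat) : measurable_fun setT (fun x => chi (- n%:R) n%:R x * G x).
  have [L _] := Fubini_Int (triangle_L1prod (- n%:R) n%:R L1c (proj1 pG)).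
  apply: L1_meas; apply: (L1_ext _ (L1D L (L1Z (G (- n%:R)) (L1_chi (- n%:R) n%:R)))) => x /=.
  case xn : (- n%:R <= x <= n%:R); last first.
    rewrite (Int_ext (g := fun=> 0)); last by move=> y; rewrite /chi xn !mul0r.
    by rewrite Int0 /chi xn mulr0 mul0r addr0.
  rewrite (Int_ext (g := fun y => chi (- n%:R) n%:R y * (if y <= x then 1 else 0) * g y)).
    by rewrite (triangle_slice_lower pG xn) /chi xn mulr1 mul1r subrK.
  by move=> y; rewrite {1}/chi xn !mul1r.
apply: (measurable_fun_cvg mn) => x _.
by rewrite -[X in _ --> X]mul1r; apply: cvgMl; exact: chi_cvg.
Qed.

Lemma prim_bnd G g a b x : prim G g -> a <= x <= b ->
  `|G x| <= `|G a| + Int (fun y => `|chi a b y * g y|).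
Proof.
move=> pG xab; have [[mg Lg] E] := pG.
have -> : G x = G a + itg a x g by rewrite -E ?subrKC//; case/andP: xab.
apply: (le_trans (ler_normD _ _)); rewrite lerD2l.
apply: Int_norm_le => //; first exact: L1_abs.
move=> y; rewrite !normrM ler_wpM2r// !(ger0_norm (chi_ge0 _ _ _)).
rewrite /chi; case: ifP => [/andP[ay yx]|_]; last exact: chi_ge0.
by case/andP: xab => ax xb; rewrite ay (le_trans yx xb).
Qed.

Lemma prim_L1locM F f G g : prim G g -> L1loc f -> L1loc (fun x => f x * G x).
Proof.
move=> pG [mf Lf]; split; first by apply: measurable_funM => //; exact: prim_meas pG.
move=> a b.
pose C := `|G a| + Int (fun y => `|chi a b y * g y|).
apply: (L1_le _ (L1Z C (L1_abs (Lf a b)))).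
  apply: measurable_funM; first exact: meas_chi.
  by apply: measurable_funM => //; exact: prim_meas pG.
move=> x; rewrite mulrA normrM mulrC.
case xab : (a <= x <= b); last by rewrite /chi xab mul0r normr0 !mulr0.
by rewrite ler_wpM2r// (prim_bnd pG xab).
Qed.

(** Fubini's theorem on the triangle gives
int f (G - G(a)) = int g (F(b) - F), which rearranges into the product rule. *)
Lemma prim_mul F f G g : prim F f -> prim G g ->
  prim (fun x => F x * G x) (fun x => f x * G x + g x * F x).
Proof.
move=> pF pG; have [[mf Lf] EF] := pF; have [[mg Lg] EG] := pG.
have LfG := prim_L1locM F pG (proj1 pF); have LgF := prim_L1locM F pF (proj1 pG).
split; first exact: L1locD.
move=> a b ab; rewrite itgD//.
have [_ E] := Fubini_Int (triangle_L1prod a b (proj1 pF) (proj1 pG)).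
have E1 : Int (fun x => chi a b x * f x * (G x - G a)) = itg a b (fun x => f x * G x) - G a * itg a b f.
  rewrite /itg -(IntZ (G a) (Lf a b)) -IntB; [|exact: (proj2 LfG)|exact: L1Z].
  by apply: Int_ext => x; ring.
have E2 : Int (fun y => chi a b y * g y * (F b - F y)) = F b * itg a b g - itg a b (fun y => g y * F y).
  rewrite /itg -(IntZ (F b) (Lg a b)) -IntB; [|exact: L1Z|exact: (proj2 LgF)].
  by apply: Int_ext => x; ring.
have : Int (fun x => chi a b x * f x * (G x - G a)) = Int (fun y => chi a b y * g y * (F b - F y)).
  apply: (etrans _ (etrans E _)) => /=; apply: Int_ext => x /=.
    case xab : (a <= x <= b); last first.
      rewrite (Int_ext (g := fun=> 0)) ?Int0; last by move=> y; rewrite {1}/chi xab !mul0r.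
      by rewrite /chi xab !mul0r.
    rewrite -(triangle_slice_lower pG xab) -IntZ//.
    by apply: triangle_slice_L1 (proj1 pG); exact: measurable_fun_ler.
  case xab : (a <= x <= b); last first.
    rewrite (Int_ext (g := fun=> 0)) ?Int0; last by move=> y; rewrite {2}/chi xab !mul0r mulr0.
    by rewrite /chi xab !mul0r.
  rewrite -(triangle_slice_upper pF xab) -IntZ//; last first.
    by apply: triangle_slice_L1 (proj1 pF); exact: measurable_fun_ler.
  by apply: Int_ext => y; case: ifP => _; ring.
by rewrite E1 E2 -EF// -EG// => /eqP; rewrite subr_eq => /eqP ->; ring.
Qed.

Lemma itg_cvg h : lebL1 h -> itg (- n%:R) n%:R h @[n --> \oo] --> Int h.
Proof.
move=> Lh; have mh := L1_meas Lh.
apply: (proj2 (Int_cvg_dom _ _ (L1_abs Lh) _ _)) => //.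
- by move=> n; apply: measurable_funM => //; exact: meas_chi.
- by move=> n x; rewrite normrM ler_piMl// chi_norm.
- by apply: aeW => x; rewrite -[X in _ --> X]mul1r; apply: cvgMl; exact: chi_cvg.
Qed.

(** Otherwise |H t - H (- t)| would stay above half of |Int h| for all large [t],
and [H] would not be integrable. *)
Lemma prim_int0 H h : lebL1 H -> lebL1 h -> prim H h -> Int h = 0.
Proof.
move=> LH Lh pH; have [_ EH] := pH.
set l := Int h; apply/eqP; apply: contraT => l0.
have l0' : 0 < `|l| by rewrite normr_gt0.
have [LHN _] := Int_reflect LH.
have Lk : lebL1 (fun t => `|H t - H (- t)|) by apply: L1_abs; exact: L1B.
have Lr (n : nat) : lebL1 (fun x => `|h x| - chi (- n%:R) n%:R x * `|h x|).
  apply: L1B; first exact: L1_abs.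
  apply: (L1_ext _ (L1_abs (proj2 (L1_L1loc Lh) (- n%:R) n%:R))) => x.
  by rewrite normrM ger0_norm ?chi_ge0.
have rc : Int (fun x => `|h x| - chi (- n%:R) n%:R x * `|h x|) @[n --> \oo] --> (0 : R).
  rewrite -(subrr (Int (fun x => `|h x|))).
  have -> : (fun n : nat => Int (fun x => `|h x| - chi (- n%:R) n%:R x * `|h x|)) =
     (fun n : nat => Int (fun x => `|h x|) - itg (- n%:R) n%:R (fun x => `|h x|)).
    apply/funext => n; rewrite /itg -IntB//; first exact: L1_abs.
    exact: (proj2 (L1_L1loc (L1_abs Lh)) (- n%:R) n%:R).
  by apply: cvgB; [exact: cvg_cst|exact: itg_cvg (L1_abs Lh)].
move/cvgrPdist_le: rc => /(_ (`|l| / 2)); rewrite divr_gt0// => /(_ isT) [N _ /(_ N (leqnn N))].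
rewrite /= sub0r normrN => HN.
have low t : N%:R <= t -> `|l| / 2 <= `|H t - H (- t)|.
  move=> Nt.
  have t0 : 0 <= t by exact: le_trans (ler0n _ _) Nt.
  rewrite EH; last by lra.
  have D : `|l - itg (- t) t h| <= `|l| / 2.
    rewrite /l /itg -IntB//; last exact: (proj2 (L1_L1loc Lh)).
    apply: (le_trans _ (ler_normlW HN)).
    apply: Int_norm_le => //.
      by apply: L1B => //; exact: (proj2 (L1_L1loc Lh)).
    move=> x; rewrite /chi; case: ifP => xt; case: ifP => xN; rewrite ?mul1r ?mul0r ?subr0 ?subrr ?normr0//.
    move: xN => /andP[? ?]; move/negP: xt; case; apply/andP; split; lra.
  by have := ler_normD (l - itg (- t) t h) (itg (- t) t h); rewrite subrK; lra.
have B (n : nat) : `|l| / 2 * n%:R <= Int (fun t => `|H t - H (- t)|).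
  have <- : Int (fun x => `|l| / 2 * chi N%:R (N%:R + n%:R) x) = `|l| / 2 * n%:R.
    by rewrite IntZ ?Int_chi ?lerDl//; [congr (_ * _); lra|exact: L1_chi].
  apply: Int_le => //; first by apply: L1Z; exact: L1_chi.
  by move=> x; rewrite /chi; case: ifP => [/andP[/low xN _]|_]; rewrite ?mulr1 ?mulr0.
have := nbhs_infty_gtr (Int (fun t => `|H t - H (- t)|) / (`|l| / 2)).
move=> [n _ /(_ n (leqnn n))] /=; rewrite ltr_pdivrMr ?divr_gt0// mulrC => H1.
by have := B n; rewrite leNgt H1.
Qed.

Lemma prim_C1 F f : (forall x : R, is_derive x (1:R) F (f x)) -> continuous f -> prim F f.
Proof.
move=> dF cf.
have mf : measurable_fun setT f by exact: continuous_measurable_fun.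
have L a b : mu.-integrable `[a, b] (EFin \o f).
  apply: continuous_compact_integrable; first exact: segment_compact.
  exact: continuous_subspaceT.
have Lc a b : lebL1 (fun x => chi a b x * f x).
  have := proj1 (@integrable_mkcond _ _ _ mu `[a, b]%classic (EFin \o f) (measurable_itv _)) (L a b).
  by apply: eq_integrable => // x _ /=; rewrite restrict_EFin patch_indic /= chiE mulrC.
split => // a b; rewrite le_eqVlt => /predU1P[->|ab].
  rewrite subrr /itg.
  have -> : (fun x => chi b b x * f x) = (f \_ [set b]).
    apply/funext => x; rewrite patch_indic /= mulrC; congr (_ * _).
    by rewrite chiE set_itv1.
  by rewrite -Rintegral_mkcond Rintegral_set1.
rewrite /itg.
have dcF (x : R) : {for x, continuous F}.
  by apply: differentiable_continuous; apply/derivable1_diffP; exact: (@ex_derive _ _ _ _ _ _ _ (dF x)).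
have E := @continuous_FTC2 R f F a b ab (continuous_subspaceT cf).
have -> : (fun x => chi a b x * f x) = (f \_ `[a, b]).
  by apply/funext => x; rewrite patch_indic /= mulrC chiE.
rewrite -Rintegral_mkcond /Rintegral E//.
- split.
  + by move=> x _; exact: (@ex_derive _ _ _ _ _ _ _ (dF x)).
  + by apply: cvg_at_right_filter; exact: dcF.
  + by apply: cvg_at_left_filter; exact: dcF.
- by move=> x _; rewrite derive1E; exact: derive_val.
Qed.

End Prim.

(** * A smooth step function *)

Section Smooth.
Context {R : realType}.
Implicit Types (f g h : R -> R) (a b : R) (p q : {poly R}).

(** Differentiability to order [n] with the derivatives exhibited, which makes
stability under the algebraic operations a plain induction. *)
Fixpoint diffn (n : nat) (f : R -> R) : Prop :=
  if n is m.+1 then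
    exists df : R -> R, (forall x : R, is_derive x (1 : R) f (df x)) /\ diffn m df
  else True.

Definition rsmooth f := forall n x, derivable (derive1n n f) x 1.

Lemma diffn_derive1n f (df : R -> R) : (forall x : R, is_derive x (1 : R) f (df x)) -> derive1 f = df.
Proof. by move=> d; apply/funext => x; rewrite derive1E; exact: derive_val. Qed.

Lemma diffn_smooth f : (forall n, diffn n f) -> rsmooth f.
Proof.
move=> H n x; have := H n.+1; elim: n f {H} => [|n IH] f [df [dF]].
  by move=> _; exact: (@ex_derive _ _ _ _ _ _ _ (dF x)).
by move=> H; rewrite derive1Sn (diffn_derive1n dF); exact: IH.
Qed.

Lemma diffnW n f : diffn n.+1 f -> diffn n f.
Proof. by elim: n f => // n IH f [df [dF H]]; exists df; split => //; exact: IH. Qed.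

(** Used with families closed under derivation, such as the functions [expinv p]. *)
Lemma diffn_closed (C : (R -> R) -> Prop) :
  (forall f, C f -> exists df, (forall x : R, is_derive x (1 : R) f (df x)) /\ C df) ->
  forall f, C f -> forall n, diffn n f.
Proof.
move=> HC f Cf n; elim: n f Cf => // n IH f /HC [df [dF Cdf]].
by exists df; split => //; exact: IH.
Qed.

Lemma diffn_cst (k : R) n : diffn n (fun _ => k).
Proof.
apply: (@diffn_closed (fun f => exists k, f = fun _ => k)); last by exists k.
by move=> _ [c ->]; exists (fun _ => 0); split; [move=> x; exact: is_derive_cst|exists 0].
Qed.

Lemma diffnD n f g : diffn n f -> diffn n g -> diffn n (fun x => f x + g x).
Proof.
elim: n f g => // n IH f g [df [dF Hf]] [dg [dG Hg]].
exists (fun x => df x + dg x); split; last exact: IH.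
by move=> x; apply: is_deriveD.
Qed.

Lemma diffnM n f g : diffn n f -> diffn n g -> diffn n (fun x => f x * g x).
Proof.
elim: n f g => // n IH f g Hf Hg.
have Wf := diffnW Hf; have Wg := diffnW Hg.
case: Hf Hg => [df [dF Hf]] [dg [dG Hg]].
exists (fun x => f x * dg x + g x * df x); split; last by apply: diffnD; exact: IH.
by move=> x; apply: is_deriveM.
Qed.

Lemma diffnZ n (k : R) f : diffn n f -> diffn n (fun x => k * f x).
Proof. by apply: diffnM; exact: diffn_cst. Qed.

Lemma diffn_affine n (k c : R) f : diffn n f -> diffn n (fun x => f (k * x + c)).
Proof.
elim: n f => // n IH f [df [dF Hf]].
exists (fun x => k * df (k * x + c)); split; last by apply: diffnZ; exact: IH.
move=> x.
have d1 : is_derive x (1 : R) (fun x : R => k * x + c) k.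
  have h := is_deriveD (is_deriveZ k (is_derive_id x (1 : R))) (is_derive_cst c x 1).
  by apply: (is_derive_eq h); rewrite addr0 /GRing.scale /= mulr1.
have := @is_derive1_comp _ f (fun x => k * x + c) x _ _ (dF _) d1.
by move=> h; apply: (is_derive_eq h); rewrite mulrC.
Qed.

Lemma diffnV n g : (forall x, g x != 0) -> diffn n g -> diffn n (fun x => (g x)^-1).
Proof.
move=> g0; elim: n => // n IH Hg.
have /IH Vg := diffnW Hg; case: Hg => dg [dG Hg].
exists (fun x => (-1) * dg x * ((g x)^-1 * (g x)^-1)); split.
  move=> x; have h := is_deriveV (g0 x) (dG x); apply: (is_derive_eq h).
  by rewrite /GRing.scale /= expr2 invfM; ring.
by apply: diffnM; [exact: diffnZ|exact: diffnM].
Qed.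

Lemma poly_expR_bound p (k : R) : 0 < k -> exists C : R, 0 <= C /\ forall t, `|p.[t]| <= C * expR (k * `|t|).
Proof.
elim/poly_ind: p k => [|p c IH] k k0.
  by exists 0; split => // t; rewrite horner0 normr0 mul0r.
have k2 : 0 < k / 2 by rewrite divr_gt0.
have [C [C0 HC]] := IH _ k2.
exists (C * (2 / k) + `|c|); split; first by rewrite addr_ge0// mulr_ge0// divr_ge0// ltW.
move=> t; rewrite hornerMXaddC (le_trans (ler_normD _ _))// mulrDl; apply: lerD; last first.
  rewrite ler_peMr// -expR0 ler_expR mulr_ge0// ltW//.
rewrite normrM.
have -> : k * `|t| = k / 2 * `|t| + k / 2 * `|t| by field.
rewrite expRD mulrACA; apply: ler_pM => //.
have H := expR_ge1Dx (k / 2 * `|t|).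
have -> : `|t| = 2 / k * (k / 2 * `|t|) by field; rewrite gt_eqF.
rewrite ler_wpM2l ?divr_ge0 ?(ltW k0)//.
have -> : k / 2 * (2 / k * (k / 2 * `|t|)) = k / 2 * `|t| by field; rewrite gt_eqF.
by lra.
Qed.

(** The flat function exp (- 1 / x), multiplied by a polynomial in 1 / x so that the
family is closed under derivation. *)
Definition expinv p (x : R) : R := if 0 < x then p.[x^-1] * expR (- x^-1) else 0.

Lemma expinv_derive p (x : R) :
  is_derive x (1 : R) (expinv p) (expinv ('X^2 * (p - p^`())) x).
Proof.
have [x0|x0|x0] := ltgtP 0 x.
- have d1 : is_derive x (1 : R) (fun y : R => y^-1) (- x ^- 2).
    have x0' : id x != 0 by rewrite gt_eqF.
    have h := is_deriveV x0' (is_derive_id x (1 : R)).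
    by apply: (is_derive_eq h); rewrite /GRing.scale /= mulr1.
  have d2 := @is_derive1_comp _ (horner p) (fun y : R => y^-1) x _ _ (is_derive_poly _ _) d1.
  have d3 := @is_derive1_comp _ expR (fun y : R => - y^-1) x _ _ (is_derive_expR _) (is_deriveN d1).
  have d4 := is_deriveM d2 d3.
  have near0 : \forall y \near x, (fun y => p.[y^-1] * expR (- y^-1)) y = expinv p y.
    by near=> y; rewrite /expinv ifT//; near: y; exact: lt_nbhsr.
  apply: (near_eq_is_derive near0); apply: (is_derive_eq d4).
  by rewrite /expinv x0 /= hornerM hornerXn hornerD hornerN /GRing.scale /= exprVn; ring.
- have near0 : \forall y \near x, (cst 0 : R -> R) y = expinv p y.
    near=> y; rewrite /expinv ifF//; apply/negbTE; rewrite -leNgt ltW//.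
    by near: y; exact: lt_nbhsl.
  apply: (near_eq_is_derive near0); rewrite /expinv ifF; last by apply/negbTE; rewrite -leNgt ltW.
  exact: is_derive_cst.
- rewrite -x0 [expinv _ 0]/expinv ltxx.
  have [C [C0 HC]] := poly_expR_bound ('X^2 * p) (ltr01 : 0 < (1 : R)).
  have bnd (h : R) : `|h^-1 * expinv p h| <= C * `|h|.
    rewrite /expinv; case: ifPn => hp; last by rewrite mulr0 normr0 mulr_ge0.
    have := HC h^-1; rewrite hornerM hornerXn mul1r (ger0_norm (_ : 0 <= h^-1)) ?invr_ge0 ?(ltW hp)// => H.
    rewrite expRN mulrA normrM normfV (ger0_norm (expR_ge0 _)).
    rewrite ler_pdivrMr ?expR_gt0// (ger0_norm (ltW hp)).
    have -> : h^-1 * p.[h^-1] = h * ((h^-1) ^+ 2 * p.[h^-1]).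
      by field; rewrite gt_eqF.
    have -> : C * h * expR h^-1 = h * (C * expR h^-1) by ring.
    rewrite normrM (gtr0_norm hp). exact: (ler_wpM2l (ltW hp) H).
  apply/is_derive1_caratheodory; exists (fun z => z^-1 * expinv p z); split.
  + move=> z; rewrite [expinv p 0]/expinv ltxx !subr0.
    have [->|z0] := eqVneq z 0; first by rewrite /expinv ltxx !mulr0.
    by rewrite mulrAC mulVf// mul1r.
  + rewrite /prop_for /continuous_at invr0 mul0r.
    apply/cvgrPdist_le => /= e e0; near=> z; rewrite sub0r normrN.
    apply: (le_trans (bnd z)).
    have : `|z| <= e / (C + 1).
      near: z; have := @nbhs0_le R R (e / (C + 1)); apply; rewrite divr_gt0//; lra.
    rewrite ler_pdivlMr; last by lra.
    by have := normr_ge0 z; nra.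
  + by rewrite invr0 mul0r.
Unshelve. all: by end_near.
Qed.

Lemma diffn_expinv p n : diffn n (expinv p).
Proof.
apply: (@diffn_closed (fun f => exists p, f = expinv p)); last by exists p.
move=> _ [q ->]; exists (expinv ('X^2 * (q - q^`()))); split; first exact: expinv_derive.
by eexists.
Qed.

(** A smooth function equal to 0 on the left of 0 and to 1 on the right of 1. *)
Definition step (x : R) : R := expinv 1 x * (expinv 1 x + expinv 1 (1 - x))^-1.

Lemma expinv1_gt0 (x : R) : 0 < x -> 0 < expinv 1 x.
Proof. by move=> x0; rewrite /expinv x0 hornerC mul1r expR_gt0. Qed.

Lemma expinv1_ge0 (x : R) : 0 <= expinv 1 x.
Proof. by rewrite /expinv; case: ifP => // _; rewrite hornerC mul1r expR_ge0. Qed.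

Lemma expinv1_le0 (x : R) : x <= 0 -> expinv 1 x = 0.
Proof. by rewrite leNgt /expinv => /negbTE ->. Qed.

Lemma step_den_gt0 (x : R) : 0 < expinv 1 x + expinv 1 (1 - x).
Proof.
have [x0|x0] := ltP 0 x; first by rewrite ltr_pwDl ?expinv1_gt0 ?expinv1_ge0.
by rewrite ltr_pwDr ?expinv1_ge0// expinv1_gt0//; lra.
Qed.

Lemma step_le0 (x : R) : x <= 0 -> step x = 0.
Proof. by move=> x0; rewrite /step expinv1_le0// mul0r. Qed.

Lemma step_ge1 (x : R) : 1 <= x -> step x = 1.
Proof.
move=> x1; rewrite /step (@expinv1_le0 (1 - x)) ?subr_le0// addr0 divff//.
by rewrite gt_eqF// expinv1_gt0//; lra.
Qed.

Lemma step01 (x : R) : 0 <= step x <= 1.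
Proof.
apply/andP; split; first by rewrite divr_ge0 ?expinv1_ge0// ltW// step_den_gt0.
by rewrite ler_pdivrMr ?step_den_gt0// mul1r lerDl expinv1_ge0.
Qed.

Lemma diffn_step n : diffn n step.
Proof.
apply: diffnM; first exact: diffn_expinv.
apply: diffnV; first by move=> x; rewrite gt_eqF// step_den_gt0.
apply: diffnD; first exact: diffn_expinv.
have -> : (fun x : R => expinv 1 (1 - x)) = (fun x => expinv 1 ((-1) * x + 1)).
  by apply/funext => x; rewrite mulN1r addrC.
by apply: diffn_affine; exact: diffn_expinv.
Qed.

Lemma diffn_continuous f : diffn 1 f -> continuous f.
Proof.
move=> [df [dF _]] x; apply: differentiable_continuous; apply/derivable1_diffP.
exact: (@ex_derive _ _ _ _ _ _ _ (dF x)).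
Qed.

(** The derivative vanishes outside [0, 1] because the step is locally constant
there; it is bounded by compactness. *)
Lemma step_derive : exists (bump : R -> R) (M : R),
  [/\ forall x : R, is_derive x (1 : R) step (bump x), continuous bump,
      forall x, ~~ (0 <= x <= 1) -> bump x = 0 & forall x, `|bump x| <= M].
Proof.
have [bump [dS Hb]] := diffn_step 2.
have cb := diffn_continuous Hb.
have out (x : R) : ~~ (0 <= x <= 1) -> bump x = 0.
  move=> nx; have [c nc] : exists c : R, \forall y \near x, (cst c : R -> R) y = step y.
    have [x0|x0] := ltP x 0.
      exists 0; near=> y; rewrite step_le0// ltW//; near: y; exact: lt_nbhsl.
    exists 1; near=> y; rewrite step_ge1// ltW//; near: y; apply: lt_nbhsr.
    by move: nx; rewrite x0 /= -ltNge.
  have h := near_eq_is_derive nc (is_derive_cst c x 1).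
  by rewrite -(@derive_val _ _ _ _ _ _ _ (dS x)) (@derive_val _ _ _ _ _ _ _ h).
have [M [_ HM]] : bounded_set (bump @` `[0, 1]).
  apply: compact_bounded; apply: continuous_compact; last exact: segment_compact.
  exact: continuous_subspaceT.
exists bump, (`|M| + 1); split => // x.
have [x01|nx] := boolP (0 <= x <= 1); last by rewrite out// normr0 addr_ge0.
apply: HM; last by exists x => //=; rewrite in_itv.
by rewrite (le_lt_trans (ler_norm M))// ltrDl.
Unshelve. all: by end_near.
Qed.

End Smooth.

(** * From weak derivatives to primitives *)

Section WeakDeriv.
Context {R : realType}.
Notation mu := (@lebesgue_measure R).
Implicit Types (f g h : R -> R) (a b k : R).

Lemma L1loc_locint f : L1loc f -> locally_integrable setT f.
Proof.
move=> [mf Lf]; split => //; first exact: openT.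
move=> K _ cK.
have [M [_ HM]] := compact_bounded cK.
pose B := `|M| + 1.
have KB : K `<=` `[- B, B]%classic.
  move=> x Kx; rewrite /= in_itv /= -ler_norml; apply: HM => //.
  by rewrite (le_lt_trans (ler_norm M))// ltrDl.
have /integrableP[_] := L1_abs (Lf (- B) B); apply: le_lt_trans.
rewrite integral_mkcond; apply: ge0_le_integral => //.
- by move=> x _; rewrite patchE; case: ifP.
- apply: (proj1 (measurable_restrictT _ (compact_measurable cK))).
  apply/measurable_EFinP; apply: measurableT_comp => //.
  exact: measurable_funS mf.
- apply: measurableT_comp => //; apply/measurable_EFinP; apply: measurableT_comp => //.
  by apply: measurable_funM => //; exact: meas_chi.
- move=> x _; rewrite patchE; case: ifPn => xK; last exact: abse_ge0.
  rewrite /= lee_fin normr_id normrM /chi.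
  have := KB x (set_mem xK); rewrite /= in_itv /= => ->.
  by rewrite normr1 mul1r.
Qed.

(** The derivatives of steep steps form an approximate identity at [a], supported
on the right of [a]. *)
Lemma step_kernel : exists M : R, 0 <= M /\ forall k a, 0 < k -> exists (K : R -> R),
  [/\ forall x : R, is_derive x (1 : R) (fun x => step (k * x + - (k * a))) (K x),
      continuous K,
      forall x, ~~ (a <= x <= a + k^-1) -> K x = 0,
      forall x, `|K x| <= k * M & lebL1 K /\ Int K = 1].
Proof.
have [bump [M [dS cb out bM]]] := step_derive (R := R).
exists M; split; first exact: le_trans (normr_ge0 _) (bM 0).
move=> k a k0; pose K x := k * bump (k * x + - (k * a)).
have out' x : ~~ (a <= x <= a + k^-1) -> K x = 0.
  move=> nx; rewrite /K out ?mulr0//; apply: contra nx => /andP[H1 H2].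
  have Ea : k * (x - a) = k * x - k * a by ring.
  have ax : a <= x.
    by rewrite -subr_ge0 -(pmulr_rge0 _ k0) Ea.
  rewrite ax /= -lerBlDl -(ler_pM2l k0) Ea mulfV ?gt_eqF//.
have cK : continuous K.
  move=> x; apply: cvgMr.
  apply: (@cvg_comp _ _ _ (fun x => k * x + - (k * a)) bump); last exact: cb.
  by apply: cvgD; [apply: cvgMr; exact: cvg_id|exact: cvg_cst].
have dK (x : R) : is_derive x (1 : R) (fun x => step (k * x + - (k * a))) (K x).
  have d1 : is_derive x (1 : R) (fun x : R => k * x + - (k * a)) k.
    have h := is_deriveD (is_deriveZ k (is_derive_id x (1 : R))) (is_derive_cst (- (k * a)) x 1).
    by apply: (is_derive_eq h); rewrite addr0 /GRing.scale /= mulr1.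
  have h := @is_derive1_comp _ step (fun x => k * x + - (k * a)) x _ _ (dS _) d1.
  by apply: (is_derive_eq h); rewrite mulrC.
have [[mK LK] EK] := prim_C1 dK cK.
have KE x : chi a (a + k^-1) x * K x = K x.
  rewrite /chi; case: ifPn => [_|/out' ->]; first by rewrite mul1r.
  by rewrite mulr0.
have LK1 : lebL1 K by apply: (L1_ext _ (LK a (a + k^-1))) => x; rewrite KE.
have kV : 0 < k^-1 by rewrite invr_gt0.
exists K; split => //.
  by move=> x; rewrite normrM gtr0_norm// ler_wpM2l// ltW.
split => //; rewrite -(Int_ext KE) -[LHS]EK; last by rewrite lerDl ltW.
rewrite mulrDr mulfV ?gt_eqF// step_ge1; last by rewrite addrAC subrr add0r.
by rewrite step_le0 ?subr0// subrr.
Qed.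

(** A kernel of height k M on an interval of length 1 / k only sees the mean
oscillation of [f], so a Lebesgue point is enough, even for one-sided kernels. *)
Lemma kernel_cvg f a (K : nat -> R -> R) (M : R) : L1loc f -> lebesgue_pt f a -> 0 <= M ->
  (forall n, [/\ continuous (K n), forall x, ~~ (a <= x <= a + n.+1%:R^-1) -> K n x = 0,
    forall x, `|K n x| <= n.+1%:R * M & lebL1 (K n) /\ Int (K n) = 1]) ->
  (forall n, lebL1 (fun x => f x * K n x)) /\
  Int (fun x => f x * K n x) @[n --> \oo] --> f a.
Proof.
move=> Lf fa M0 HK.
have mK n : measurable_fun setT (K n).
  by have [cK _ _ _] := HK n; exact: continuous_measurable_fun.
have L n : lebL1 (fun x => f x * K n x).
  have [_ out bK _] := HK n.
  apply: (L1_ext _ (L1_bM (mK n) bK (proj2 Lf a (a + n.+1%:R^-1)))) => x.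
  rewrite mulrC /chi; case: ifPn => [_|/out ->]; first by rewrite mul1r.
  by rewrite !mulr0.
split => //; apply/cvgrPdist_le => /= e e0.
have e1 : 0 < e / (2 * M + 1) by rewrite divr_gt0//; lra.
have [d [d0 hd]] := lebesgue_pt_le (L1loc_locint Lf) fa e1.
have d2 : 0 < d / 2 by rewrite divr_gt0.
have := near_infty_natSinv_lt (PosNum d2); apply: filterS => n /= hn.
have [_ out bK [LK IK]] := HK n.
have k0 : 0 < (n.+1%:R : R) by rewrite ltr0n.
move: (n.+1%:R : R) k0 hn out bK => k k0 hn out bK.
have kV : 0 < k^-1 by rewrite invr_gt0.
have [|LI II] := hd (2 * k^-1); first by rewrite mulr_gt0//= mulrC -ltr_pdivlMr.
have -> : f a - Int (fun x => f x * K n x) = Int (fun x => (f a - f x) * K n x).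
  rewrite -[f a in LHS]mulr1 -IK -(IntZ (f a) LK) -IntB//; last exact: L1Z.
  by apply: Int_ext => x; ring.
apply: (@le_trans _ _ (Int (fun x => (k * M) * (\1_`]a - 2 * k^-1, a + 2 * k^-1[ x * `|f x - f a|)))).
  apply: Int_norm_le.
  - apply: (L1_ext _ (L1B (L1Z (f a) LK) (L n))) => x; ring.
  - exact: L1Z.
  - move=> x; rewrite normrM distrC.
    have [xa|/out ->] := boolP (a <= x <= a + k^-1); last first.
      by rewrite normr0 mulr0 !mulr_ge0// ltW.
    rewrite indicE mem_set ?mul1r; last first.
      by rewrite /= in_itv /=; case/andP: xa => ? ?; apply/andP; split; lra.
    by rewrite mulrC ler_wpM2r.
rewrite (IntZ _ LI); apply: (@le_trans _ _ ((k * M) * (e / (2 * M + 1) * (2 * k^-1)))).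
  by rewrite ler_wpM2l// mulr_ge0// ltW.
have -> : k * M * (e / (2 * M + 1) * (2 * k^-1)) = e * (2 * M / (2 * M + 1)).
  by field; rewrite gt_eqF//=; lra.
rewrite ler_piMr ?(ltW e0)// ler_pdivrMr; lra.
Qed.

Definition rtest (p : R -> R) := rsmooth p /\ compact (closure [set x | p x != 0]).

(** A smooth approximation of the indicator of the interval from a to b. *)
Definition plateau k a b x := step (k * x + - (k * a)) - step (k * x + - (k * b)).

Lemma plateau_out k a b x : 0 < k -> a < b -> ~~ (a <= x <= b + k^-1) -> plateau k a b x = 0.
Proof.
move=> k0 ab; rewrite negb_and -!ltNge => /orP[xa|bx]; rewrite /plateau.
  rewrite !step_le0 ?subrr// -mulrBr pmulr_rle0//; lra.
rewrite !step_ge1 ?subrr// -mulrBr.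
  rewrite -(mulfV (_ : k != 0)) ?gt_eqF// ler_pM2l//; lra.
rewrite -(mulfV (_ : k != 0)) ?gt_eqF// ler_pM2l//; lra.
Qed.

Lemma plateau_norm k a b x : `|plateau k a b x| <= 1.
Proof.
have /andP[? ?] := step01 (k * x + - (k * a)).
have /andP[? ?] := step01 (k * x + - (k * b)).
by rewrite ler_norml; apply/andP; split; rewrite /plateau; lra.
Qed.

Lemma plateau_test k a b : 0 < k -> a < b -> rtest (plateau k a b).
Proof.
move=> k0 ab; split.
  apply: diffn_smooth => n; rewrite /plateau.
  have -> : (fun x => step (k * x + - (k * a)) - step (k * x + - (k * b))) =
    (fun x => step (k * x + - (k * a)) + (-1) * step (k * x + - (k * b))).
    by apply/funext => x; rewrite mulN1r.
  by apply: diffnD; [|apply: diffnZ]; apply: diffn_affine; exact: diffn_step.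
apply: (@subclosed_compact _ _ `[a, b + k^-1]); first exact: closed_closure.
  exact: segment_compact.
have -> : `[a, b + k^-1]%classic = closure `[a, b + k^-1]%classic.
  by apply/closure_id; exact: itv_closed.
apply: closure_subset => x /=; apply: contraNT => nx.
by rewrite plateau_out//; move: nx; rewrite in_itv.
Qed.

Lemma meas_step : measurable_fun setT (@step R).
Proof. by apply: continuous_measurable_fun; apply: diffn_continuous; exact: diffn_step. Qed.

Lemma plateau_cvg a b x : a < b -> x != a ->
  plateau n.+1%:R a b x @[n --> \oo] --> chi a b x.
Proof.
move=> ab xa; apply: cvg_near_cst.
have big (y : R) : 0 < y -> \forall n \near \oo, 1 <= n.+1%:R * y.
  move=> y0; have := near_infty_natSinv_lt (PosNum y0); apply: filterS => n /= /ltW.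
  by rewrite -div1r ler_pdivrMr ?ltr0n// mulrC.
have [xa'|ax] := ltP x a.
  near=> n; rewrite plateau_out//; last by rewrite negb_and -ltNge xa'.
  by rewrite /chi leNgt xa'.
have {}ax : 0 < x - a by rewrite subr_gt0 lt_neqAle eq_sym xa.
have ax' : a <= x by lra.
have [xb|bx] := leP x b.
  near=> n; rewrite /plateau /chi ax' xb -!mulrBr step_ge1; last by near: n; exact: big.
  by rewrite step_le0 ?subr0// pmulr_rle0 ?ltr0n//; lra.
have {}bx : 0 < x - b by lra.
near=> n; rewrite /plateau /chi -!mulrBr step_ge1; last by near: n; exact: big.
rewrite step_ge1 ?subrr; last by near: n; exact: big.
by rewrite ax' /= leNgt -subr_gt0 bx.
Unshelve. all: by end_near.
Qed.

Lemma ae_neq a : {ae mu, forall x : R, x != a}.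
Proof.
exists [set a]; split => //; first exact: lebesgue_measure_set1.
by move=> x /= /negP; rewrite negbK => /eqP.
Qed.

Lemma ae_ex (P : R -> Prop) : {ae mu, forall x, P x} -> exists x, P x.
Proof.
move=> aP; apply: contrapT => nP.
case: aP => A [mA A0 sA].
have AT : A = setT by apply/seteqP; split => // x _; apply: sA => /= Px; apply: nP; exists x.
by move: A0; rewrite AT -set_itvNyy lebesgue_measure_itv.
Qed.

Lemma itg_cat a b c g : L1loc g -> a <= b -> b <= c -> itg a c g = itg a b g + itg b c g.
Proof.
move=> [mg Lg] ab bc; rewrite /itg -IntD//.
have mc u v : measurable_fun setT (fun x => chi u v x * g x).
  by apply: measurable_funM => //; exact: meas_chi.
apply: Int_ae; [exact: mc|exact: measurable_funD|].
apply: (ae_imp (ae_neq b)) => x xb; rewrite -mulrDl; congr (_ * _).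
rewrite /chi; have [xb'|bx] := leP x b.
  have {}xb : (b <= x) = false by apply/negbTE; rewrite -ltNge lt_neqAle xb.
  by rewrite xb /= addr0 (le_trans xb' bc).
by rewrite (ltW (le_lt_trans ab bx)) (ltW bx) /= add0r.
Qed.

(** Du Bois-Reymond's lemma. Testing against steep plateaus between two Lebesgue
points a < b of [f] gives f b - f a = itg a b g. Hence [f] agrees at all its
Lebesgue points with the primitive of [g] through one of them. *)
Lemma weak_deriv_prim f g : L1loc f -> L1loc g ->
  (forall p, rtest p -> - Int (fun x => f x * derive1 p x) = Int (fun x => g x * p x)) ->
  exists F, prim F g /\ {ae mu, forall x, f x = F x}.
Proof.
move=> Lf Lg H.
have lp := lebesgue_differentiation (L1loc_locint Lf).
have [M [M0 HM]] := step_kernel.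
have kpos (n : nat) : 0 < (n.+1%:R : R) by rewrite ltr0n.
pose K a (n : nat) := sval (cid (HM n.+1%:R a (kpos n))).
have HK a n := svalP (cid (HM n.+1%:R a (kpos n))).
have key a b : lebesgue_pt f a -> lebesgue_pt f b -> a < b -> f b - f a = itg a b g.
  move=> fa fb ab.
  have [La ca] : (forall n, lebL1 (fun x => f x * K a n x)) /\
      Int (fun x => f x * K a n x) @[n --> \oo] --> f a.
    by apply: (kernel_cvg Lf fa M0) => n; have [_ ? ? ? ?] := HK a n.
  have [Lb cb] : (forall n, lebL1 (fun x => f x * K b n x)) /\
      Int (fun x => f x * K b n x) @[n --> \oo] --> f b.
    by apply: (kernel_cvg Lf fb M0) => n; have [_ ? ? ? ?] := HK b n.
  have E n : Int (fun x => f x * K b n x) - Int (fun x => f x * K a n x) =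
      Int (fun x => g x * plateau n.+1%:R a b x).
    rewrite -(H _ (plateau_test (kpos n) ab)).
    have -> : derive1 (plateau n.+1%:R a b) = (fun x => K a n x - K b n x).
      apply: diffn_derive1n => x.
      by apply: is_deriveB; [have [] := HK a n|have [] := HK b n].
    rewrite -IntB// -IntN; last first.
      by apply: (L1_ext _ (L1B (La n) (Lb n))) => x; rewrite mulrBr.
    by apply: Int_ext => x; rewrite mulrBr opprB.
  have c1 : Int (fun x => g x * plateau n.+1%:R a b x) @[n --> \oo] --> f b - f a.
    by under eq_fun do rewrite -E; exact: cvgB.
  have c2 : Int (fun x => g x * plateau n.+1%:R a b x) @[n --> \oo] --> itg a b g.
    apply: (proj2 (Int_cvg_dom _ _ (L1_abs (proj2 Lg a (b + 1))) _ _)).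
    - move=> n; apply: measurable_funM; first exact: (proj1 Lg).
      by apply: measurable_funB; apply: (measurableT_comp meas_step); apply: measurable_funD => //;
        exact: mulrl_measurable.
    - by apply: measurable_funM; [exact: meas_chi|exact: (proj1 Lg)].
    - move=> n x; rewrite mulrC !normrM.
      have [xin|nx] := boolP (a <= x <= b + 1).
        by rewrite /chi xin normr1 ler_wpM2r// plateau_norm.
      rewrite plateau_out ?normr0 ?mul0r ?mulr_ge0//.
      apply: contra nx => /andP[-> /le_trans ->//].
      by rewrite lerD2l invf_le1// ler1n.
    - apply: (ae_imp (ae_neq a)) => x xa; rewrite mulrC.
      by apply: cvgMr; exact: plateau_cvg.
  by have := cvg_unique _ c1 c2; apply.
have [a0 fa0] := ae_ex lp.
pose F x := f a0 + (if a0 <= x then itg a0 x g else - itg x a0 g).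
exists F; split; last first.
  apply: (ae_imp lp) => x fx; rewrite /F; have [ax|xa] := leP a0 x.
    move: ax; rewrite le_eqVlt => /predU1P[<-|ax]; last by rewrite -key// subrKC.
    rewrite (_ : itg _ _ _ = 0) ?addr0//.
    apply: etrans (Int0 (R := R)); apply: Int_ae => //.
      by apply: measurable_funM; [exact: meas_chi|exact: (proj1 Lg)].
    apply: (ae_imp (ae_neq a0)) => y ya.
    by rewrite /chi -eq_le eq_sym (negbTE ya) mul0r.
  by rewrite -key// opprB subrKC.
split => // a b ab; rewrite /F.
have [xa|xa] := leP a0 a; have [xb|xb] := leP a0 b.
- by rewrite (itg_cat Lg xa ab) opprD addrACA subrr add0r addrAC subrr add0r.
- by have := lt_le_trans xb (le_trans xa ab); rewrite ltxx.
- by rewrite (itg_cat Lg (ltW xa) xb) opprD opprK addrACA subrr add0r addrC.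
- by rewrite (itg_cat Lg ab (ltW xb)) opprD opprK addrACA subrr add0r; ring.
Qed.

End WeakDeriv.

(** * Gaussian Schwartz functions and their Fourier transforms *)

Section GaussFT.
Context {R : realType}.
Notation mu := (@lebesgue_measure R).
Implicit Types (f g h : R -> R) (a b s x t : R) (p q : {poly R}).

Lemma Int_shift f a : lebL1 f ->
  lebL1 (fun x => f (x + a)) /\ Int (fun x => f (x + a)) = Int f.
Proof.
move=> L1f; have mf := L1_meas L1f.
pose N : R -> measurableTypeR R := fun x => x + a.
have mN : measurable_fun [set: measurableTypeR R] N by exact: measurable_funD.
have E A : measurable A -> A `<=` setT -> mu A = pushforward mu N A.
  move=> mA _; apply: (@lebesgue_measure_unique R (pushforward mu N)) => //.
  move=> X [[u v] _ <-] /=; rewrite /pushforward /=.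
  rewrite (_ : N @^-1` _ = `]u - a, v - a]%classic); last first.
    apply/seteqP; split => x /=; rewrite !in_itv /= /N => /andP[? ?]; apply/andP; split; lra.
  rewrite !lebesgue_measure_itv /= !lte_fin ltrD2r; case: ifP => // _.
  by congr EFin; ring.
have IfN : lebL1 (fun x => f (x + a)).
  have /integrableP[_ If] := L1f.
  apply/integrableP; split; first by apply/measurable_EFinP; exact: measurableT_comp.
  apply: le_lt_trans If; rewrite le_eqVlt; apply/orP; left; apply/eqP/esym.
  rewrite (eq_measure_integral (pushforward mu N)) //.
  rewrite ge0_integral_pushforward//.
    by apply: measurableT_comp => //; apply/measurable_EFinP.
split => //; apply/esym; rewrite /Rintegral; congr fine.
rewrite (eq_measure_integral (pushforward mu N)) //.
rewrite integral_pushforward//.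
exact/measurable_EFinP.
Qed.

(** The polynomial is dominated by exp |t|, and this exponential is absorbed by the
larger standard deviation. *)
Lemma poly_gauss_bound p s : 0 < s -> exists C : R, 0 <= C /\
  forall t, `|p.[t]| * gauss s t <= C * gauss (2 * s) t.
Proof.
move=> s0; have [C [C0 HC]] := poly_expR_bound p (ltr01 : 0 < (1 : R)).
exists (2 * C * expR (s ^+ 2)); split; first by rewrite !mulr_ge0// expR_ge0.
move=> t; apply: (@le_trans _ _ (C * expR (1 * `|t|) * gauss s t)).
  by rewrite ler_wpM2r// gauss_ge0.
rewrite /gauss normal_peak2.
rewrite [leLHS](_ : _ = C * normal_peak s * (expR (1 * `|t|) * expR (- t ^+ 2 / (s ^+ 2 *+ 2)))); last by ring.
rewrite [leRHS](_ : _ = C * normal_peak s * (expR (s ^+ 2) * expR (- t ^+ 2 / ((2 * s) ^+ 2 *+ 2)))); last by field.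
rewrite ler_wpM2l ?mulr_ge0 ?normal_peak_ge0// -!expRD ler_expR.
have -> : - t ^+ 2 / ((2 * s) ^+ 2 *+ 2) = - (`|t| / s) ^+ 2 / 8.
  by rewrite expr_div_n real_normK ?num_real//; field; rewrite gt_eqF.
have -> : - t ^+ 2 / (s ^+ 2 *+ 2) = - (`|t| / s) ^+ 2 / 2.
  by rewrite expr_div_n real_normK ?num_real//; field; rewrite gt_eqF.
have -> : 1 * `|t| = s * (`|t| / s) by field; rewrite gt_eqF.
(* with y = |t| / s, what remains is s y <= s^2 + 3 / 8 y^2 *)
have := sqr_ge0 (3 * (`|t| / s) - 4 * s); nra.
Qed.

Lemma meas_horner p : measurable_fun setT (horner p).
Proof. by apply: continuous_measurable_fun; exact: continuous_horner. Qed.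

Lemma poly_gauss_L1 p s : 0 < s -> lebL1 (fun t => p.[t] * gauss s t).
Proof.
move=> s0; have [C [C0 HC]] := poly_gauss_bound p s0.
have s20 : 2 * s != 0 by rewrite gt_eqF// mulr_gt0.
have Lg : lebL1 (gauss (2 * s)).
  by apply: (L1_ext _ (gauss_L1 0 s20)) => t; rewrite sub0r gaussN.
apply: (L1_le _ (L1Z C Lg)).
  by apply: measurable_funM; [exact: meas_horner|exact: meas_gauss].
by move=> t; rewrite normrM (ger0_norm (gauss_ge0 _ _)).
Qed.

Lemma poly_gauss_trig_L1 (c : R -> R) p s : 0 < s -> measurable_fun setT c ->
  (forall t, `|c t| <= 1) -> lebL1 (fun t => c t * (p.[t] * gauss s t)).
Proof. by move=> s0 mc c1; apply: (L1_bM mc c1); exact: poly_gauss_L1. Qed.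

Lemma gauss_derive s x : s != 0 -> is_derive x (1 : R) (gauss s) (- (x / s ^+ 2) * gauss s x).
Proof.
move=> s0; rewrite /gauss.
have d1 : is_derive x (1 : R) (fun z : R => - z ^+ 2 / (s ^+ 2 *+ 2)) (- (x / s ^+ 2)).
  have h : is_derive x (1 : R) (fun z : R => - (s ^+ 2 *+ 2)^-1 * z ^+ 2) _ :=
    is_deriveZ (- (s ^+ 2 *+ 2)^-1) (is_deriveX 2 (is_derive_id x (1 : R))).
  have -> : (fun z : R => - z ^+ 2 / (s ^+ 2 *+ 2)) = (fun z : R => - (s ^+ 2 *+ 2)^-1 * z ^+ 2).
    by apply/funext => z; rewrite mulNr mulrC -mulNr.
  by apply: (is_derive_eq h); rewrite /GRing.scale /=; field.
have d2 := @is_derive1_comp _ expR _ x _ _ (is_derive_expR _) d1.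
have d3 := is_deriveZ (normal_peak s) d2.
by apply: (is_derive_eq d3); rewrite /GRing.scale /=; ring.
Qed.

Lemma cos_lin_derive x t : is_derive t (1 : R) (fun t => cos (x * t)) (- x * sin (x * t)).
Proof.
have d1 : is_derive t (1 : R) (fun z : R => x * z) x.
  have h := is_deriveZ x (is_derive_id t (1 : R)).
  by apply: (is_derive_eq h); rewrite /GRing.scale /= mulr1.
have d2 := @is_derive1_comp _ (@cos R) _ t _ _ (is_derive_cos _) d1.
by apply: (is_derive_eq d2); ring.
Qed.

Lemma sin_lin_derive x t : is_derive t (1 : R) (fun t => sin (x * t)) (x * cos (x * t)).
Proof.
have d1 : is_derive t (1 : R) (fun z : R => x * z) x.
  have h := is_deriveZ x (is_derive_id t (1 : R)).
  by apply: (is_derive_eq h); rewrite /GRing.scale /= mulr1.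
have d2 := @is_derive1_comp _ (@sin R) _ t _ _ (is_derive_sin _) d1.
by apply: (is_derive_eq d2); ring.
Qed.

(** A family of Schwartz functions that contains the modulated Gaussians and their
Fourier transforms, and is closed under derivation. *)
Definition gpoly s a b p q x :=
  gauss s (x - a) * (p.[x] * cos (b * x) + q.[x] * sin (b * x)).

Lemma gpoly_derive s a b p q x : s != 0 -> is_derive x (1 : R) (gpoly s a b p q)
  (gpoly s a b (p^`() - (s ^+ 2)^-1 *: (('X - a%:P) * p) + b *: q)
               (q^`() - (s ^+ 2)^-1 *: (('X - a%:P) * q) - b *: p) x).
Proof.
move=> s0.
have d1 : is_derive x (1 : R) (fun z : R => z - a) 1.
  have h := is_deriveD (is_derive_id x (1 : R)) (is_derive_cst (- a) x (1 : R)).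
  by apply: (is_derive_eq h); rewrite addr0.
have d2 := @is_derive1_comp _ (gauss s) _ x _ _ (gauss_derive _ s0) d1.
have d3 := is_deriveD (is_deriveM (is_derive_poly p x) (cos_lin_derive b x))
  (is_deriveM (is_derive_poly q x) (sin_lin_derive b x)).
have d4 := is_deriveM d2 d3.
apply: (is_derive_eq d4).
rewrite /gpoly /GRing.scale /= !(hornerD, hornerN, hornerZ, hornerM, hornerX, hornerC).
set W := (horner p * _ + _) x; have -> : W = p.[x] * cos (b * x) + q.[x] * sin (b * x) by [].
by field.
Qed.

Lemma gpoly_bound s a b p q : 0 < s -> forall j : nat, exists M : R,
  forall x, `|x| ^+ j * `|gpoly s a b p q x| <= M.
Proof.
move=> s0 j.
have bnd (r : {poly R}) : exists M : R, forall x, `|r.[x]| * gauss s (x - a) <= M.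
  have [C [C0 HC]] := poly_gauss_bound (r \Po ('X + a%:P)) s0.
  exists (C * normal_peak (2 * s)) => x; have := HC (x - a).
  rewrite horner_comp hornerD hornerX hornerC subrK => /le_trans; apply.
  by rewrite ler_wpM2l// gauss_le.
have [M1 H1] := bnd ('X^j * p); have [M2 H2] := bnd ('X^j * q).
exists (M1 + M2) => x; apply: le_trans (lerD (H1 x) (H2 x)).
rewrite /gpoly normrM (ger0_norm (gauss_ge0 _ _)) mulrCA -mulrDl mulrC ler_wpM2r ?gauss_ge0//.
rewrite !hornerM hornerXn !normrM normrX -mulrDr ler_wpM2l ?exprn_ge0//.
apply: (le_trans (ler_normD _ _)); rewrite !normrM; apply: lerD.
  by rewrite ler_piMr// ler_norml cos_geN1 cos_le1.
by rewrite ler_piMr// ler_norml sin_geN1 sin_le1.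
Qed.

Definition gclass s a b f := exists p q, f = gpoly s a b p q.

Lemma gclass_derive1n s a b n f : 0 < s -> gclass s a b f ->
  gclass s a b (derive1n n f) /\ forall x, derivable (derive1n n f) x 1.
Proof.
move=> s0; have sn0 : s != 0 by rewrite gt_eqF.
have der (h : R -> R) : gclass s a b h -> forall x, derivable h x 1.
  move=> [p [q ->]] x; exact: (@ex_derive _ _ _ _ _ _ _ (gpoly_derive a b p q x sn0)).
elim: n f => [|n IH] f hf; first by split => //; exact: der.
rewrite derive1Sn; apply: IH; case: hf => [p [q ->]].
do 2 eexists; apply/diffn_derive1n => x; exact: gpoly_derive.
Qed.

Lemma gclass_schwartz s a b (f1 f2 : R -> R) : 0 < s -> gclass s a b f1 -> gclass s a b f2 ->
  schwartz (fun x => f1 x +i* f2 x)%C.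
Proof.
move=> s0 g1 g2; split.
  by move=> n x; split; [exact: (proj2 (gclass_derive1n n s0 g1))|exact: (proj2 (gclass_derive1n n s0 g2))].
move=> j k.
have [[p1 [q1 E1]] _] := gclass_derive1n k s0 g1.
have [[p2 [q2 E2]] _] := gclass_derive1n k s0 g2.
have [M1 H1] := gpoly_bound a b p1 q1 s0 j.
have [M2 H2] := gpoly_bound a b p2 q2 s0 j.
exists (M1 + M2) => _ [x _ <-]; rewrite /weighted_deriv /cderive.
apply: le_trans (lerD (H1 x) (H2 x)); rewrite -mulrDr ler_wpM2l ?exprn_ge0//.
rewrite /reP /imP /= -E1 -E2.
set u := derive1n _ _ _; set v := derive1n _ _ _.
rewrite -[leRHS]ger0_norm ?addr_ge0// -sqrtr_sqr ler_sqrt ?sqr_ge0//.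
rewrite sqrrD -!normrX !(ger0_norm (sqr_ge0 _)) addrAC lerDl mulrn_wge0// mulr_ge0//.
Qed.

Lemma gauss_L1_0 s : 0 < s -> lebL1 (gauss s).
Proof.
move=> s0; have sn0 : s != 0 by rewrite gt_eqF.
by apply: (L1_ext _ (gauss_L1 0 sn0)) => t; rewrite sub0r gaussN.
Qed.

Lemma meas_cos_lin x : measurable_fun setT (fun t : R => cos (x * t)).
Proof.
apply: continuous_measurable_fun; apply: diffn_continuous.
by exists (fun t => - x * sin (x * t)); split => // t; exact: cos_lin_derive.
Qed.

Lemma meas_sin_lin x : measurable_fun setT (fun t : R => sin (x * t)).
Proof.
apply: continuous_measurable_fun; apply: diffn_continuous.
by exists (fun t => x * cos (x * t)); split => // t; exact: sin_lin_derive.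
Qed.

Lemma cos_norm_le1 x : `|cos x| <= 1.
Proof. by rewrite ler_norml cos_geN1 cos_le1. Qed.

Lemma sin_norm_le1 x : `|sin x| <= 1.
Proof. by rewrite ler_norml sin_geN1 sin_le1. Qed.

Lemma cos_gauss_L1 p s x : 0 < s -> lebL1 (fun t => cos (x * t) * (p.[t] * gauss s t)).
Proof.
move=> s0; apply: poly_gauss_trig_L1 => //; first exact: meas_cos_lin.
by move=> t; exact: cos_norm_le1.
Qed.

Lemma sin_gauss_L1 p s x : 0 < s -> lebL1 (fun t => sin (x * t) * (p.[t] * gauss s t)).
Proof.
move=> s0; apply: poly_gauss_trig_L1 => //; first exact: meas_sin_lin.
by move=> t; exact: sin_norm_le1.
Qed.

(** The integrand is the derivative of [gpoly s 0 b p q]; this is integration by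
parts for all the Gaussian integrals below. *)
Lemma gpoly_int0 s b p q : 0 < s ->
  Int (gpoly s 0 b (p^`() - (s ^+ 2)^-1 *: ('X * p) + b *: q)
               (q^`() - (s ^+ 2)^-1 *: ('X * q) - b *: p)) = 0.
Proof.
move=> s0; have sn0 : s != 0 by rewrite gt_eqF.
have L p1 q1 : lebL1 (gpoly s 0 b p1 q1).
  apply: (L1_ext _ (L1D (cos_gauss_L1 p1 b s0) (sin_gauss_L1 q1 b s0))) => t.
  by rewrite /gpoly subr0; ring.
set g := gpoly _ _ _ _ _.
have dg x : is_derive x (1 : R) (gpoly s 0 b p q) (g x).
  by have := gpoly_derive 0 b p q x sn0; rewrite subr0.
apply: (prim_int0 (L p q) (L _ _)); apply: (prim_C1 dg).
apply: diffn_continuous; eexists; split; last by [].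
by move=> x; exact: gpoly_derive.
Qed.

Lemma gauss_cos_L1 s x : 0 < s -> lebL1 (fun t => cos (x * t) * gauss s t).
Proof. by move=> s0; apply: (L1_ext _ (cos_gauss_L1 1 x s0)) => t; rewrite hornerC mul1r. Qed.

Lemma gauss_sin_L1 s x : 0 < s -> lebL1 (fun t => sin (x * t) * gauss s t).
Proof. by move=> s0; apply: (L1_ext _ (sin_gauss_L1 1 x s0)) => t; rewrite hornerC mul1r. Qed.

Lemma gauss_tsin_L1 s x : 0 < s -> lebL1 (fun t => sin (x * t) * (t * gauss s t)).
Proof. by move=> s0; apply: (L1_ext _ (sin_gauss_L1 'X x s0)) => t; rewrite hornerX. Qed.

Lemma gauss_t2cos_L1 s x : 0 < s -> lebL1 (fun t => cos (x * t) * (t ^+ 2 * gauss s t)).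
Proof. by move=> s0; apply: (L1_ext _ (cos_gauss_L1 'X^2 x s0)) => t; rewrite hornerXn. Qed.

Lemma gauss_tsin s x : 0 < s -> Int (fun t => sin (x * t) * (t * gauss s t)) =
  s ^+ 2 * x * Int (fun t => cos (x * t) * gauss s t).
Proof.
move=> s0; have := gpoly_int0 x 0 1 s0.
rewrite (Int_ext (g := fun t => x * (cos (x * t) * gauss s t) -
    (s ^+ 2)^-1 * (sin (x * t) * (t * gauss s t)))); last first.
  move=> t; rewrite /gpoly subr0 !(hornerD, hornerN, hornerZ, hornerM, hornerX, hornerC, derivC).
  by ring.
have L1 := L1Z x (gauss_cos_L1 x s0).
have L2 := L1Z (s ^+ 2)^-1 (gauss_tsin_L1 x s0).
rewrite (IntB L1 L2) (IntZ x (gauss_cos_L1 x s0)) (IntZ _ (gauss_tsin_L1 x s0)).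
move/eqP; rewrite subr_eq0 => /eqP H.
by rewrite -mulrA H mulVKf// gt_eqF// exprn_gt0.
Qed.

(** Differentiation under the integral sign, followed by an integration by parts:
the transform F of the Gaussian solves F' = - s^2 x F. *)
Lemma gauss_cos_der s x : 0 < s -> is_derive x (1 : R)
  (fun x => Int (fun t => cos (x * t) * gauss s t))
  (- (s ^+ 2 * x * Int (fun t => cos (x * t) * gauss s t))).
Proof.
move=> s0.
pose f y t := cos (y * t) * gauss s t.
have df y t : is_derive y (1 : R) (f ^~ t) (- (sin (y * t) * (t * gauss s t))).
  have h := is_deriveM (cos_lin_derive t y) (is_derive_cst (gauss s t) y (1 : R)).
  have -> : f ^~ t = (fun y => cos (t * y)) * cst (gauss s t).
    by apply/funext => z; rewrite /f [z * t]mulrC.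
  apply: (is_derive_eq h); rewrite /GRing.scale /= [y * t]mulrC; ring.
have xI : `]x - 1, x + 1[%classic x by rewrite /= in_itv /=; apply/andP; split; lra.
have intf y : `]x - 1, x + 1[%classic y -> mu.-integrable setT (EFin \o f y).
  by move=> _; exact: gauss_cos_L1.
have derf y t : `]x - 1, x + 1[%classic y -> setT t -> derivable (f ^~ t) y 1.
  by move=> _ _; exact: (@ex_derive _ _ _ _ _ _ _ (df y t)).
pose G t := `|t * gauss s t|.
have G0 t : 0 <= G t by exact: normr_ge0.
have LG : lebL1 G.
  by apply: L1_abs; apply: (L1_ext _ (poly_gauss_L1 'X s0)) => t; rewrite hornerX.
have d1E y t : ('D_1 (f ^~ t) y) = - (sin (y * t) * (t * gauss s t)).
  exact: (@derive_val _ _ _ _ _ _ _ (df y t)).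
have Gub y t : `]x - 1, x + 1[%classic y -> setT t -> `|partial1of2 f y t| <= G t.
  move=> _ _; rewrite partial1of2E d1E normrN normrM ler_piMl//.
  exact: sin_norm_le1.
have D1 := @derivable_under_integral R _ _ mu f setT measurableT x _ _ xI intf derf G G0 LG Gub.
have E1 := @differentiation_under_integral R _ _ mu f setT measurableT x _ _ xI intf derf G G0 LG Gub.
apply: DeriveDef => //.
rewrite -derive1E E1 (Int_ext (g := fun t => - (sin (x * t) * (t * gauss s t)))); last first.
  by move=> t; rewrite partial1of2E d1E.
by rewrite (IntN (gauss_tsin_L1 x s0)) gauss_tsin.
Qed.

Lemma gauss_cos_ft s x : 0 < s -> Int (fun t => cos (x * t) * gauss s t) = damp s x.
Proof.
move=> s0; have sn0 : s != 0 by rewrite gt_eqF.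
pose F x := Int (fun t => cos (x * t) * gauss s t).
have dE y : is_derive y (1 : R) (fun y => expR (s ^+ 2 * y ^+ 2 / 2)) (s ^+ 2 * y * expR (s ^+ 2 * y ^+ 2 / 2)).
  have h : is_derive y (1 : R) (fun z : R => (s ^+ 2 / 2) * z ^+ 2) _ :=
    is_deriveZ (s ^+ 2 / 2) (is_deriveX 2 (is_derive_id y (1 : R))).
  have d2 := @is_derive1_comp _ expR _ y _ _ (is_derive_expR _) h.
  have E : (fun y => expR (s ^+ 2 * y ^+ 2 / 2)) = expR \o (fun z : R => (s ^+ 2 / 2) * z ^+ 2).
    by apply/funext => z /=; congr expR; rewrite mulrAC.
  by rewrite E; apply: (is_derive_eq d2); rewrite /GRing.scale /= mulrAC; field.
have dZ y : is_derive y (1 : R) (fun y => F y * expR (s ^+ 2 * y ^+ 2 / 2)) 0.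
  have h := is_deriveM (gauss_cos_der y s0) (dE y).
  apply: (is_derive_eq h); rewrite /GRing.scale /= -/(F y); ring.
have := is_derive_0_is_cst x 0 dZ.
rewrite expr0n /= mulr0 mul0r expR0 mulr1.
have -> : F 0 = 1.
  rewrite /F (Int_ext (g := fun t => 1 * gauss s (0 - t))).
    by rewrite gauss_IntZ.
  by move=> t; rewrite mul0r cos0 sub0r gaussN.
move=> H; rewrite -/(F x) /damp mulNr expRN.
have e0 : expR (s ^+ 2 * x ^+ 2 / 2) != 0 by rewrite gt_eqF// expR_gt0.
by apply: (mulIf e0); rewrite H mulVf.
Qed.

Lemma gauss_t2cos_ft s x : 0 < s -> Int (fun t => cos (x * t) * (t ^+ 2 * gauss s t)) =
  s ^+ 2 * (1 - s ^+ 2 * x ^+ 2) * damp s x.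
Proof.
move=> s0; have := gpoly_int0 x 'X 0 s0.
have L0 := gauss_cos_L1 x s0; have L1 := gauss_tsin_L1 x s0; have L2 := gauss_t2cos_L1 x s0.
rewrite (Int_ext (g := fun t => cos (x * t) * gauss s t -
    ((s ^+ 2)^-1 * (cos (x * t) * (t ^+ 2 * gauss s t)) + x * (sin (x * t) * (t * gauss s t))))); last first.
  move=> t; rewrite /gpoly subr0 derivX deriv0 !(hornerD, hornerN, hornerZ, hornerM, hornerX, hornerC, horner0).
  by rewrite expr2; ring.
have L3 := L1Z (s ^+ 2)^-1 L2; have L4 := L1Z x L1.
rewrite (IntB L0 (L1D L3 L4)) (IntD L3 L4) (IntZ _ L2) (IntZ _ L1) gauss_tsin// gauss_cos_ft//.
set I := Int _ => H.
have s20 : s ^+ 2 != 0 by rewrite gt_eqF// exprn_gt0.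
have -> : I = s ^+ 2 * ((s ^+ 2)^-1 * I) by rewrite mulVKf.
have -> : (s ^+ 2)^-1 * I = damp s x - x * (s ^+ 2 * x * damp s x) by lra.
by rewrite expr2; ring.
Qed.

Lemma gauss_sin_ft s x : 0 < s -> Int (fun t => sin (x * t) * gauss s t) = 0.
Proof.
move=> s0; have L := sin_gauss_L1 1 x s0.
have L' : lebL1 (fun t => sin (x * t) * gauss s t).
  by apply: (L1_ext _ L) => t; rewrite hornerC mul1r.
have [_] := Int_reflect L'.
have -> : (fun t => sin (x * - t) * gauss s (- t)) = (fun t => - (sin (x * t) * gauss s t)).
  by apply/funext => t; rewrite mulrN sinN gaussN mulNr.
by rewrite IntN// => h; lra.
Qed.

Lemma gauss_shift_trig s a x : 0 < s ->
  Int (fun t => cos (x * t) * gauss s (t - a)) = cos (x * a) * damp s x /\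
  Int (fun t => sin (x * t) * gauss s (t - a)) = sin (x * a) * damp s x.
Proof.
move=> s0; have sn0 : s != 0 by rewrite gt_eqF.
have Lg : lebL1 (fun t => gauss s (t - a)).
  by apply: (L1_ext _ (gauss_L1 a sn0)) => t; rewrite gaussC.
have Lc : lebL1 (fun t => cos (x * t) * gauss s (t - a)).
  by apply: (L1_bM (meas_cos_lin x) _ Lg) => t; exact: cos_norm_le1.
have Ls : lebL1 (fun t => sin (x * t) * gauss s (t - a)).
  by apply: (L1_bM (meas_sin_lin x) _ Lg) => t; exact: sin_norm_le1.
have L1 := gauss_cos_L1 x s0; have L2 := gauss_sin_L1 x s0.
split.
  have [_ <-] := Int_shift a Lc.
  rewrite (Int_ext (g := fun t => cos (x * a) * (cos (x * t) * gauss s t) -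
     sin (x * a) * (sin (x * t) * gauss s t))); last first.
    by move=> t; rewrite addrK mulrDr cosD; ring.
  by rewrite IntB ?IntZ ?gauss_cos_ft ?gauss_sin_ft ?mulr0 ?subr0//; exact: L1Z.
have [_ <-] := Int_shift a Ls.
rewrite (Int_ext (g := fun t => sin (x * a) * (cos (x * t) * gauss s t) +
   cos (x * a) * (sin (x * t) * gauss s t))); last first.
  by move=> t; rewrite addrK mulrDr sinD; ring.
by rewrite IntD ?IntZ ?gauss_cos_ft ?gauss_sin_ft ?mulr0 ?addr0//; exact: L1Z.
Qed.

End GaussFT.

(** * The Plancherel identity for the convolution *)

Section RealPlancherel.
Context {R : realType}.
Notation mu := (@lebesgue_measure R).
Implicit Types (f g h : R -> R) (a b s x t : R).

(** The hypothesis makes every mollified pairing of [h] with itself vanish, and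
these converge to the integral of h^2. *)
Lemma gauss_pairing_eq0_L2 h : rL2 h ->
  (forall (n : nat) a, Int (fun y => h y * gauss n.+1%:R^-1 (y - a)) = 0) ->
  {ae mu, forall x, h x = 0}.
Proof.
move=> hh H.
have c1 := moll_cvg hh hh.
have E n : moll n.+1%:R^-1 h h = 0.
  rewrite /moll (Int_ext (g := fun=> 0)) ?Int0// => x.
  rewrite (Int_ext (g := fun y => h y * gauss n.+1%:R^-1 (y - x))) ?H ?mulr0//.
  by move=> y; rewrite mulrC gaussC.
have c2 : moll n.+1%:R^-1 h h @[n --> \oo] --> (0 : R).
  by under eq_fun do rewrite E; exact: cvg_cst.
have I0 : Int (fun x => h x * h x) = 0 by have := cvg_unique _ c1 c2; apply.
have := Int_eq0_ae (rL2_mul hh hh) _ I0 => /(_ _)/ae_imp; apply.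
  by move=> x; rewrite -expr2 sqr_ge0.
by move=> x /eqP; rewrite mulf_eq0 orbb => /eqP.
Qed.

Lemma dampE s x : 0 < s -> damp s x = (normal_peak s^-1)^-1 * gauss s^-1 x.
Proof.
move=> s0; rewrite /gauss mulKf; last by rewrite gt_eqF// normal_peak_gt0// invr_eq0 gt_eqF.
by rewrite /damp; congr expR; field; rewrite gt_eqF.
Qed.

Lemma gaussE s x : 0 < s -> gauss s x = normal_peak s * damp s^-1 x.
Proof.
move=> s0; rewrite dampE ?invr_gt0// invrK mulVKf// gt_eqF// normal_peak_gt0// gt_eqF//.
Qed.

Lemma dampN s x : damp s (- x) = damp s x.
Proof. by rewrite /damp sqrrN. Qed.

Lemma damp_rL2 s : 0 < s -> rL2 (damp s).
Proof.
move=> s0; have sV0 : s^-1 != 0 by rewrite invr_eq0 gt_eqF.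
apply: (rL2_ext _ (rL2Z (normal_peak s^-1)^-1 (gauss_rL2 0 sV0))) => x.
by rewrite sub0r gaussN -dampE.
Qed.

Lemma damp_L1 s : 0 < s -> lebL1 (damp s).
Proof.
move=> s0; have sV0 : 0 < s^-1 by rewrite invr_gt0.
by apply: (L1_ext _ (L1Z (normal_peak s^-1)^-1 (gauss_L1_0 sV0))) => x; rewrite -dampE.
Qed.

Lemma damp_gauss s a : 0 < s -> exists (C r b : R), 0 < r /\
  forall y, damp 1 y * gauss s (y - a) = C * gauss r (y - b).
Proof.
move=> s0; have q0 : 0 < 1 + s ^+ 2 by rewrite ltr_pwDl// sqr_ge0.
(* completing the square in y^2 + (y - a)^2 / s^2 *)
pose r := s / Num.sqrt (1 + s ^+ 2); pose b := a / (1 + s ^+ 2).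
have r0 : 0 < r by rewrite divr_gt0// sqrtr_gt0.
have r2 : r ^+ 2 = s ^+ 2 / (1 + s ^+ 2) by rewrite expr_div_n sqr_sqrtr// ltW.
exists (normal_peak s / normal_peak r * expR (- (a ^+ 2 / (2 * (1 + s ^+ 2))))), r, b; split => // y.
rewrite /damp /gauss r2.
rewrite [RHS](_ : _ = normal_peak s * (expR (- (a ^+ 2 / (2 * (1 + s ^+ 2)))) *
   expR (- (y - b) ^+ 2 / (s ^+ 2 / (1 + s ^+ 2) *+ 2)))); last first.
  by field; rewrite gt_eqF// normal_peak_gt0// gt_eqF.
rewrite mulrCA -!expRD; congr (_ * expR _); rewrite /b.
by field; rewrite ?gt_eqF.
Qed.

Lemma damp_gt0 s x : 0 < damp s x. Proof. exact: expR_gt0. Qed.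

(** Multiplying [h] by [damp 1] brings it into L^2 and keeps all pairings with
Gaussians equal to 0. *)
Lemma gauss_pairing_eq0_bnd h (M : R) : measurable_fun setT h -> (forall x, `|h x| <= M) ->
  (forall s a, 0 < s -> Int (fun y => h y * gauss s (y - a)) = 0) ->
  {ae mu, forall x, h x = 0}.
Proof.
move=> mh hM H.
have hd : rL2 (fun x => h x * damp 1 x) by exact: (rL2_bM mh hM (damp_rL2 ltr01)).
have := gauss_pairing_eq0_L2 hd => /(_ _)/ae_imp; apply; last first.
  by move=> x /eqP; rewrite mulf_eq0 orbC gt_eqF ?damp_gt0//= => /eqP.
move=> n a; have n0 : 0 < (n.+1%:R^-1 : R) by rewrite invr_gt0.
have [C [r [b [r0 E]]]] := damp_gauss a n0.
rewrite (Int_ext (g := fun y => C * (h y * gauss r (y - b)))).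
  rewrite IntZ ?H ?mulr0//; apply: (L1_bM mh hM).
  by apply: (L1_ext _ (gauss_L1 b (lt0r_neq0 r0))) => t; rewrite gaussC.
by move=> y; rewrite -mulrA E mulrCA.
Qed.

Lemma normal_peakV s : 0 < s -> normal_peak s * normal_peak s^-1 = (pi *+ 2)^-1.
Proof.
move=> s0; rewrite /normal_peak -invfM; congr (_^-1).
have p0 : 0 <= (pi *+ 2 : R) by rewrite mulrn_wge0// pi_ge0.
have E (z : R) : Num.sqrt (z ^+ 2 * pi *+ 2) = `|z| * Num.sqrt (pi *+ 2).
  by rewrite -mulrnAr sqrtrM ?sqr_ge0// sqrtr_sqr.
rewrite !E !gtr0_norm ?invr_gt0//.
by rewrite mulrACA mulfV ?gt_eqF// mul1r -expr2 sqr_sqrtr.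
Qed.

Lemma eqN_eq0 (z : R) : z = - z -> z = 0.
Proof. by move=> h; lra. Qed.

(** The setting: p + i q is the transform of the real function eta, w is the real
bounded transform of W, and g1 + i g2 is the convolution. HA and HG are these
relations tested on Gaussians, Hw the parity of w. *)
Variables (eta p q w g1 g2 : R -> R) (M : R).
Hypothesis heta : rL2 eta.
Hypothesis hp : rL2 p.
Hypothesis hq : rL2 q.
Hypothesis hg1 : rL2 g1.
Hypothesis hg2 : rL2 g2.
Hypothesis mw : measurable_fun setT w.
Hypothesis w0 : forall x, 0 <= w x.
Hypothesis wM : forall x, w x <= M.
Hypothesis HA : forall s a, 0 < s ->
  Int (fun x => eta x * (cos (a * x) * damp s x)) = Int (fun t => p t * gauss s (t - a)) /\
  Int (fun x => eta x * (sin (a * x) * damp s x)) = - Int (fun t => q t * gauss s (t - a)).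
Hypothesis HG : forall s y, 0 < s ->
  Int (fun x => g1 x * damp s (y - x)) =
    Int (fun t => (w t * p t * cos (y * t) - w t * q t * sin (y * t)) * gauss s t) /\
  Int (fun x => g2 x * damp s (y - x)) =
    Int (fun t => (w t * p t * sin (y * t) + w t * q t * cos (y * t)) * gauss s t).
Hypothesis Hw : forall s a, 0 < s ->
  Int (fun t => w t * gauss s (t - a)) = Int (fun t => w t * gauss s (t + a)).

Let normw x : `|w x| <= M. Proof. by rewrite ger0_norm. Qed.
Let hwp : rL2 (fun t => w t * p t). Proof. exact: (rL2_bM mw normw hp). Qed.
Let hwq : rL2 (fun t => w t * q t). Proof. exact: (rL2_bM mw normw hq). Qed.

Lemma gauss_shift_rL2 s a : 0 < s -> rL2 (fun t => gauss s (t - a)).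
Proof.
move=> s0; apply: (rL2_ext _ (gauss_rL2 a (lt0r_neq0 s0))) => t.
by rewrite gaussC.
Qed.

Lemma reflect_gauss f s a : lebL1 (fun t => f t * gauss s (t + a)) ->
  Int (fun t => f (- t) * gauss s (t - a)) = Int (fun t => f t * gauss s (t + a)).
Proof.
move=> L; have [_ <-] := Int_reflect L; apply: Int_ext => t.
by rewrite -gaussN opprB [- t + a]addrC.
Qed.

Lemma rL2_reflect f : rL2 f -> rL2 (fun x => f (- x)).
Proof.
move=> [mf Lf]; split; first by apply: measurableT_comp => //; exact: oppr_measurable.
by have [] := Int_reflect Lf.
Qed.

Lemma w_even : {ae mu, forall x, w (- x) = w x}.
Proof.
have mwN : measurable_fun setT (fun x => w (- x)).
  by apply: measurableT_comp => //; exact: oppr_measurable.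
have Lwg (f : R -> R) s a : measurable_fun setT f -> (forall x, `|f x| <= M) -> 0 < s ->
    lebL1 (fun t => f t * gauss s (t - a)).
  move=> mf fM s0; apply: (L1_bM mf fM).
  by apply: (L1_ext _ (gauss_L1 a (lt0r_neq0 s0))) => t; rewrite gaussC.
have := @gauss_pairing_eq0_bnd (fun x => w (- x) - w x) (M + M) => /(_ _ _ _)/ae_imp; apply.
- exact: measurable_funB.
- by move=> x; apply: (le_trans (ler_normB _ _)); exact: lerD.
- move=> s a s0.
  rewrite (Int_ext (g := fun t => w (- t) * gauss s (t - a) - w t * gauss s (t - a))).
    have L1 := Lwg w s a mw normw s0.
    have L2 := Lwg (fun x => w (- x)) s a mwN (fun x => normw (- x)) s0.
    have L3 := Lwg w s (- a) mw normw s0; rewrite opprK in L3.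
    by rewrite (IntB L2 L1) (reflect_gauss L3) (Hw a s0) subrr.
  by move=> t; rewrite mulrBl.
- by move=> x /eqP; rewrite subr_eq0 => /eqP.
Qed.

Lemma p_even : {ae mu, forall x, p (- x) = p x}.
Proof.
have hN := rL2_reflect hp.
have := @gauss_pairing_eq0_L2 (fun x => p (- x) - p x) (rL2B hN hp) => /(_ _)/ae_imp; apply; last first.
  by move=> x /eqP; rewrite subr_eq0 => /eqP.
move=> n a; have n0 : 0 < (n.+1%:R^-1 : R) by rewrite invr_gt0.
move: (n.+1%:R^-1 : R) n0 => s s0.
rewrite (Int_ext (g := fun t => p (- t) * gauss s (t - a) - p t * gauss s (t - a))); last first.
  by move=> t; rewrite mulrBl.
have L b : lebL1 (fun t => p t * gauss s (t - b)) by apply: rL2_mul => //; exact: gauss_shift_rL2.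
rewrite IntB//; last by apply: rL2_mul => //; exact: gauss_shift_rL2.
rewrite reflect_gauss; last by rewrite -[a]opprK; exact: L.
rewrite -(proj1 (HA a s0)).
have := proj1 (HA (- a) s0); rewrite opprK => <-.
by apply/eqP; rewrite subr_eq0; apply/eqP; apply: Int_ext => x; rewrite mulNr cosN.
Qed.

Lemma q_odd : {ae mu, forall x, q (- x) = - q x}.
Proof.
have hN := rL2_reflect hq.
have := @gauss_pairing_eq0_L2 (fun x => q (- x) + q x) (rL2D hN hq) => /(_ _)/ae_imp; apply; last first.
  by move=> x /eqP; rewrite addr_eq0 => /eqP.
move=> n a; have n0 : 0 < (n.+1%:R^-1 : R) by rewrite invr_gt0.
move: (n.+1%:R^-1 : R) n0 => s s0.
rewrite (Int_ext (g := fun t => q (- t) * gauss s (t - a) + q t * gauss s (t - a))); last first.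
  by move=> t; rewrite mulrDl.
have L b : lebL1 (fun t => q t * gauss s (t - b)) by apply: rL2_mul => //; exact: gauss_shift_rL2.
rewrite IntD//; last by apply: rL2_mul => //; exact: gauss_shift_rL2.
rewrite reflect_gauss; last by rewrite -[a]opprK; exact: L.
have E1 := proj2 (HA a s0); have := proj2 (HA (- a) s0); rewrite opprK => E2.
have E3 : Int (fun x => eta x * (sin (- a * x) * damp s x)) = - Int (fun x => eta x * (sin (a * x) * damp s x)).
  rewrite -IntN.
    by apply: Int_ext => x; rewrite mulNr sinN mulNr mulrN.
  apply: rL2_mul => //; apply: (rL2_bM (meas_sin_lin a) _ (damp_rL2 s0)) => x.
  exact: sin_norm_le1.
by move: E3; rewrite E1 E2 => /oppr_inj ->; rewrite addNr.
Qed.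

(** By parity, the integral that represents the pairing of [g2] with a Gaussian
has an odd integrand. *)
Lemma convolution_imag_eq0 : {ae mu, forall x, g2 x = 0}.
Proof.
apply: (gauss_pairing_eq0_L2 hg2) => n a.
have n0 : 0 < (n.+1%:R^-1 : R) by rewrite invr_gt0.
move: (n.+1%:R^-1 : R) n0 => s s0; have sV0 : 0 < s^-1 by rewrite invr_gt0.
rewrite (Int_ext (g := fun x => normal_peak s * (g2 x * damp s^-1 (a - x)))); last first.
  by move=> x; rewrite gaussC gaussE// mulrCA.
have hd : rL2 (fun x => damp s^-1 (a - x)).
  apply: (rL2_ext _ (rL2Z (normal_peak s)^-1 (gauss_rL2 a (lt0r_neq0 s0)))) => x.
  by rewrite gaussE// mulKf// gt_eqF// normal_peak_gt0// gt_eqF.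
rewrite IntZ; last exact: rL2_mul.
rewrite (proj2 (HG a sV0)).
set F := fun t => _.
have LF : lebL1 F.
  have hc : rL2 (fun t => cos (a * t) * gauss s^-1 t).
    apply: (rL2_bM (meas_cos_lin a) (fun t => cos_norm_le1 _)).
    by apply: (rL2_ext _ (gauss_shift_rL2 0 sV0)) => t; rewrite subr0.
  have hs : rL2 (fun t => sin (a * t) * gauss s^-1 t).
    apply: (rL2_bM (meas_sin_lin a) (fun t => sin_norm_le1 _)).
    by apply: (rL2_ext _ (gauss_shift_rL2 0 sV0)) => t; rewrite subr0.
  apply: (L1_ext _ (L1D (rL2_mul hwp hs) (rL2_mul hwq hc))) => t.
  by rewrite /F mulrDl !mulrA.
have [LFN EF] := Int_reflect LF.
suff : Int (fun t => F (- t)) = - Int F by rewrite EF => /eqN_eq0 ->; rewrite mulr0.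
rewrite -IntN//; apply: Int_ae; [exact: L1_meas|exact: L1_meas (L1N LF)|].
apply: (ae_imp (ae_and w_even (ae_and p_even q_odd))) => t [Ew [Ep Eq]].
by rewrite /F Ew Ep Eq gaussN mulrN cosN sinN; ring.
Qed.

(** The Plancherel identity at the level of mollified pairings. Inserting HG for
the Gaussian mean of g1 gives a double integral over position and frequency;
integrating first over the position, with HA, gives mollified pairings on the
frequency side. The constant is the product of the peaks of [gauss s] and
[gauss s^-1]. *)
Lemma moll_plancherel s : 0 < s -> moll s eta g1 =
  (pi *+ 2)^-1 * (moll s (fun t => w t * p t) p + moll s (fun t => w t * q t) q).
Proof.
move=> s0; have sV0 : 0 < s^-1 by rewrite invr_gt0.
have sn0 := lt0r_neq0 s0.
pose F (y t : R) := damp s y * eta y * ((w t * p t * cos (y * t) - w t * q t * sin (y * t)) * damp s t).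
have L1e : lebL1 (fun y => damp s y * eta y) by apply: rL2_mul => //; exact: damp_rL2.
have L1p : lebL1 (fun t => w t * p t * damp s t) by apply: rL2_mul => //; exact: damp_rL2.
have L1q : lebL1 (fun t => w t * q t * damp s t) by apply: rL2_mul => //; exact: damp_rL2.
have c1 y t : `|cos (y * t)| <= 1 by exact: cos_norm_le1.
have s1 y t : `|sin (y * t)| <= 1 by exact: sin_norm_le1.
have Lc y : lebL1 (fun t => cos (y * t) * (w t * p t * damp s t)) by exact: (L1_bM (meas_cos_lin y) (c1 y) L1p).
have Ls y : lebL1 (fun t => sin (y * t) * (w t * q t * damp s t)) by exact: (L1_bM (meas_sin_lin y) (s1 y) L1q).
have LF y : lebL1 (F y).
  apply: (L1_ext _ (L1Z (damp s y * eta y) (L1B (Lc y) (Ls y)))) => t.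
  by rewrite /F; ring.
(* the Gaussian mean of g1 at y, expressed by HG as an integral over frequencies *)
have E1 y : damp s y * eta y * Int (fun x => gauss s (y - x) * g1 x) =
    (pi *+ 2)^-1 * Int (F y).
  have -> : Int (fun x => gauss s (y - x) * g1 x) =
      normal_peak s * Int (fun x => g1 x * damp s^-1 (y - x)).
    rewrite -IntZ.
      by apply: Int_ext => x; rewrite gaussE// mulrCA mulrC.
    apply: rL2_mul => //; apply: (rL2_ext _ (rL2Z (normal_peak s)^-1 (gauss_rL2 y sn0))) => x.
    by rewrite gaussE// mulKf// gt_eqF// normal_peak_gt0.
  rewrite (proj1 (HG y sV0)) -(normal_peakV s0).
  rewrite (Int_ext (g := fun t => normal_peak s^-1 * (cos (y * t) * (w t * p t * damp s t) -
      sin (y * t) * (w t * q t * damp s t)))); last first.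
    by move=> t; rewrite gaussE// invrK; ring.
  rewrite (IntZ _ (L1B (Lc y) (Ls y))).
  rewrite (Int_ext (f := F y) (g := fun t => (damp s y * eta y) * (cos (y * t) * (w t * p t * damp s t) -
      sin (y * t) * (w t * q t * damp s t)))); last by move=> t; rewrite /F; ring.
  rewrite (IntZ _ (L1B (Lc y) (Ls y))).
  by move: (Int _) => I; ring.
pose b t := `|w t * p t * damp s t| + `|w t * q t * damp s t|.
have Lb : lebL1 b by apply: L1D; exact: L1_abs.
have Fb y t : `|F y t| <= `|damp s y * eta y| * b t.
  rewrite /F normrM ler_wpM2l// mulrBl (le_trans (ler_normB _ _))//.
  by rewrite /b; apply: lerD; rewrite mulrAC normrM ler_piMr.
have m1 (f : R -> R) : measurable_fun setT f -> measurable_fun setT (fun z : R * R => f z.1).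
  by move=> mf; apply: (measurableT_comp mf); exact: measurable_fst.
have m2 (f : R -> R) : measurable_fun setT f -> measurable_fun setT (fun z : R * R => f z.2).
  by move=> mf; apply: (measurableT_comp mf); exact: measurable_snd.
have mprod : measurable_fun setT (fun z : R * R => z.1 * z.2).
  by apply: measurable_funM; [exact: measurable_fst|exact: measurable_snd].
have mcos2 : measurable_fun setT (fun z : R * R => cos (z.1 * z.2)).
  have mc := @meas_cos_lin R 1; have := measurableT_comp mc mprod.
  by apply: eq_measurable_fun => z _ /=; rewrite mul1r.
have msin2 : measurable_fun setT (fun z : R * R => sin (z.1 * z.2)).
  have mc := @meas_sin_lin R 1; have := measurableT_comp mc mprod.
  by apply: eq_measurable_fun => z _ /=; rewrite mul1r.
have LP : L1prod (fun z : R * R => F z.1 z.2).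
  apply: (L1prod_crit (a := fun y => Int b * `|damp s y * eta y|)).
  - rewrite /F; apply: measurable_funM.
      by apply: (m1 (fun y => damp s y * eta y)); exact: L1_meas.
    apply: measurable_funM; last exact: (m2 _ (meas_damp s)).
    apply: measurable_funB; apply: measurable_funM => //.
      by apply: (m2 (fun t => w t * p t)); exact: rL2_meas hwp.
    by apply: (m2 (fun t => w t * q t)); exact: rL2_meas hwq.
  - by move=> y; exact: LF.
  - by apply: L1Z; exact: L1_abs.
  - move=> y /=; rewrite mulrC -(IntZ _ Lb).
    by apply: Int_le; [apply: L1_abs; exact: LF|exact: L1Z|exact: Fb].
have [LFy EF] := Fubini_Int LP.
(* at a fixed frequency t, the integral over positions, expressed by HA *)
have E2 t : Int (fun y => F y t) =
   damp s t * (w t * p t) * Int (fun z => gauss s (t - z) * p z) +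
   damp s t * (w t * q t) * Int (fun z => gauss s (t - z) * q z).
  have [A1 A2] := HA t s0.
  have -> : Int (fun z => gauss s (t - z) * p z) = Int (fun z => p z * gauss s (z - t)).
    by apply: Int_ext => z; rewrite gaussC mulrC.
  have -> : Int (fun z => gauss s (t - z) * q z) = Int (fun z => q z * gauss s (z - t)).
    by apply: Int_ext => z; rewrite gaussC mulrC.
  have hc : rL2 (fun x => cos (t * x) * damp s x) := rL2_bM (meas_cos_lin t) (c1 t) (damp_rL2 s0).
  have hs : rL2 (fun x => sin (t * x) * damp s x) := rL2_bM (meas_sin_lin t) (s1 t) (damp_rL2 s0).
  have L1 := L1Z (w t * p t * damp s t) (rL2_mul heta hc).
  have L2 := L1Z (w t * q t * damp s t) (rL2_mul heta hs).
  rewrite -A1 -[Int (fun z => q z * _)]opprK -A2.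
  rewrite (Int_ext (g := fun y => w t * p t * damp s t * (eta y * (cos (t * y) * damp s y)) -
     w t * q t * damp s t * (eta y * (sin (t * y) * damp s y)))); last first.
    by move=> y; rewrite /F [y * t]mulrC; ring.
  rewrite (IntB L1 L2) (IntZ _ (rL2_mul heta hc)) (IntZ _ (rL2_mul heta hs)).
  by move: (Int _) (Int _) => I1 I2; ring.
have [Lp Ep] := mollE sn0 hwp hp.
have [Lq Eq] := mollE sn0 hwq hq.
transitivity (Int (fun y => (pi *+ 2)^-1 * Int (F y))).
  by apply: Int_ext => y; exact: E1.
rewrite (IntZ _ LFy); congr (_ * _).
apply: (etrans EF); rewrite /= /moll -(IntD Lp Lq).
by apply: Int_ext => t; exact: E2.
Qed.

(** The limit of [moll_plancherel] is
2 pi int eta g1 = int w (p^2 + q^2), and w is nonnegative. *)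
Lemma convolution_pairing_ge0 : 0 <= Int (fun x => eta x * g1 x).
Proof.
have c1 := moll_cvg heta hg1.
have c2 := cvgD (moll_cvg hwp hp) (moll_cvg hwq hq).
have E : Int (fun x => eta x * g1 x) = (pi *+ 2)^-1 *
    (Int (fun x => w x * p x * p x) + Int (fun x => w x * q x * q x)).
  have c3 : (pi *+ 2)^-1 * (moll n.+1%:R^-1 (fun t => w t * p t) p + moll n.+1%:R^-1 (fun t => w t * q t) q)
     @[n --> \oo] --> (pi *+ 2)^-1 *
    (Int (fun x => w x * p x * p x) + Int (fun x => w x * q x * q x)).
    by apply: cvgMr; exact: c2.
  have c4 : moll n.+1%:R^-1 eta g1 @[n --> \oo] --> (pi *+ 2)^-1 *
    (Int (fun x => w x * p x * p x) + Int (fun x => w x * q x * q x)).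
    by under eq_fun do rewrite moll_plancherel ?invr_gt0//.
  by have := cvg_unique _ c1 c4; apply.
rewrite E; apply: mulr_ge0; first by rewrite invr_ge0 mulrn_wge0// pi_ge0.
apply: addr_ge0; apply: Int_ge0 => x; rewrite -mulrA -expr2; apply: mulr_ge0 => //; exact: sqr_ge0.
Qed.

End RealPlancherel.

(** * Real spectral data of a tempered convolution *)

Section Interface.
Context {R : realType}.
Notation mu := (@lebesgue_measure R).
Implicit Types (a b s x t : R) (f F : R -> R[i]).
Local Open Scope complex_scope.

Lemma Re_mul (x y : R[i]) : complex.Re (x * y) = complex.Re x * complex.Re y - complex.Im x * complex.Im y.
Proof. by case: x => a b; case: y => c d. Qed.

Lemma Im_mul (x y : R[i]) : complex.Im (x * y) = complex.Re x * complex.Im y + complex.Im x * complex.Re y.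
Proof. by case: x => a b; case: y => c d. Qed.

Lemma dist_ofE f (phi : R -> R[i]) : dist_of f phi =
  (Int (fun x => reP f x * reP phi x - imP f x * imP phi x)) +i*
  (Int (fun x => reP f x * imP phi x + imP f x * reP phi x)).
Proof.
rewrite /dist_of /cintegral; congr (_ +i* _); apply: Int_ext => x.
  by rewrite /reP Re_mul.
by rewrite /imP Im_mul.
Qed.

Definition gphi s a b (t : R) : R[i] :=
  (gauss s (t - a) * cos (b * t)) +i* (gauss s (t - a) * sin (b * t)).

Lemma schwartz_gphi s a b : 0 < s -> schwartz (gphi s a b).
Proof.
move=> s0.
have -> : gphi s a b = fun x => gpoly s a b 1 0 x +i* gpoly s a b 0 1 x.
  apply/funext => x; rewrite /gphi /gpoly !hornerC.
  by rewrite !mul1r !mul0r add0r addr0.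
by apply: (@gclass_schwartz _ s a b) => //; do 2 eexists.
Qed.

Definition gphihat s a b (x : R) : R[i] :=
  (cos ((b - x) * a) * damp s (b - x)) +i* (sin ((b - x) * a) * damp s (b - x)).

Lemma fourier_gphi s a b : 0 < s -> fourier (gphi s a b) = gphihat s a b.
Proof.
move=> s0; apply/funext => x; rewrite /fourier /cintegral /gphihat.
have [E1 E2] := gauss_shift_trig a (b - x) s0.
rewrite -E1 -E2; congr (_ +i* _); apply: Int_ext => t.
  rewrite /reP Re_mul /= cosN sinN mulrBl cosB [t * x]mulrC; ring.
rewrite /imP Im_mul /= cosN sinN mulrBl sinB [t * x]mulrC; ring.
Qed.

Lemma fourier_is_gphi (T : (R -> R[i]) -> R[i]) F s a b : 0 < s -> fourier_is T F ->
  T (gphihat s a b) = dist_of F (gphi s a b).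
Proof. by move=> s0 H; rewrite -fourier_gphi//; apply: H; exact: schwartz_gphi. Qed.

Lemma schwartz_gphihat s a : 0 < s -> schwartz (gphihat s a 0).
Proof.
move=> s0; have sV0 : 0 < s^-1 by rewrite invr_gt0.
pose c := (normal_peak s^-1)^-1.
have -> : gphihat s a 0 = fun x => gpoly s^-1 0 a c%:P 0 x +i* gpoly s^-1 0 a 0 (- c)%:P x.
  apply/funext => x; rewrite /gphihat /gpoly !hornerC.
  rewrite sub0r subr0 mulNr cosN sinN dampN dampE// -/c !mul0r addr0 add0r [x * a]mulrC.
  by congr (_ +i* _); ring.
by apply: (@gclass_schwartz _ s^-1 0 a) => //; do 2 eexists.
Qed.

Lemma gphihatN s a x : gphihat s a 0 (- x) = gphihat s (- a) 0 x.
Proof.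
by rewrite /gphihat opprK add0r sub0r mulrNN dampN mulrC.
Qed.

Lemma ae_bounded_rep (h : R -> R) : h \in Lfun mu +oo%E -> exists (h0 : R -> R) (M : R),
  [/\ measurable_fun setT h0, forall x, `|h0 x| <= M & {ae mu, forall x, h x = h0 x}].
Proof.
move=> /Lfuny_bounded [mh [M [M0 HM]]].
exists (fun x => if `|h x| <= M then h x else 0), M; split.
- by apply: measurable_fun_ifT => //; apply: measurable_fun_ler => //; exact: measurableT_comp.
- by move=> x; case: ifP; rewrite ?normr0.
- by apply: (ae_imp HM) => x ->.
Qed.

Lemma Linfty_uniq F F' : Lp +oo%E F -> Lp +oo%E F' ->
  (forall s a, 0 < s -> dist_of F (gphi s a 0) = dist_of F' (gphi s a 0)) ->
  {ae mu, forall x, reP F x = reP F' x} /\ {ae mu, forall x, imP F x = imP F' x}.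
Proof.
move=> [F1 F2] [G1 G2] H.
have U (h k : R -> R) : h \in Lfun mu +oo%E -> k \in Lfun mu +oo%E ->
   (forall s a, 0 < s -> Int (fun t => h t * gauss s (t - a)) = Int (fun t => k t * gauss s (t - a))) ->
   {ae mu, forall x, h x = k x}.
  move=> hL kL E.
  have [h0 [M [mh0 bh eh]]] := ae_bounded_rep hL.
  have [k0 [N [mk0 bk ek]]] := ae_bounded_rep kL.
  have [mh _] := Lfuny_bounded hL; have [mk _] := Lfuny_bounded kL.
  suff h0k0 : {ae mu, forall x, h0 x - k0 x = 0}.
    apply: (ae_imp (ae_and eh (ae_and ek h0k0))) => x [-> [-> /eqP]].
    by rewrite subr_eq0 => /eqP.
  apply: (@gauss_pairing_eq0_bnd _ (fun x => h0 x - k0 x) (M + N)).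
  + exact: measurable_funB.
  + by move=> x; apply: (le_trans (ler_normB _ _)); exact: lerD.
  + move=> s a s0.
    have mg : measurable_fun setT (fun t : R => gauss s (t - a)).
      by apply: (measurableT_comp (meas_gauss s)); exact: measurable_funB.
    have Lg : lebL1 (fun t => gauss s (t - a)).
      by apply: (L1_ext _ (gauss_L1 a (lt0r_neq0 s0))) => t; rewrite gaussC.
    rewrite (Int_ext (g := fun t => h0 t * gauss s (t - a) - k0 t * gauss s (t - a))); last first.
      by move=> t; rewrite mulrBl.
    rewrite (IntB (L1_bM mh0 bh Lg) (L1_bM mk0 bk Lg)).
    apply/eqP; rewrite subr_eq0; apply/eqP.
    transitivity (Int (fun t => h t * gauss s (t - a))).
      apply: Int_ae; [exact: measurable_funM|exact: measurable_funM|].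
      by apply: (ae_imp eh) => t ->.
    rewrite E//; apply: Int_ae; [exact: measurable_funM|exact: measurable_funM|].
    by apply: (ae_imp ek) => t ->.
have pair (h : R -> R[i]) s a : 0 < s -> dist_of h (gphi s a 0) =
    (Int (fun t => reP h t * gauss s (t - a))) +i* (Int (fun t => imP h t * gauss s (t - a))).
  move=> s0; rewrite dist_ofE; congr (_ +i* _); apply: Int_ext => t;
    by rewrite /reP /imP /= mul0r cos0 sin0 mulr1 mulr0 ?mulr0 ?subr0 ?add0r.
by split; apply: U => // s a s0; have := H s a s0; rewrite !pair// => -[].
Qed.

(** All that the rest of the proof uses about the convolution. Here p is the real
part of the transform of eta and w a bounded nonnegative representative of the
transform of W. The symbol that defines the convolution represents the same
tempered distribution as the given one, so the two agree almost everywhere. *)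
Lemma convolution_spectral (W : tempered_distribution R) (What : R -> R[i]) (eta : R -> R) (g : R -> R[i]) :
  td_even W -> Lp +oo%E What -> fourier_is W What ->
  {ae mu, forall xi, 0 <= What xi} ->
  rL2 eta -> convolution_is W (fun x => (eta x)%:C) g ->
  exists (p w : R -> R) (M : R),
  [/\ rL2 p, measurable_fun setT w, (forall x, 0 <= w x <= M) &
      {ae mu, forall x, reP What x = w x}] /\
  [/\ rL2 (reP g), {ae mu, forall x, imP g x = 0}, 0 <= Int (fun x => eta x * reP g x) &
   forall s, 0 < s ->
   [/\ Int (fun x => eta x * damp s x) = Int (fun t => p t * gauss s t),
       Int (fun x => eta x * (s ^+ 2 * (1 - s ^+ 2 * x ^+ 2) * damp s x)) =
         Int (fun t => p t * (t ^+ 2 * gauss s t)) &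
       Int (fun x => reP g x * damp s x) = Int (fun t => w t * p t * gauss s t)]].
Proof.
move=> W_even WL FW W0 heta [gL2 [What0 [fhat [W0L FW0 fL2 Ff Fg]]]].
have hp : rL2 (reP fhat) by apply: Lfun2_rL2; case: fL2.
have hq : rL2 (imP fhat) by apply: Lfun2_rL2; case: fL2.
have hg1 : rL2 (reP g) by apply: Lfun2_rL2; case: gL2.
have hg2 : rL2 (imP g) by apply: Lfun2_rL2; case: gL2.
have [eW1 eW2] : {ae mu, forall x, reP What x = reP What0 x} /\ {ae mu, forall x, imP What x = imP What0 x}.
  apply: Linfty_uniq => // s a s0.
  by rewrite -(fourier_is_gphi a 0 s0 FW) -(fourier_is_gphi a 0 s0 FW0).
have [h0 [M [mh0 bh eh]]] := ae_bounded_rep (proj1 WL).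
(* the absolute value makes the representative nonnegative everywhere *)
pose w x := `|h0 x|.
have mw : measurable_fun setT w by exact: measurableT_comp.
have w0 x : 0 <= w x by exact: normr_ge0.
have wM x : w x <= M by exact: bh.
have ew : {ae mu, forall x, reP What x = w x /\ imP What x = 0}.
  apply: (ae_imp (ae_and W0 eh)) => x [].
  rewrite /reP /imP; case: (What x) => c d; rewrite lecE /= => /andP[/eqP -> c0] E.
  by split => //; rewrite /w -E ger0_norm.
have mW0 : measurable_fun setT (reP What0) by exact: (proj1 (Lfuny_bounded (proj1 W0L))).
have mW0i : measurable_fun setT (imP What0) by exact: (proj1 (Lfuny_bounded (proj2 W0L))).
have mW1 : measurable_fun setT (reP What) by exact: (proj1 (Lfuny_bounded (proj1 WL))).
have mgs s a : measurable_fun setT (fun t : R => gauss s (t - a)).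
  by apply: (measurableT_comp (meas_gauss s)); exact: measurable_funB.
have HA s a : 0 < s ->
  Int (fun x => eta x * (cos (a * x) * damp s x)) = Int (fun t => reP fhat t * gauss s (t - a)) /\
  Int (fun x => eta x * (sin (a * x) * damp s x)) = - Int (fun t => imP fhat t * gauss s (t - a)).
  move=> s0; have := fourier_is_gphi a 0 s0 Ff; rewrite !dist_ofE => -[E1 E2]; split.
    apply: (etrans (etrans _ E1)); apply: Int_ext => t.
      by rewrite /reP /imP /= sub0r mulNr cosN dampN [t * a]mulrC mul0r subr0.
    by rewrite /reP /imP /= mul0r cos0 sin0 mulr1 !mulr0 subr0.
  have -> : Int (fun t => imP fhat t * gauss s (t - a)) =
      - Int (fun x => eta x * (sin (a * x) * damp s x)); last by rewrite opprK.
  have hs : rL2 (fun x => sin (a * x) * damp s x).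
    by apply: (rL2_bM (meas_sin_lin a) _ (damp_rL2 s0)) => x; exact: sin_norm_le1.
  rewrite -(IntN (rL2_mul heta hs)).
  rewrite [RHS](Int_ext (g := fun x => reP (fun x => (eta x)%:C) x * imP (gphihat s a 0) x +
       imP (fun x => (eta x)%:C) x * reP (gphihat s a 0) x)); last first.
    move=> x; rewrite /reP /imP /= sub0r mulNr sinN dampN [x * a]mulrC mul0r addr0.
    by ring.
  rewrite E2; apply: Int_ext => t.
  by rewrite /reP /imP /= mul0r cos0 sin0 mulr1 !mulr0 add0r.
have eG : {ae mu, forall x, reP (fun xi => What0 xi * fhat xi) x = w x * reP fhat x /\
     imP (fun xi => What0 xi * fhat xi) x = w x * imP fhat x}.
  apply: (ae_imp (ae_and ew (ae_and eW1 eW2))) => x [[E1 E2] [E3 E4]].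
  have E5 : reP What0 x = w x by rewrite -E3.
  have E6 : imP What0 x = 0 by rewrite -E4.
  have -> : reP (fun xi => What0 xi * fhat xi) x = reP What0 x * reP fhat x - imP What0 x * imP fhat x.
    exact: Re_mul.
  have -> : imP (fun xi => What0 xi * fhat xi) x = reP What0 x * imP fhat x + imP What0 x * reP fhat x.
    exact: Im_mul.
  by rewrite E5 E6 !mul0r subr0 addr0.
have mG1 : measurable_fun setT (reP (fun xi => What0 xi * fhat xi)).
  apply: (eq_measurable_fun (fun x => reP What0 x * reP fhat x - imP What0 x * imP fhat x)).
    by move=> x _; rewrite [RHS]/reP Re_mul.
  by apply: measurable_funB; apply: measurable_funM => //; [case: hp|case: hq].
have mG2 : measurable_fun setT (imP (fun xi => What0 xi * fhat xi)).
  apply: (eq_measurable_fun (fun x => reP What0 x * imP fhat x + imP What0 x * reP fhat x)).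
    by move=> x _; rewrite [RHS]/imP Im_mul.
  by apply: measurable_funD; apply: measurable_funM => //; [case: hq|case: hp].
have mp := rL2_meas hp; have mq := rL2_meas hq.
have HG s y : 0 < s ->
  Int (fun x => reP g x * damp s (y - x)) =
    Int (fun t => (w t * reP fhat t * cos (y * t) - w t * imP fhat t * sin (y * t)) * gauss s t) /\
  Int (fun x => imP g x * damp s (y - x)) =
    Int (fun t => (w t * reP fhat t * sin (y * t) + w t * imP fhat t * cos (y * t)) * gauss s t).
  move=> s0; have := fourier_is_gphi 0 y s0 Fg; rewrite !dist_ofE => -[E1 E2].
  have mc := meas_cos_lin y; have ms := meas_sin_lin y; have mg := meas_gauss s.
  have mgc : measurable_fun setT (reP (gphi s 0 y)).
    by rewrite /reP /=; apply: measurable_funM.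
  have mgi : measurable_fun setT (imP (gphi s 0 y)).
    by rewrite /imP /=; apply: measurable_funM.
  split.
    transitivity (Int (fun x => reP g x * reP (gphihat s 0 y) x - imP g x * imP (gphihat s 0 y) x)).
      by apply: Int_ext => x; rewrite [reP (gphihat _ _ _) _]/reP [imP (gphihat _ _ _) _]/imP /= mulr0 cos0 sin0 mul1r mul0r mulr0 subr0.
    rewrite E1; apply: Int_ae.
    + by apply: measurable_funB; exact: measurable_funM.
    + by apply: measurable_funM => //; apply: measurable_funB; apply: measurable_funM => //; exact: measurable_funM.
    + apply: (ae_imp eG) => t [-> ->].
      by rewrite [reP (gphi _ _ _) _]/reP [imP (gphi _ _ _) _]/imP /= subr0; ring.
  transitivity (Int (fun x => reP g x * imP (gphihat s 0 y) x + imP g x * reP (gphihat s 0 y) x)).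
    by apply: Int_ext => x; rewrite [reP (gphihat _ _ _) _]/reP [imP (gphihat _ _ _) _]/imP /= mulr0 cos0 sin0 mul1r mul0r mulr0 add0r.
  rewrite E2; apply: Int_ae.
  + by apply: measurable_funD; exact: measurable_funM.
  + by apply: measurable_funM => //; apply: measurable_funD; apply: measurable_funM => //; exact: measurable_funM.
  + apply: (ae_imp eG) => t [-> ->].
    by rewrite [reP (gphi _ _ _) _]/reP [imP (gphi _ _ _) _]/imP /= subr0; ring.
have Hw s a : 0 < s -> Int (fun t => w t * gauss s (t - a)) = Int (fun t => w t * gauss s (t + a)).
  move=> s0.
  have E : dist_of What (gphi s a 0) = dist_of What (gphi s (- a) 0).
    rewrite -(fourier_is_gphi a 0 s0 FW) -(fourier_is_gphi (- a) 0 s0 FW).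
    rewrite -(W_even _ (schwartz_gphihat a s0)); congr (td_fun W _).
    by apply/funext => x; rewrite gphihatN.
  have R1 b : Int (fun t => w t * gauss s (t - b)) = complex.Re (dist_of What (gphi s b 0)).
    rewrite dist_ofE /=.
    transitivity (Int (fun t => reP What t * gauss s (t - b))).
      apply: Int_ae; [exact: measurable_funM|exact: measurable_funM|].
      by apply: (ae_imp ew) => t [->].
    by apply: Int_ext => t; rewrite /reP /imP /= mul0r cos0 sin0 mulr1 !mulr0 subr0.
  by rewrite R1 E -R1 opprK.
exists (reP fhat), w, M; split.
  split => //; first by move=> x; rewrite w0 wM.
  by apply: (ae_imp ew) => x [].
split => //.
- exact: (convolution_imag_eq0 heta hp hq hg2 mw w0 wM HA HG Hw).
- exact: (convolution_pairing_ge0 heta hp hq hg1 mw w0 wM HA HG).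
- move=> s s0; split.
  + have [E _] := HA s 0 s0; transitivity (Int (fun x => eta x * (cos (0 * x) * damp s x))).
      by apply: Int_ext => x; rewrite mul0r cos0 mul1r.
    by rewrite E; apply: Int_ext => t; rewrite subr0.
  + pose phi2 t : R[i] := (t ^+ 2 * gauss s t)%:C.
    have sphi2 : schwartz phi2.
      have -> : phi2 = fun x => gpoly s 0 0 'X^2 0 x +i* gpoly s 0 0 0 0 x.
        apply/funext => x; rewrite /phi2 /gpoly hornerXn !hornerC subr0 mul0r cos0 mulr1.
        by rewrite !mul0r !addr0 mulr0 mulrC.
      by apply: (@gclass_schwartz _ s 0 0) => //; do 2 eexists.
    have := Ff _ sphi2; rewrite !dist_ofE => -[E _].
    transitivity (Int (fun x => reP (fun x => (eta x)%:C) x * reP (fourier phi2) x -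
       imP (fun x => (eta x)%:C) x * imP (fourier phi2) x)).
      apply: Int_ext => x; rewrite [imP (fun x => (eta x)%:C) x]/imP /= mul0r subr0; congr (_ * _).
      rewrite -(gauss_t2cos_ft x s0) /fourier /cintegral /reP /=; apply: Int_ext => t.
      by rewrite cosN mulr0 subr0 [t * x]mulrC.
    rewrite E; apply: Int_ext => t.
    by rewrite [imP phi2 t]/imP [reP phi2 t]/reP /= mulr0 subr0.
  + have [E _] := HG s 0 s0; transitivity (Int (fun x => reP g x * damp s (0 - x))).
      by apply: Int_ext => x; rewrite sub0r dampN.
    by rewrite E; apply: Int_ext => t; rewrite mul0r cos0 sin0 mulr1 mulr0 subr0.
Qed.

End Interface.

(** * Conservation laws and the weighted identity *)

Section ODE.
Context {R : realType}.
Notation mu := (@lebesgue_measure R).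
Implicit Types (f g h F : R -> R) (a b s x t : R).

(** The line has infinite measure. *)
Lemma L1_cst_eq0 (c : R) : lebL1 (fun _ : R => c) -> c = 0.
Proof.
move=> Lc; apply/eqP; apply: contraT => c0.
have c0' : 0 < `|c| by rewrite normr_gt0.
have B (n : nat) : `|c| * n%:R <= Int (fun _ : R => `|c|).
  have <- : Int (fun x => `|c| * chi 0 n%:R x) = `|c| * n%:R.
    by rewrite (IntZ _ (L1_chi 0 n%:R)) Int_chi// subr0.
  apply: Int_le; [by apply: L1Z; exact: L1_chi|exact: L1_abs|].
  by move=> x; rewrite ler_piMr// (le_trans (ler_norm _))// chi_norm.
have := nbhs_infty_gtr (Int (fun _ : R => `|c|) / `|c|).
move=> [n _ /(_ n (leqnn n))] /=; rewrite ltr_pdivrMr// mulrC => H1.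
by have := B n; rewrite leNgt H1.
Qed.

Lemma itg_ae a b f g : measurable_fun setT f -> measurable_fun setT g ->
  {ae mu, forall x, f x = g x} -> itg a b f = itg a b g.
Proof.
move=> mf mg fg; apply: Int_ae.
- by apply: measurable_funM => //; exact: meas_chi.
- by apply: measurable_funM => //; exact: meas_chi.
- by apply: (ae_imp fg) => x ->.
Qed.

Lemma L1loc_ae f g : measurable_fun setT g -> {ae mu, forall x, f x = g x} -> L1loc f -> L1loc g.
Proof.
move=> mg fg [mf Lf]; split => // a b; apply: (L1_ae _ _ (Lf a b)).
  by apply: measurable_funM => //; exact: meas_chi.
by apply: (ae_imp fg) => x ->.
Qed.

Lemma prim_ae F f g : measurable_fun setT g -> {ae mu, forall x, f x = g x} ->
  prim F f -> prim F g.
Proof.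
move=> mg fg [Lf E]; split; first exact: L1loc_ae fg Lf.
by move=> a b ab; rewrite E//; apply: itg_ae => //; case: Lf.
Qed.

Lemma rL2_ae f g : measurable_fun setT g -> {ae mu, forall x, f x = g x} -> rL2 f -> rL2 g.
Proof.
move=> mg fg [mf Lf]; split => //; apply: (L1_ae _ _ Lf); first exact: measurable_funX.
by apply: (ae_imp fg) => x ->.
Qed.

Lemma damp_derive s x : is_derive x (1 : R) (damp s) (- (s ^+ 2 * x) * damp s x).
Proof.
have h : is_derive x (1 : R) (fun z : R => - (s ^+ 2 / 2) * z ^+ 2) _ :=
  is_deriveZ (- (s ^+ 2 / 2)) (is_deriveX 2 (is_derive_id x (1 : R))).
have d2 := @is_derive1_comp _ expR _ x _ _ (is_derive_expR _) h.
have E : damp s = expR \o (fun z : R => - (s ^+ 2 / 2) * z ^+ 2).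
  by apply/funext => z /=; rewrite /damp; congr expR; ring.
by rewrite E; apply: (is_derive_eq d2); rewrite /GRing.scale /=; field.
Qed.

Lemma damp_derive2 s x : is_derive x (1 : R) (fun x => - (s ^+ 2 * x) * damp s x)
  (- (s ^+ 2 * (1 - s ^+ 2 * x ^+ 2) * damp s x)).
Proof.
have h : is_derive x (1 : R) (fun z : R => - s ^+ 2 * z) _ :=
  is_deriveZ (- s ^+ 2) (is_derive_id x (1 : R)).
have d := is_deriveM h (damp_derive s x).
have E : (fun x => - (s ^+ 2 * x) * damp s x) = (fun z : R => - s ^+ 2 * z) * damp s.
  by apply/funext => z; rewrite -mulNr.
by rewrite E; apply: (is_derive_eq d); rewrite /GRing.scale /=; ring.
Qed.

Lemma continuous_damp s : continuous (damp s).
Proof.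
move=> x; apply: differentiable_continuous; apply/derivable1_diffP.
exact: (@ex_derive _ _ _ _ _ _ _ (damp_derive s x)).
Qed.

Lemma prim_damp s : prim (damp s) (fun x => - (s ^+ 2 * x) * damp s x).
Proof.
apply: prim_C1; first exact: damp_derive.
apply: diffn_continuous; eexists; split; last by [].
by move=> x; exact: damp_derive2.
Qed.

Lemma prim_damp2 s : prim (fun x => - (s ^+ 2 * x) * damp s x)
  (fun x => - (s ^+ 2 * (1 - s ^+ 2 * x ^+ 2) * damp s x)).
Proof.
apply: prim_C1; first exact: damp_derive2.
move=> x; apply: (@cvgN _ R^o); apply: cvgM; last exact: continuous_damp.
apply: cvgMr; apply: (@cvgB _ R^o); first exact: cvg_cst.
by apply: cvgMr; exact: sqr_continuous.
Qed.

Lemma rL2_le f h : measurable_fun setT f -> rL2 h -> (forall x, `|f x| <= h x) -> rL2 f.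
Proof.
move=> mf [mh Lh] fh; split => //; apply: (L1_le _ Lh); first exact: measurable_funX.
move=> x; rewrite ger0_norm ?sqr_ge0// -[f x ^+ 2]real_normK ?num_real//.
by rewrite lerXn2r ?nnegrE// (le_trans _ (fh x)).
Qed.

Lemma poly_damp_rL2 (p : {poly R}) s : 0 < s -> rL2 (fun x => p.[x] * damp s x).
Proof.
move=> s0; have sV0 : 0 < s^-1 by rewrite invr_gt0.
have [C [C0 HC]] := poly_gauss_bound p sV0.
have s2 : 0 < 2 * s^-1 by rewrite mulr_gt0.
have hg : rL2 (gauss (2 * s^-1)).
  by apply: (rL2_ext _ (gauss_shift_rL2 0 s2)) => x; rewrite subr0.
apply: (rL2_le _ (rL2Z (normal_peak s^-1)^-1 (rL2Z C hg))).
  by apply: measurable_funM; [exact: meas_horner|exact: meas_damp].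
move=> x; rewrite normrM (ger0_norm (damp_ge0 _ _)) dampE// mulrCA.
by rewrite ler_wpM2l// invr_ge0 normal_peak_ge0.
Qed.

Lemma xdamp_rL2 s : 0 < s -> rL2 (fun x => - (s ^+ 2 * x) * damp s x).
Proof.
move=> s0; apply: (rL2_ext _ (poly_damp_rL2 (- s ^+ 2 *: 'X) s0)) => x.
by rewrite hornerZ hornerX mulNr.
Qed.

Lemma x2damp_rL2 s : 0 < s -> rL2 (fun x => s ^+ 2 * (1 - s ^+ 2 * x ^+ 2) * damp s x).
Proof.
move=> s0; apply: (rL2_ext _ (poly_damp_rL2 (s ^+ 2 *: (1 - s ^+ 2 *: 'X^2)) s0)) => x.
by rewrite !(hornerZ, hornerD, hornerN, hornerXn, hornerC).
Qed.

Variables (U1 U2 V1 V2 g : R -> R) (c : R).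
Hypothesis c2 : c ^+ 2 = 2.
Hypothesis pU1 : prim U1 V1.
Hypothesis pU2 : prim U2 V2.
Hypothesis pV1 : prim V1 (fun x => c * V2 x - U1 x * g x).
Hypothesis pV2 : prim V2 (fun x => - c * V1 x - U2 x * g x).
Hypothesis hV1 : rL2 V1.
Hypothesis hV2 : rL2 V2.
Hypothesis hg : rL2 g.

(** The density defect 1 - |u|^2. *)
Definition Eta x := 1 - U1 x ^+ 2 - U2 x ^+ 2.
Hypothesis hEta : rL2 Eta.

Definition kinetic x := V1 x ^+ 2 + V2 x ^+ 2.
(** The real part of conj(u) u', which is - 1 / 2 times the derivative of the
defect. *)
Definition current x := U1 x * V1 x + U2 x * V2 x.

Lemma kinetic_ge0 x : 0 <= kinetic x. Proof. by rewrite addr_ge0// sqr_ge0. Qed.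

Lemma kinetic_L1 : lebL1 kinetic.
Proof. by apply: L1D; [case: hV1|case: hV2]. Qed.

Lemma prim_Eta : prim Eta (fun x => - 2 * current x).
Proof.
have h := primD (prim_cst 1) (primZ (-1) (primD (prim_mul pU1 pU1) (prim_mul pU2 pU2))).
apply: prim_ext h => x; rewrite /Eta /current; ring.
Qed.

(** Both sides have the same derivative, so J = U1 V2 - U2 V1 - (c / 2) Eta is a
constant k. Where Eta^2 <= 1 the momentum is at most |u| |u'| with
|u|^2 = 1 - Eta <= 2, and where Eta^2 > 1 trivially k^2 <= k^2 Eta^2. So the
constant k^2 is dominated by the integrable function
4 |u'|^2 + (1 + k^2) Eta^2, and vanishes. *)
Lemma momentum_identity x : U1 x * V2 x - U2 x * V1 x = c / 2 * Eta x.
Proof.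
pose J x := U1 x * V2 x - U2 x * V1 x - c / 2 * Eta x.
have h := primD (primD (prim_mul pU1 pV2) (primZ (-1) (prim_mul pU2 pV1))) (primZ (- (c / 2)) prim_Eta).
have pJ : prim J (fun _ => 0).
  apply: prim_ext h => y; rewrite /J /Eta /current; first ring.
  by field.
have JE := prim_const pJ.
pose k := J 0.
suff k0 : k = 0.
  by have := JE x 0; rewrite -/k k0 /J => /eqP; rewrite subr_eq0 => /eqP.
have Lb : lebL1 (fun x => 4 * kinetic x + (1 + k ^+ 2) * Eta x ^+ 2).
  by apply: L1D; apply: L1Z; [exact: kinetic_L1|case: hEta].
suff L : lebL1 (fun _ : R => k ^+ 2) by apply/eqP; rewrite -sqrf_eq0; apply/eqP; exact: L1_cst_eq0 L.
apply: (L1_le _ Lb) => // y; rewrite ger0_norm ?sqr_ge0//.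
have e0 := kinetic_ge0 y.
have -> : k = J y by exact: JE.
have [e1|e1] := leP (Eta y ^+ 2) 1; last first.
  rewrite mulrDl mul1r; have := sqr_ge0 (J y) => J0.
  have : J y ^+ 2 <= J y ^+ 2 * Eta y ^+ 2 by rewrite ler_peMr// ltW.
  have := sqr_ge0 (Eta y); lra.
have JJ : (U1 y * V2 y - U2 y * V1 y) ^+ 2 <= (1 - Eta y) * kinetic y.
  have -> : (1 - Eta y) * kinetic y = (U1 y * V2 y - U2 y * V1 y) ^+ 2 + current y ^+ 2.
    by rewrite /Eta /kinetic /current; ring.
  by rewrite lerDl sqr_ge0.
have En : - 1 <= Eta y.
  by rewrite leNgt; apply/negP => h1; move: e1; rewrite expr2; nra.
have : 0 <= J y ^+ 2 * Eta y ^+ 2 by rewrite mulr_ge0 ?sqr_ge0.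
have -> : (1 + J y ^+ 2) * Eta y ^+ 2 = Eta y ^+ 2 + J y ^+ 2 * Eta y ^+ 2 by ring.
move: (J y ^+ 2 * Eta y ^+ 2) => Z Z0.
rewrite /J; set a := U1 y * V2 y - _ in JJ *.
have JJ2 : a ^+ 2 <= 2 * kinetic y.
  by apply: (le_trans JJ); rewrite ler_wpM2r//; lra.
have bb : (c / 2 * Eta y) ^+ 2 = Eta y ^+ 2 / 2 by rewrite exprMn expr_div_n c2; field.
have := sqr_ge0 (a + c / 2 * Eta y).
have -> : (a + c / 2 * Eta y) ^+ 2 = a ^+ 2 + 2 * (a * (c / 2 * Eta y)) + (c / 2 * Eta y) ^+ 2 by ring.
have -> : (a - c / 2 * Eta y) ^+ 2 = a ^+ 2 - 2 * (a * (c / 2 * Eta y)) + (c / 2 * Eta y) ^+ 2 by ring.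
by rewrite bb /J -/a; lra.
Qed.

(** The equation gives Q' = |u'|^2 + c (U1 V2 - U2 V1) - |u|^2 g. By the momentum
identity and c^2 = 2, the middle term is Eta; and |u|^2 = 1 - Eta. *)
Lemma prim_current : prim current (fun x => kinetic x + Eta x - g x + Eta x * g x).
Proof.
have h := primD (prim_mul pU1 pV1) (prim_mul pU2 pV2).
apply: prim_ext h => x //.
have -> : Eta x = c * (U1 x * V2 x - U2 x * V1 x).
  by rewrite momentum_identity mulrA [c * _]mulrA -expr2 c2; field.
have E1 : U1 x ^+ 2 + U2 x ^+ 2 = 1 - Eta x by rewrite /Eta; ring.
have -> : c * (U1 x * V2 x - U2 x * V1 x) * g x = (1 - (U1 x ^+ 2 + U2 x ^+ 2)) * g x.
  by rewrite E1 momentum_identity mulrA [c * _]mulrA -expr2 c2; field.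
by rewrite /kinetic; ring.
Qed.

(** The derivative of Eta damp' + 2 Q damp has integral 0; expanding it with
[prim_Eta] and [prim_current], the terms with Q damp' cancel. *)
Lemma weighted_identity s : 0 < s ->
  Int (fun x => Eta x * (s ^+ 2 * (1 - s ^+ 2 * x ^+ 2) * damp s x))
  - 2 * Int (fun x => Eta x * damp s x) + 2 * Int (fun x => g x * damp s x)
  = Int (fun x => (2 * kinetic x + 2 * (Eta x * g x)) * damp s x).
Proof.
move=> s0.
have h1 := primD (prim_mul prim_Eta (prim_damp2 s)) (primZ 2 (prim_mul prim_current (prim_damp s))).
pose D2 x := s ^+ 2 * (1 - s ^+ 2 * x ^+ 2) * damp s x.
have Ld := damp_L1 s0; have hd := damp_rL2 s0.
have md := meas_damp s.
have bd x : `|damp s x| <= 1 by rewrite ger0_norm ?damp_ge0// damp_le1.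
have Led : lebL1 (fun x => kinetic x * damp s x).
  by apply: (L1_ext _ (L1_bM md bd kinetic_L1)) => x; rewrite mulrC.
have LEg : lebL1 (fun x => Eta x * g x) by exact: rL2_mul.
have LEgd : lebL1 (fun x => Eta x * g x * damp s x).
  by apply: (L1_ext _ (L1_bM md bd LEg)) => x; rewrite mulrC.
have LEd : lebL1 (fun x => Eta x * damp s x) by exact: rL2_mul.
have Lgd : lebL1 (fun x => g x * damp s x) by exact: rL2_mul.
have LED : lebL1 (fun x => Eta x * D2 x) by apply: rL2_mul => //; exact: x2damp_rL2.
set H := (fun x => _) in h1; set h := (fun x => _) in h1.
have LH : lebL1 H.
  have mQ := prim_meas prim_current.
  have LQ : lebL1 (fun x => current x * damp s x).
    apply: (L1_le _ (L1D (L1B Ld LEd) Led)); first exact: measurable_funM.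
    move=> x; rewrite normrM (ger0_norm (damp_ge0 _ _)) -[damp s x in X in _ <= X - _ + _]mul1r -mulrBl -mulrDl.
    rewrite ler_wpM2r ?damp_ge0// /Eta /kinetic /current ler_norml.
    have := sqr_ge0 (U1 x + V1 x); have := sqr_ge0 (U1 x - V1 x).
    have := sqr_ge0 (U2 x + V2 x); have := sqr_ge0 (U2 x - V2 x).
    have := sqr_ge0 (U1 x); have := sqr_ge0 (U2 x); have := sqr_ge0 (V1 x); have := sqr_ge0 (V2 x).
    by rewrite !expr2 => *; apply/andP; split; lra.
  by apply: L1D; [apply: rL2_mul => //; exact: xdamp_rL2|exact: L1Z].
have hE x : h x = (2 * (kinetic x * damp s x) + 2 * (Eta x * g x * damp s x)) -
     ((Eta x * D2 x - 2 * (Eta x * damp s x)) + 2 * (g x * damp s x)).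
  by rewrite /h /D2; ring.
have L1 := L1D (L1Z 2 Led) (L1Z 2 LEgd).
have L2 := L1B LED (L1Z 2 LEd).
have L3 := L1D L2 (L1Z 2 Lgd).
have Lh : lebL1 h by apply: (L1_ext _ (L1B L1 L3)) => x; rewrite hE.
have := prim_int0 LH Lh h1.
rewrite (Int_ext hE) (IntB L1 L3) (IntD L2 (L1Z 2 Lgd)) (IntB LED (L1Z 2 LEd)).
rewrite (IntZ 2 LEd) (IntZ 2 Lgd) => /eqP; rewrite subr_eq0 => /eqP <-.
by apply: Int_ext => x; ring.
Qed.

End ODE.

(** * The symbol at the critical speed *)

Section Limit.
Context {R : realType}.
Notation mu := (@lebesgue_measure R).
Implicit Types (f g h F : R -> R) (a b s x t : R).

(** In the variable y = x^2 / (2 s^2) this is y exp (- y) <= 1. *)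
Lemma gauss_x2_le s x : 0 < s -> x ^+ 2 * gauss s x <= 2 * s.
Proof.
move=> s0; pose y := x ^+ 2 / (s ^+ 2 *+ 2).
have y0 : 0 <= y by rewrite divr_ge0 ?sqr_ge0// mulrn_wge0// sqr_ge0.
have -> : gauss s x = normal_peak s * expR (- y) by rewrite /gauss /y mulNr.
have -> : x ^+ 2 = 2 * s ^+ 2 * y by rewrite /y; field; rewrite gt_eqF.
have E : y * expR (- y) <= 1.
  rewrite expRN ler_pdivrMr ?expR_gt0// mul1r.
  by apply: le_trans (expR_ge1Dx y); lra.
have ye0 : 0 <= y * expR (- y) by rewrite mulr_ge0// expR_ge0.
have P : s * normal_peak s <= 1.
  by rewrite mulrC -ler_pdivlMr// div1r normal_peak_le.
have P0 : 0 <= s * normal_peak s by rewrite mulr_ge0 ?normal_peak_ge0// ltW.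
have -> : 2 * s ^+ 2 * y * (normal_peak s * expR (- y)) = (2 * s) * ((s * normal_peak s) * (y * expR (- y))) by ring.
by rewrite ler_piMr ?mulr_ge0// ?(ltW s0)// mulr_ile1.
Qed.

Lemma gauss_x4_le s x : 0 < s -> x ^+ 4 * gauss s x <= 16 * s ^+ 3.
Proof.
move=> s0; pose y := x ^+ 2 / (s ^+ 2 *+ 2).
have y0 : 0 <= y by rewrite divr_ge0 ?sqr_ge0// mulrn_wge0// sqr_ge0.
have -> : gauss s x = normal_peak s * expR (- y) by rewrite /gauss /y mulNr.
have -> : x ^+ 4 = 4 * s ^+ 4 * y ^+ 2 by rewrite /y; field; rewrite gt_eqF.
have E : y ^+ 2 * expR (- y) <= 4.
  rewrite expRN ler_pdivrMr ?expR_gt0//.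
  have -> : expR y = expR (y / 2) ^+ 2 by rewrite expr2 -expRD; congr expR; field.
  have := expR_ge1Dx (y / 2); have := expR_gt0 (y / 2); move: (expR (y / 2)) => e e0 H.
  by rewrite !expr2; nra.
have ye0 : 0 <= y ^+ 2 * expR (- y) by rewrite mulr_ge0 ?expR_ge0// sqr_ge0.
have P : s * normal_peak s <= 1.
  by rewrite mulrC -ler_pdivlMr// div1r normal_peak_le.
have P0 : 0 <= s * normal_peak s by rewrite mulr_ge0 ?normal_peak_ge0// ltW.
have -> : 4 * s ^+ 4 * y ^+ 2 * (normal_peak s * expR (- y)) = (4 * s ^+ 3) * ((s * normal_peak s) * (y ^+ 2 * expR (- y))) by ring.
have -> : 16 * s ^+ 3 = 4 * s ^+ 3 * 4 by ring.
rewrite ler_wpM2l ?mulr_ge0 ?exprn_ge0 ?(ltW s0)//.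
by apply: le_trans E; rewrite ler_piMl.
Qed.

(** As (|x| + x^2)^2 <= 2 (x^2 + x^4), the moment bounds give
(m gauss)^2 <= C s gauss for s <= 1, whose integral is C s. The weighted
inequality [Int_mul_amgm] with weight sqrt s then bounds the pairing by a multiple
of sqrt s. *)
Lemma symbol_vanish (p m : R -> R) (K : R) : rL2 p -> measurable_fun setT m ->
  0 <= K -> {ae mu, forall x, `|m x| <= K * (`|x| + x ^+ 2)} ->
  (forall s, 0 < s -> lebL1 (fun x => p x * (m x * gauss s x))) ->
  Int (fun x => p x * (m x * gauss n.+1%:R^-1 x)) @[n --> \oo] --> (0 : R).
Proof.
move=> hp mm K0 mK Lm.
(* a representative of the symbol that satisfies the bound everywhere *)
pose m' x := if `|m x| <= K * (`|x| + x ^+ 2) then m x else 0.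
have mm' : measurable_fun setT m'.
  apply: measurable_fun_ifT => //; apply: measurable_fun_ler.
    exact: measurableT_comp.
  apply: measurable_funM => //; apply: measurable_funD; last exact: measurable_funX.
  exact: normr_measurable.
have m'K x : `|m' x| <= K * (`|x| + x ^+ 2).
  by rewrite /m'; case: ifP => // _; rewrite normr0 mulr_ge0// addr_ge0// sqr_ge0.
have bnd s x : 0 < s <= 1 -> (m' x * gauss s x) ^+ 2 <= (36 * K ^+ 2 * s) * gauss s x.
  move=> /andP[s0 s1]; have g0 := gauss_ge0 s x.
  have A1 := gauss_x2_le x s0; have A2 := gauss_x4_le x s0.
  rewrite exprMn [X in _ * X]expr2 mulrA ler_wpM2r//.
  have S : m' x ^+ 2 <= K ^+ 2 * (2 * (x ^+ 2 + x ^+ 4)).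
    apply: (@le_trans _ _ ((K * (`|x| + x ^+ 2)) ^+ 2)).
      rewrite -[m' x ^+ 2]real_normK ?num_real// lerXn2r ?nnegrE//.
      by rewrite mulr_ge0// addr_ge0// sqr_ge0.
    rewrite exprMn ler_wpM2l ?sqr_ge0//.
    have -> : x ^+ 4 = (x ^+ 2) ^+ 2 by rewrite -exprM.
    rewrite -[x ^+ 2 in X in _ <= _ * (X + _)]real_normK ?num_real//.
    have := sqr_ge0 (`|x| - x ^+ 2); rewrite !expr2; lra.
  apply: (@le_trans _ _ (K ^+ 2 * (2 * (x ^+ 2 + x ^+ 4)) * gauss s x)).
    by rewrite ler_wpM2r.
  have -> : K ^+ 2 * (2 * (x ^+ 2 + x ^+ 4)) * gauss s x =
     K ^+ 2 * (2 * (x ^+ 2 * gauss s x + x ^+ 4 * gauss s x)) by ring.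
  have -> : 36 * K ^+ 2 * s = K ^+ 2 * (36 * s) by ring.
  rewrite ler_wpM2l ?sqr_ge0//.
  have s3 : s ^+ 3 <= s.
    rewrite exprS ler_piMr ?(ltW s0)// exprn_ile1// ltW//.
  lra.
have hm' s : 0 < s <= 1 -> rL2 (fun x => m' x * gauss s x) /\
    Int (fun x => (m' x * gauss s x) ^+ 2) <= 36 * K ^+ 2 * s.
  move=> s01; have s0 : 0 < s by case/andP: s01.
  have Lg := L1Z (36 * K ^+ 2 * s) (gauss_L1_0 s0).
  have L2 : lebL1 (fun x => (m' x * gauss s x) ^+ 2).
    apply: (L1_le _ Lg) => [|x]; last by rewrite ger0_norm ?sqr_ge0// bnd.
    by apply: measurable_funX; apply: measurable_funM => //; exact: meas_gauss.
  split; first by split => //; apply: measurable_funM => //; exact: meas_gauss.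
  have <- : Int (fun x => (36 * K ^+ 2 * s) * gauss s x) = 36 * K ^+ 2 * s.
    rewrite -[RHS](gauss_IntZr (36 * K ^+ 2 * s) 0 (lt0r_neq0 s0)).
    by apply: Int_ext => x; rewrite subr0.
  by apply: Int_le => // x; exact: bnd.
pose B := Int (fun x => p x ^+ 2) + 36 * K ^+ 2.
have key (n : nat) : `|Int (fun x => p x * (m x * gauss n.+1%:R^-1 x))| <= Num.sqrt n.+1%:R^-1 * B.
  have s01 : 0 < (n.+1%:R^-1 : R) <= 1 by rewrite invr_gt0 ltr0n /= invf_le1 ?ltr0n// ler1n.
  move: (n.+1%:R^-1 : R) s01 => s s01.
  have s0 : 0 < s by case/andP: s01.
  have q0 : 0 < Num.sqrt s by rewrite sqrtr_gt0.
  have [h2 I2] := hm' s s01.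
  have -> : Int (fun x => p x * (m x * gauss s x)) = Int (fun x => p x * (m' x * gauss s x)).
    apply: Int_ae; [exact: L1_meas (Lm s s0)|exact: L1_meas (rL2_mul hp h2)|].
    by apply: (ae_imp mK) => x xK; rewrite /m' xK.
  apply: (le_trans (Int_mul_amgm q0 hp h2)).
  rewrite /B mulrDr lerD2l; apply: (@le_trans _ _ ((Num.sqrt s)^-1 * (36 * K ^+ 2 * s))).
    by rewrite ler_wpM2l// invr_ge0 ltW.
  rewrite -[s in X in X <= _](sqr_sqrtr (ltW s0)) le_eqVlt; apply/orP; left; apply/eqP.
  rewrite sqr_sqrtr ?(ltW s0)//.
  have {2}-> : s = Num.sqrt s ^+ 2 by rewrite sqr_sqrtr// ltW.
  by field; rewrite gt_eqF.
apply: norm_cvg0; apply: (@squeeze_cvgr _ _ _ _ (fun _ => 0) (fun n : nat => Num.sqrt n.+1%:R^-1 * B)).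
- by apply: nearW => n; rewrite normr_ge0 key.
- exact: cvg_cst.
- rewrite -(mul0r B); apply: cvgMl.
  rewrite -(sqrtr0 R).
  by apply: (@cvg_comp _ _ _ (fun n : nat => n.+1%:R^-1 : R) (@Num.sqrt R) _ _ _ invn_cvg0); exact: sqrt_continuous.
Qed.

(** Caratheodory's form of the derivative: h x - h 0 = k x * x with k continuous at
0, hence bounded near 0. *)
Lemma derivable_lip h : derivable h 0 1 -> exists (d C : R), [/\ 0 < d, 0 <= C &
  forall x, `|x| < d -> `|h x - h 0| <= C * `|x|].
Proof.
move=> /derivableP /is_derive1_caratheodory [k [hk ck _]].
have : \forall x \near 0, `|k x - k 0| < 1.
  by move/cvgrPdist_lt : ck => /(_ 1 ltr01); apply: filterS => x; rewrite distrC.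
move=> /nbhs_ballP[d /= d0 kd].
exists d, (`|k 0| + 1); split => // x xd.
rewrite hk subr0 normrM ler_wpM2r//.
have : `|k x - k 0| < 1 by apply: kd; rewrite /ball /= sub0r normrN.
move=> H; have := ler_normD (k x - k 0) (k 0); rewrite subrK; lra.
Qed.

(** Near 0 the symbol is t^2 + 2 (w(t) - w(0)), and w is Lipschitz at 0. At distance
at least d from 0 the bounded part is at most a multiple of |t|. *)
Lemma symbol_bound h w (M : R) : derivable h 0 1 -> h 0 = 1 -> (forall x, 0 <= w x <= M) ->
  {ae mu, forall x, h x = w x} ->
  exists K : R, 0 <= K /\ {ae mu, forall x, `|x ^+ 2 - 2 + 2 * w x| <= K * (`|x| + x ^+ 2)}.
Proof.
move=> /derivable_lip [d [C [d0 C0 hC]]] h01 wM hw.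
have M0 : 0 <= M by have /andP[] := wM 0; exact: le_trans.
have D0 : 0 <= (2 * M + 2) / d by apply: divr_ge0; [lra|exact: ltW].
exists (1 + 2 * C + (2 * M + 2) / d); split; first lra.
apply: (ae_imp hw) => x hwx; have /andP[w0 w1] := wM x.
have x20 := sqr_ge0 x; have nx0 := normr_ge0 x.
have D1 : 0 <= (2 * M + 2) / d * x ^+ 2 by rewrite mulr_ge0.
have D2 : 0 <= (2 * M + 2) / d * `|x| by rewrite mulr_ge0.
have C1 : 0 <= C * x ^+ 2 by rewrite mulr_ge0.
have C2 : 0 <= C * `|x| by rewrite mulr_ge0.
have E : x ^+ 2 - 2 + 2 * w x = x ^+ 2 + 2 * (w x - 1) by ring.
apply: (@le_trans _ _ (x ^+ 2 + 2 * `|w x - 1|)).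
  rewrite E; apply: (le_trans (ler_normD _ _)).
  by rewrite (ger0_norm x20) normrM (ger0_norm (ler0n R 2)).
have [xd|xd] := ltP `|x| d.
  by have := hC x xd; rewrite h01 hwx => H; move: D1 D2; lra.
have H1 : `|w x - 1| <= M + 1 by rewrite ler_norml; apply/andP; split; lra.
have H2 : 2 * M + 2 <= (2 * M + 2) / d * `|x|.
  rewrite mulrAC ler_pdivlMr// ler_wpM2l//; lra.
lra.
Qed.

Section Rigidity.
Variables (U1 U2 V1 V2 g : R -> R) (c : R).
Hypothesis c2 : c ^+ 2 = 2.
Hypothesis pU1 : prim U1 V1.
Hypothesis pU2 : prim U2 V2.
Hypothesis pV1 : prim V1 (fun x => c * V2 x - U1 x * g x).
Hypothesis pV2 : prim V2 (fun x => - c * V1 x - U2 x * g x).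
Hypothesis hV1 : rL2 V1.
Hypothesis hV2 : rL2 V2.
Hypothesis hg : rL2 g.
Hypothesis hEta : rL2 (Eta U1 U2).
Variables (p w : R -> R) (M : R).
Hypothesis hp : rL2 p.
Hypothesis mw : measurable_fun setT w.
Hypothesis wM : forall x, 0 <= w x <= M.
Variable K : R.
Hypothesis K0 : 0 <= K.
Hypothesis mK : {ae mu, forall x, `|x ^+ 2 - 2 + 2 * w x| <= K * (`|x| + x ^+ 2)}.
Hypothesis Etag_ge0 : 0 <= Int (fun x => Eta U1 U2 x * g x).
Hypothesis HA : forall s, 0 < s ->
  Int (fun x => Eta U1 U2 x * damp s x) = Int (fun t => p t * gauss s t).
Hypothesis HB : forall s, 0 < s ->
  Int (fun x => Eta U1 U2 x * (s ^+ 2 * (1 - s ^+ 2 * x ^+ 2) * damp s x)) =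
    Int (fun t => p t * (t ^+ 2 * gauss s t)).
Hypothesis HG : forall s, 0 < s ->
  Int (fun x => g x * damp s x) = Int (fun t => w t * p t * gauss s t).

Local Notation balance x := (2 * kinetic V1 V2 x + 2 * (Eta U1 U2 x * g x)).

Lemma t2gauss_rL2 s : 0 < s -> rL2 (fun t => t ^+ 2 * gauss s t).
Proof.
move=> s0; have [C [C0 HC]] := poly_gauss_bound 'X^2 s0.
have hg2 : rL2 (gauss (2 * s)).
  by have := gauss_shift_rL2 0 (mulr_gt0 (ltr0n R 2) s0); apply: rL2_ext => x; rewrite subr0.
apply: (rL2_le _ (rL2Z C hg2)).
  by apply: measurable_funM; [exact: measurable_funX|exact: meas_gauss].
move=> x; have := HC x; rewrite hornerXn [`|_ * gauss s x|]normrM (ger0_norm (gauss_ge0 s x)).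
by apply.
Qed.

Lemma symbol_L1 s : 0 < s -> lebL1 (fun x => p x * ((x ^+ 2 - 2 + 2 * w x) * gauss s x)).
Proof.
move=> s0; have L1 := rL2_mul hp (t2gauss_rL2 s0).
have hg1 : rL2 (gauss s).
  by have := gauss_shift_rL2 0 s0; apply: rL2_ext => x; rewrite subr0.
have b2 x : `|- 2 + 2 * w x| <= 2 + 2 * M.
  by have /andP[w0 w1] := wM x; rewrite ler_norml; apply/andP; split; lra.
have m2 : measurable_fun setT (fun x => - 2 + 2 * w x).
  by apply: measurable_funD => //; exact: measurable_funM.
have L2 := rL2_mul hp (rL2_bM m2 b2 hg1).
by apply: (L1_ext _ (L1D L1 L2)) => x; ring.
Qed.

(** The weighted identity, with its left-hand side moved to the Fourier side. *)
Lemma balance_spectral s : 0 < s ->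
  Int (fun x => balance x * damp s x) = Int (fun x => p x * ((x ^+ 2 - 2 + 2 * w x) * gauss s x)).
Proof.
move=> s0.
rewrite -(weighted_identity c2 pU1 pU2 pV1 pV2 hV1 hV2 hg hEta s0) (HA s0) (HB s0) (HG s0).
have hg1 : rL2 (gauss s).
  by have := gauss_shift_rL2 0 s0; apply: rL2_ext => x; rewrite subr0.
have L1 := rL2_mul hp (t2gauss_rL2 s0).
have L2 := rL2_mul hp hg1.
have bw x : `|w x| <= M by have /andP[w0 w1] := wM x; rewrite ger0_norm.
have L3 : lebL1 (fun t => w t * p t * gauss s t).
  by apply: (L1_ext _ (rL2_mul hp (rL2_bM mw bw hg1))) => x; rewrite mulrCA mulrA.
rewrite -(@IntZ _ 2 _ L2) -(@IntZ _ 2 _ L3) -(IntB L1 (L1Z 2 L2)) -(IntD (L1B L1 (L1Z 2 L2)) (L1Z 2 L3)).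
by apply: Int_ext => x; ring.
Qed.

Lemma balance_L1 : lebL1 (fun x => balance x).
Proof. exact: (L1D (L1Z 2 (kinetic_L1 hV1 hV2)) (L1Z 2 (rL2_mul hEta hg))). Qed.

Lemma balance_Int0 : Int (fun x => balance x) = 0.
Proof.
have sv := symbol_vanish hp _ K0 mK symbol_L1.
have /sv C0 : measurable_fun setT (fun x => x ^+ 2 - 2 + 2 * w x).
  apply: measurable_funD; last exact: measurable_funM.
  by apply: measurable_funB => //; exact: measurable_funX.
have C1 : Int (fun x => balance x * damp n.+1%:R^-1 x) @[n --> \oo] --> Int (fun x => balance x).
  have ml := L1_meas balance_L1.
  apply: (proj2 (Int_cvg_dom _ ml (L1_abs balance_L1) _ _)).
  - by move=> n; apply: measurable_funM => //; exact: meas_damp.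
  - move=> n x; rewrite normrM ler_piMr// ger0_norm ?damp_ge0//; exact: damp_le1.
  - apply: (ae_imp (ae_neq 0)) => x _; rewrite -[X in _ --> X]mulr1; apply: cvgMr; exact: damp_cvg.
apply: (cvg_unique _ C1); first exact: Rhausdorff.
rewrite (_ : (fun n : nat => _) = fun n : nat => Int (fun x => p x * ((x ^+ 2 - 2 + 2 * w x) * gauss n.+1%:R^-1 x))) //.
by apply/funext => n; apply: balance_spectral; rewrite invr_gt0.
Qed.

(** The balance is a sum of two nonnegative integrals, so the kinetic energy
vanishes and U1, U2 are constants; the defect is then a constant in L^2. *)
Lemma solution_const : exists k1 k2 : R, [/\ k1 ^+ 2 + k2 ^+ 2 = 1,
  forall x, U1 x = k1 & forall x, U2 x = k2].
Proof.
have LE := kinetic_L1 hV1 hV2; have Lh := rL2_mul hEta hg.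
have E0 : Int (kinetic V1 V2) = 0.
  have := balance_Int0; rewrite (IntD (L1Z 2 LE) (L1Z 2 Lh)) (IntZ 2 LE) (IntZ 2 Lh).
  have := Int_ge0 (kinetic_ge0 V1 V2); move: Etag_ge0.
  move: (Int _) (Int _) => a b; lra.
have eE := Int_eq0_ae LE (kinetic_ge0 V1 V2) E0.
have V0 x : kinetic V1 V2 x = 0 -> V1 x = 0 /\ V2 x = 0.
  by rewrite /kinetic => /eqP; rewrite paddr_eq0 ?sqr_ge0// !sqrf_eq0 => /andP[/eqP -> /eqP ->].
have V10 x (e : kinetic V1 V2 x = 0) : V1 x = 0 := proj1 (V0 x e).
have V20 x (e : kinetic V1 V2 x = 0) : V2 x = 0 := proj2 (V0 x e).
have c1 := prim_const (prim_ae (measurable_cst (0 : R)) (ae_imp eE V10) pU1).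
have c2' := prim_const (prim_ae (measurable_cst (0 : R)) (ae_imp eE V20) pU2).
exists (U1 0), (U2 0); split; [|by move=> x; exact: c1|by move=> x; exact: c2'].
have [_ L] := hEta.
have /L1_cst_eq0/eqP : lebL1 (fun _ : R => (1 - U1 0 ^+ 2 - U2 0 ^+ 2) ^+ 2).
  by apply: (L1_ext _ L) => x; rewrite /Eta (c1 x 0) (c2' x 0).
by rewrite sqrf_eq0 => /eqP; lra.
Qed.

End Rigidity.
End Limit.

(** * Weak solutions, and the conclusion *)

Section Weak.
Context {R : realType}.
Local Open Scope complex_scope.
Notation mu := (@lebesgue_measure R).
Implicit Types (f g h p : R -> R) (u v : R -> R[i]) (a b s x t : R).

Lemma chi_rL2 a b : rL2 (@chi R a b).
Proof.
split; first exact: meas_chi.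
by apply: (L1_ext _ (L1_chi a b)) => x; rewrite /chi; case: ifP => _; rewrite ?expr1n ?expr0n.
Qed.

(** Cut-offs are idempotent, so each factor can carry its own; measurability is
that of the limit of the cut-off functions. *)
Lemma L2loc_mul f g : (forall a b, rL2 (fun x => chi a b x * f x)) ->
  (forall a b, rL2 (fun x => chi a b x * g x)) -> L1loc (fun x => f x * g x).
Proof.
have meas h : (forall a b, rL2 (fun x => chi a b x * h x)) -> measurable_fun setT h.
  move=> H; apply: (measurable_fun_cvg (fun n : nat => proj1 (H (- n%:R) n%:R))) => x _.
  by rewrite -[X in _ --> X]mul1r; apply: cvgMl; exact: chi_cvg.
move=> hf hg; split; first by apply: measurable_funM; exact: meas.
move=> a b; apply: (L1_ext _ (rL2_mul (hf a b) (hg a b))) => x.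
by rewrite /chi; case: ifP => _; ring.
Qed.

Lemma rL2_L2loc g a b : rL2 g -> rL2 (fun x => chi a b x * g x).
Proof. by apply: rL2_bM (@chi_norm _ a b); exact: meas_chi. Qed.

Lemma L2loc_parts u a b : L2loc u ->
  rL2 (fun x => chi a b x * reP u x) /\ rL2 (fun x => chi a b x * imP u x).
Proof.
move=> /(_ `[a, b]%classic (@segment_compact _ a b)) [h1 h2].
split; [apply: (rL2_ext _ (Lfun2_rL2 h1))|apply: (rL2_ext _ (Lfun2_rL2 h2))] => x.
  by rewrite [LHS]/reP Re_mul /= mul0r subr0 chiE.
by rewrite [LHS]/imP Im_mul /= mul0r addr0 chiE.
Qed.

Lemma rtest_bound p : rtest p -> measurable_fun setT p /\
  exists B M : R, forall x, `|p x| <= M * chi (- B) B x.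
Proof.
move=> [sp cp].
have ctp : continuous p.
  by move=> x; apply: differentiable_continuous; apply/derivable1_diffP; exact: (sp 0%N x).
split; first exact: continuous_measurable_fun.
have [B [_ HB]] := compact_bounded cp.
have cI : compact (p @` closure [set x | p x != 0]).
  by apply: continuous_compact => //; exact: continuous_subspaceT.
have [M [_ HM]] := compact_bounded cI.
exists (`|B| + 1), (`|M| + 1) => x.
have [px|px] := eqVneq (p x) 0.
  by rewrite px normr0 mulr_ge0 ?chi_ge0// addr_ge0.
have cx : closure [set x | p x != 0] x by exact: subset_closure.
have lt (A : R) : A < `|A| + 1 by have := ler_norm A; lra.
have := HB _ (lt B) _ cx; have := HM _ (lt M) _ (ex_intro2 _ _ x cx erefl).
by rewrite /= [`|x| <= _]ler_norml /chi => pM ->; rewrite mulr1.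
Qed.

Lemma L1loc_test f p : L1loc f -> rtest p -> lebL1 (fun x => f x * p x).
Proof.
move=> [mf Lf] /rtest_bound [mp [B [M pM]]].
apply: (L1_le _ (L1Z M (L1_abs (Lf (- B) B)))); first exact: measurable_funM.
move=> x; rewrite !normrM (ger0_norm (chi_ge0 _ _ _)) mulrA mulrC.
by rewrite ler_wpM2r.
Qed.

Lemma derive1n_0 n : derive1n n (fun _ : R => 0 : R) = fun _ => 0.
Proof. by elim: n => // n IH; rewrite derive1Sn (_ : derive1 _ = fun _ => 0)//; apply/funext => x; exact: derive1_cst. Qed.

Lemma rtest_test p : rtest p -> test_function (fun x => (p x)%:C).
Proof.
move=> [sp cp]; split.
  move=> n x; split; first exact: sp.
  by rewrite (_ : imP _ = fun _ => 0)// derive1n_0.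
rewrite (_ : [set x | (p x)%:C != 0] = [set x | p x != 0])//.
by apply/seteqP; split => x /=; rewrite eq_complex /= eqxx andbT.
Qed.

(** A point outside the support of [p] has a neighbourhood where [p] is 0, so the
support does not grow. *)
Lemma rtest_derive p : rtest p -> rtest (derive1 p).
Proof.
move=> [sp cp]; split.
  by move=> n x; have := sp n.+1 x; rewrite derive1Sn.
apply: (subclosed_compact (@closed_closure _ _) cp).
have -> : closure [set x | p x != 0] = closure (closure [set x | p x != 0]).
  by apply/closure_id; exact: closed_closure.
apply: closure_subset => x /= px; apply: contrapT => nx.
have o : open (~` closure [set x | p x != 0]) by apply: closed_openC; exact: closed_closure.
move: px; rewrite derive1E (near_eq_derive (g := fun=> 0)) ?derive_cst ?eqxx//.
have := open_nbhs_nbhs (conj o nx); apply: filterS => y ny; apply/eqP; apply: contraT => py.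
by case: ny; exact: subset_closure.
Qed.

Lemma cderive_real p : cderive 1 (fun x => (p x)%:C) = fun x => (derive1 p x)%:C.
Proof.
apply/funext => x; rewrite /cderive.
by rewrite (_ : imP _ = fun _ => 0)// derive1n_0.
Qed.

Lemma dist_of_real u p : dist_of u (fun x => (p x)%:C) =
  Int (fun x => reP u x * p x) +i* Int (fun x => imP u x * p x).
Proof.
rewrite dist_ofE; congr (_ +i* _); apply: Int_ext => x.
  by rewrite [imP (fun x => (p x)%:C) x]/imP /= mulr0 subr0.
by rewrite [imP (fun x => (p x)%:C) x]/imP /= mulr0 add0r.
Qed.

Lemma weak_deriv_real u v p : weak_deriv u v -> rtest p ->
  - Int (fun x => reP u x * derive1 p x) = Int (fun x => reP v x * p x) /\
  - Int (fun x => imP u x * derive1 p x) = Int (fun x => imP v x * p x).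
Proof.
move=> H /rtest_test /H; rewrite /dist_deriv cderive_real !dist_of_real => E.
by split; [have := congr1 (@complex.Re R) E|have := congr1 (@complex.Im R) E].
Qed.

Lemma sqr_normC (z : R[i]) : 1 - `|z| ^+ 2 = (1 - complex.Re z ^+ 2 - complex.Im z ^+ 2)%:C.
Proof.
rewrite normc_def -rmorphXn /= sqr_sqrtr ?addr_ge0 ?sqr_ge0//.
by rewrite -addrA -opprD rmorphB.
Qed.

(** The real and imaginary parts of the equation tested against a real function,
with a for u paired with the derivative of the test function, b for u paired with
the second derivative and c for the nonlinear term. *)
Lemma equation_parts (k a1 a2 b1 b2 c1 c2 : R) :
  (0 +i* 1) * k%:C * (- (a1 +i* a2)) + - (- (b1 +i* b2)) + (c1 +i* c2) = 0 ->
  k * a2 + b1 + c1 = 0 /\ - k * a1 + b2 + c2 = 0.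
Proof.
by move=> [E1 E2]; split; [rewrite -[RHS]E1|rewrite -[RHS]E2]; ring.
Qed.

(** [weak_deriv_prim] is applied to u, which gives U1 and U2, and then to u', whose
weak derivative is read off from the equation. The functions u and u' are finally
replaced by their representatives, which they equal almost everywhere. *)
Lemma solution_prim u (g v : R -> R[i]) : energy_space u ->
  L2 g -> {ae mu, forall x, imP g x = 0} ->
  weak_deriv u v -> L2 v ->
  (forall phi : R -> R[i], test_function phi ->
      (0 +i* 1) * (Num.sqrt 2)%:C * dist_deriv (dist_of u) phi
      + dist_deriv (dist_deriv (dist_of u)) phi
      + dist_of (fun x => u x * g x) phi = 0) ->
  exists U1 U2 V1 V2 : R -> R,
  [/\ prim U1 V1, prim U2 V2,
      prim V1 (fun x => Num.sqrt 2 * V2 x - U1 x * reP g x),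
      prim V2 (fun x => - Num.sqrt 2 * V1 x - U2 x * reP g x) &
      [/\ rL2 V1, rL2 V2, {ae mu, forall x, reP u x = U1 x} &
          {ae mu, forall x, imP u x = U2 x}]].
Proof.
move=> [[uloc _] _ _] gL2 g20 wdu vL2 eqn.
have hg1 : rL2 (reP g) by apply: Lfun2_rL2; case: gL2.
have hg2 : rL2 (imP g) by apply: Lfun2_rL2; case: gL2.
have hv1 : rL2 (reP v) by apply: Lfun2_rL2; case: vL2.
have hv2 : rL2 (imP v) by apply: Lfun2_rL2; case: vL2.
have hu1 a b := proj1 (L2loc_parts a b uloc).
have hu2 a b := proj2 (L2loc_parts a b uloc).
have h1 a b : rL2 (fun x : R => chi a b x * 1).
  by apply: (rL2_ext _ (chi_rL2 a b)) => x; rewrite mulr1.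
have Lu1 : L1loc (reP u).
  have [m L] := L2loc_mul hu1 h1; split.
    by apply: eq_measurable_fun m => x _; rewrite mulr1.
  by move=> a b; apply: (L1_ext _ (L a b)) => x; rewrite mulr1.
have Lu2 : L1loc (imP u).
  have [m L] := L2loc_mul hu2 h1; split.
    by apply: eq_measurable_fun m => x _; rewrite mulr1.
  by move=> a b; apply: (L1_ext _ (L a b)) => x; rewrite mulr1.
have hg1l a b := rL2_L2loc a b hg1; have hg2l a b := rL2_L2loc a b hg2.
have Lu1g := L2loc_mul hu1 hg1l; have Lu2g := L2loc_mul hu2 hg1l.
have Lu1h := L2loc_mul hu1 hg2l; have Lu2h := L2loc_mul hu2 hg2l.
have Lv1 := rL2_L1loc hv1; have Lv2 := rL2_L1loc hv2.
have [U1 [pU1 eU1]] := weak_deriv_prim Lu1 Lv1 (fun p tp => proj1 (weak_deriv_real wdu tp)).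
have [U2 [pU2 eU2]] := weak_deriv_prim Lu2 Lv2 (fun p tp => proj2 (weak_deriv_real wdu tp)).
have EQ p : rtest p ->
   - Num.sqrt 2 * Int (fun x => imP v x * p x) - Int (fun x => reP v x * derive1 p x)
     + Int (fun x => reP u x * reP g x * p x) = 0 /\
   Num.sqrt 2 * Int (fun x => reP v x * p x) - Int (fun x => imP v x * derive1 p x)
     + Int (fun x => imP u x * reP g x * p x) = 0.
  move=> tp; have tp' := rtest_derive tp.
  have [A1 A2] := weak_deriv_real wdu tp; have [B1 B2] := weak_deriv_real wdu tp'.
  have [mp _] := rtest_bound tp.
  have C1 : Int (fun x => reP (fun x => u x * g x) x * p x) = Int (fun x => reP u x * reP g x * p x).
    transitivity (Int (fun x => (reP u x * reP g x - imP u x * imP g x) * p x)).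
      by apply: Int_ext => x; rewrite [reP (fun x => u x * g x) x]/reP Re_mul.
    apply: Int_ae.
    + by apply: measurable_funM => //; apply: measurable_funB; [case: Lu1g|case: Lu2h].
    + by apply: measurable_funM => //; case: Lu1g.
    + by apply: (ae_imp g20) => x ->; rewrite mulr0 subr0.
  have C2 : Int (fun x => imP (fun x => u x * g x) x * p x) = Int (fun x => imP u x * reP g x * p x).
    transitivity (Int (fun x => (reP u x * imP g x + imP u x * reP g x) * p x)).
      by apply: Int_ext => x; rewrite [imP (fun x => u x * g x) x]/imP Im_mul.
    apply: Int_ae.
    + by apply: measurable_funM => //; apply: measurable_funD; [case: Lu1h|case: Lu2g].
    + by apply: measurable_funM => //; case: Lu2g.
    + by apply: (ae_imp g20) => x ->; rewrite mulr0 add0r.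
  have := eqn _ (rtest_test tp).
  rewrite /dist_deriv !cderive_real !dist_of_real C1 C2 => E.
  have [E1 E2] := equation_parts E; split.
    by rewrite -A2 -B1 mulrNN opprK.
  by rewrite -A1 -B2 mulrN opprK -mulNr.
have W1 p : rtest p -> - Int (fun x => reP v x * derive1 p x) =
    Int (fun x => (Num.sqrt 2 * imP v x + (-1) * (reP u x * reP g x)) * p x).
  move=> tp; have [E _] := EQ p tp.
  rewrite [RHS](Int_ext (g := fun x => Num.sqrt 2 * (imP v x * p x) - reP u x * reP g x * p x)); last by move=> x; ring.
  have K1 := L1loc_test Lv2 tp; have K2 := L1loc_test Lu1g tp.
  rewrite (IntB (L1Z _ K1) K2) (IntZ _ K1).
  move: E; move: (Int _) (Int _) (Int _) => a b c; lra.
have W2 p : rtest p -> - Int (fun x => imP v x * derive1 p x) =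
    Int (fun x => (- Num.sqrt 2 * reP v x + (-1) * (imP u x * reP g x)) * p x).
  move=> tp; have [_ E] := EQ p tp.
  rewrite [RHS](Int_ext (g := fun x => - Num.sqrt 2 * (reP v x * p x) - imP u x * reP g x * p x)); last by move=> x; ring.
  have K1 := L1loc_test Lv1 tp; have K2 := L1loc_test Lu2g tp.
  rewrite (IntB (L1Z _ K1) K2) (IntZ _ K1).
  move: E; move: (Int _) (Int _) (Int _) => a b c; lra.
have [V1 [pV1 eV1]] := weak_deriv_prim Lv1 (L1locD (L1locZ (Num.sqrt 2) Lv2) (L1locZ (-1) Lu1g)) W1.
have [V2 [pV2 eV2]] := weak_deriv_prim Lv2 (L1locD (L1locZ (- Num.sqrt 2) Lv1) (L1locZ (-1) Lu2g)) W2.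
have mU1 := prim_meas pU1; have mU2 := prim_meas pU2.
have mV1 := prim_meas pV1; have mV2 := prim_meas pV2.
have mg1 := proj1 hg1.
exists U1, U2, V1, V2; split.
- exact: prim_ae pU1.
- exact: prim_ae pU2.
- apply: (prim_ae _ _ pV1); first by apply: measurable_funB; exact: measurable_funM.
  by apply: (ae_imp (ae_and eU1 eV2)) => x [-> ->]; rewrite mulN1r.
- apply: (prim_ae _ _ pV2); first by apply: measurable_funB; exact: measurable_funM.
  by apply: (ae_imp (ae_and eU2 eV1)) => x [-> ->]; rewrite mulN1r.
- by split => //; [exact: rL2_ae hv1|exact: rL2_ae hv2].
Qed.

End Weak.

Theorem theorem1p5 (R : realType) (W : tempered_distribution R)
    (What : R -> R[i])
    (W_real : td_real W) (W_even : td_even W)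
    (What_bounded : Lp +oo%E What) (What_fourier : fourier_is W What)
    (What_C2 : C2_near 0 What)
    (What_ge0 : {ae (@lebesgue_measure R), forall xi, 0 <= What xi})
    (What_0 : What 0 = 1)
    (What_2 : cderive 2 What 0 <> -1 \/
              (\forall xi \near (0 : R), cderive 2 What xi = -1)) :
  ~ exists u : R -> R[i],
      [/\ energy_space u, is_solution W u & ~ trivial_solution u].
Proof.
move=> [u [uE [g [conv eqn]] nt]]; apply: nt.
have [_ etaL2 [v [wdu vL2]]] := uE.
pose eta x := 1 - reP u x ^+ 2 - imP u x ^+ 2.
have etaE : (fun x => 1 - `|u x| ^+ 2) = fun x => (eta x)%:C%C.
  by apply/funext => x; rewrite sqr_normC.
rewrite etaE in etaL2 conv.
have heta : rL2 eta by apply: (Lfun2_rL2 (proj1 etaL2)).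
have [p [w [M [[hp mw wM ew] [hg g20 pos rels]]]]] :=
  convolution_spectral W_even What_bounded What_fourier What_ge0 heta conv.
have [gL2 _] := conv.
have [U1 [U2 [V1 [V2 [pU1 pU2 pV1 pV2 [hV1 hV2 eU1 eU2]]]]]] :=
  solution_prim uE gL2 g20 wdu vL2 eqn.
have [dW _ _] := nbhs_singleton What_C2 _ (or_introl (erefl (reP What))).
have W01 : reP What 0 = 1 by rewrite /reP What_0.
have [K [K0 mK]] := symbol_bound dW W01 wM ew.
have mE : measurable_fun setT (Eta U1 U2).
  have mU1 := prim_meas pU1; have mU2 := prim_meas pU2.
  by apply: measurable_funB; [apply: measurable_funB => //|]; exact: measurable_funX.
have eE : {ae (@lebesgue_measure R), forall x, eta x = Eta U1 U2 x}.
  by apply: (ae_imp (ae_and eU1 eU2)) => x [E1 E2]; rewrite /eta /Eta E1 E2.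
have hE : rL2 (Eta U1 U2) by exact: rL2_ae heta.
have sub (k : R -> R) : measurable_fun setT k ->
    Int (fun x => Eta U1 U2 x * k x) = Int (fun x => eta x * k x).
  move=> mk; apply: Int_ae; [exact: measurable_funM|apply: measurable_funM => //; exact: (proj1 heta)|].
  by apply: (ae_imp eE) => x ->.
have md2 s : measurable_fun setT (fun x : R => s ^+ 2 * (1 - s ^+ 2 * x ^+ 2) * damp s x).
  apply: measurable_funM; last exact: meas_damp.
  by apply: measurable_funM => //; apply: measurable_funB => //; apply: measurable_funM.
have c2 : Num.sqrt (2 : R) ^+ 2 = 2 by rewrite sqr_sqrtr.
have [k1 [k2 [k12 E1 E2]]] : exists k1 k2 : R, [/\ k1 ^+ 2 + k2 ^+ 2 = 1,
    forall x, U1 x = k1 & forall x, U2 x = k2].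
  apply: (solution_const c2 pU1 pU2 pV1 pV2 hV1 hV2 hg hE hp mw wM K0 mK).
  - by rewrite (sub _ (proj1 hg)).
  - by move=> s /rels [H _ _]; rewrite (sub _ (meas_damp s)).
  - by move=> s /rels [_ H _]; rewrite (sub _ (md2 s)).
  - by move=> s /rels [_ _ H].
exists (k1 +i* k2)%C; split; first by rewrite normc_def /= k12 sqrtr1.
apply: (ae_imp (ae_and eU1 eU2)) => x [R1 R2].
by rewrite [LHS]complexE -[complex.Re _]/(reP u x) -[complex.Im _]/(imP u x) R1 R2 E1 E2 [RHS]complexE.
Qed.
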